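(* Let $E$ be the vertex set of a countable, locally finite, connected graph with symmetric weights $c_{x,y}$ whose induced random walk is transient. Let $(L_{x,u})_{x\in E}$ be the field of occupation times, at level $u\ge 0$, of continuous-time random interlacements on $E$, under $\mathbb{P}$, let $P^G$ be the law on $\mathbb{R}^E$ of the Gaussian free field $(\varphi_x)_{x\in E}$, i.e. the centered Gaussian field with covariance $E^{P^G}[\varphi_x\varphi_y]=g(x,y)$, and let $x_0$ be a fixed point of $E$. Then, as $u\to\infty$: (1) $\big(\frac1u L_{x,u}\big)_{x\in E}$ (under $\mathbb{P}$) converges in distribution to the constant field equal to $1$; (2) $\Big(\dfrac{L_{x,u}-u}{\sqrt{2u}}\Big)_{x\in E}$ (under $\mathbb{P}$) converges in distribution to $(\varphi_x)_{x\in E}$ under $P^G$; (3) in particular, $\Big(\dfrac{L_{x,u}-L_{x_0,u}}{\sqrt{2u}}\Big)_{x\in E}$ (under $\mathbb{P}$) converges in distribution to $(\varphi_x-\varphi_{x_0})_{x\in E}$ under $P^G$. Here convergence in distribution means convergence in law of all finite-dimensional marginals.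
   Context: Weighted graph. $E$ is the vertex set of a countable, locally finite, connected graph, with weights $c_{x,y}=c_{y,x}\ge 0$, $x,y\in E$, that are positive exactly when $x\neq y$ and $\{x,y\}$ is an edge. Set $\lambda_x=\sum_{z\in E}c_{x,z}$ and $p_{x,y}=c_{x,y}/\lambda_x$. The discrete-time Markov chain on $E$ with transition probability $p_{x,y}$ (called simple random walk) is assumed transient. Walk and Green function. $P_x$ is the law under which $(Z_n)_{n\ge0}$ is simple random walk starting at $x$ and $(\sigma_n)_{n\ge 0}$ are i.i.d. exponential variables with parameter $1$, independent of $(Z_n)$; $E_x$ is the corresponding expectation. $X_t=Z_k$ for $\sigma_0+\dots+\sigma_{k-1}\le t<\sigma_0+\dots+\sigma_k$ is the continuous-time walk with jump rate $1$. The Green function is $g(x,y)=\frac1{\lambda_y}E_x\big[\int_0^\infty 1\{X_s=y\}\,ds\big]$, which is finite and symmetric. Equilibrium measure. For finite $K\subseteq E$, $e_K(x)=P_x[\widetilde H_K=\infty]\,\lambda_x\,1_K(x)$, where $\{\widetilde H_K=\infty\}$ is the event that $Z_n\notin K$ for all $n\ge1$. Continuous-time random interlacements. $\widehat W$ is the space of doubly infinite sequences $(Z_n,\sigma_n)_{n\in\mathbb{Z}}$ with values in $E\times(0,\infty)$ such that $(Z_n)_{n\in\mathbb{Z}}$ is a nearest-neighbor trajectory visiting each finite subset of $E$ only for finitely many $n$, and $\sum_{n\ge0}\sigma_n=\sum_{n<0}\sigma_n=\infty$; it carries its canonical $\sigma$-algebra. $\widehat W^*=\widehat W/\!\sim$,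 where $\widehat w\sim\widehat w'$ if $\widehat w(\cdot)=\widehat w'(\cdot+k)$ for some $k\in\mathbb{Z}$; $\pi^*:\widehat W\to\widehat W^*$ is the canonical map and $\widehat W^*$ carries the $\sigma$-algebra of sets whose inverse image under $\pi^*$ is measurable. For finite $K\subseteq E$, $\widehat Q_K$ is the finite measure on $\widehat W$ such that $\widehat Q_K(Z_0=x)=e_K(x)$ for $x\in E$ and, when $e_K(x)>0$, conditionally on $Z_0=x$, the sequences $(Z_n)_{n\ge0}$, $(Z_{-n})_{n\ge0}$, $(\sigma_n)_{n\in\mathbb{Z}}$ are independent and distributed respectively as simple random walk starting at $x$, as simple random walk starting at $x$ conditioned never to return to $K$ (at times $n\geq 1$), and as i.i.d. exponential variables with parameter $1$. There is a unique $\sigma$-finite measure $\widehat\nu$ on $\widehat W^*$ such that for every finite $K\subseteq E$ the restriction of $\widehat\nu$ to the set of $\widehat w^*$ whose $E$-valued trajectory enters $K$ equals the image of $\widehat Q_K$ under $\pi^*$ (its existence and uniqueness are known). On a probability space $(\Omega,\mathcal{A},\mathbb{P})$, $\omega=\sum_{i\ge0}\delta_{(\widehat w_i^*,u_i)}$ is a Poisson point process on $\widehat W^*\times\mathbb{R}_+$ with intensity measure $\widehat\nu(d\widehat w^* )\,du$. Occupation times. For $x\in E$, $u\ge0$, $$L_{x,u}(\omega)=\frac1{\lambda_x}\sum_{i\ge0}\sum_{n\in\mathbb{Z}}\sigma_n(\widehat w_i)\,1\{Z_n(\widehat w_i)=x,\ u_i\le u\},$$ where $\omega=\sum_{i\ge0}\delta_{(\widehat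 w_i^*,u_i)}$ and $\pi^*(\widehat w_i)=\widehat w_i^*$ for each $i$. *)

(* Defs.v *)
From HB Require Import structures.
From mathcomp Require Import all_boot all_order all_algebra finmap.
From mathcomp Require Import generic_quotient.
From mathcomp Require Import zify.
From mathcomp Require Import all_classical all_reals all_analysis.
From mathcomp Require Import measurable_realfun.

Set Implicit Arguments.
Unset Strict Implicit.
Unset Printing Implicit Defensive.
Import Order.TTheory GRing.Theory Num.Theory.
Import numFieldNormedType.Exports.
Local Open Scope classical_set_scope.
Local Open Scope ring_scope.

(* The events X_i \in B with B in M; they generate the sigma-algebra of the
   family X when M is the sigma-algebra of T. *)
Definition family_events (S I T : Type) (X : I -> S -> T)
    (M : set (set T)) : set (set S) :=
  \bigcup_i preimage_set_system setT (X i) M.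

(* I -> E and I -> R with their product sigma-algebras, E being discrete. *)
Definition vertex_paths (I : Type) (E : pointedType) :=
  g_sigma_algebraType
    (family_events (fun i (w : I -> E) => w i) discrete_measurable).

Definition real_fields (I : Type) (R : realType) :=
  g_sigma_algebraType
    (family_events (fun i (w : I -> R) => w i) measurable).

Record weighted_graph (R : realType) (E : pointedType) := WeightedGraph {
  edge : rel E ;
  weight : E -> E -> R ;
  countable_vertices : countable [set: E] ;
  edge_sym : symmetric edge ;
  locally_finite : forall x, finite_set [set y | edge x y] ;
  edge_connected : forall x y, exists2 s, path edge x s & y = last x s ;
  weight_sym : forall x y, weight x y = weight y x ;
  weight_ge0 : forall x y, 0 <= weight x y ;
  weight_gt0 : forall x y, (0 < weight x y) = (x != y) && edge x y }.

Section walk_laws.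
Context (R : realType) (E : pointedType) (G : weighted_graph R E).

Definition neighbors (x y : E) := (x != y) && edge G x y.

Definition total_weight (x : E) : R := \sum_(z \in [set: E]) weight G x z.

Definition trans_prob (x y : E) : R := weight G x y / total_weight x.

(* Under the probability mu on S, the sequence Z is the Markov chain with
   transition probability trans_prob started at x. *)
Definition is_srw (S : Type) (mu : set S -> \bar R) (Z : nat -> S -> E)
    (x : E) :=
  forall n (z : nat -> E),
    mu [set w | forall i, (i <= n)%N -> Z i w = z i] =
    ((z 0%N == x)%:R * \prod_(i < n) trans_prob (z i) (z i.+1))%:E.

Definition iid_exp1 (S : Type) (mu : set S -> \bar R) (I : choiceType)
    (s : I -> S -> R) :=
  forall (J : {fset I}) (B : I -> set R), (forall i, measurable (B i)) ->
    mu (\bigcap_(i in [set` J]) s i @^-1` B i) =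
    (\prod_(i <- J) exponential_prob 1 (B i))%E.

Definition walk_space := (vertex_paths nat E * real_fields nat R)%type.

Definition is_walk_law (P : probability walk_space R) (x : E) :=
  [/\ is_srw P (fun n w => w.1 n) x,
      iid_exp1 P (fun n w => w.2 n)
    & forall (A : set (vertex_paths nat E)) (B : set (real_fields nat R)),
        measurable A -> measurable B ->
        P (A `*` B) = (P (fst @^-1` A) * P (snd @^-1` B))%E].

End walk_laws.

(* A transient weighted graph together with the laws P_x of its walk. They are
   bundled because measurable types are pointed: transience is what provides an
   element of the space of doubly infinite trajectories below. *)
Record transient_network (R : realType) (E : pointedType) := TransientNetwork {
  graph :> weighted_graph R E ;
  walk : E -> probability (walk_space R E) R ;
  walkP : forall x, is_walk_law graph (walk x) x ;
  walk_transient : forall x,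
    walk x [set w | infinite_set [set n | w.1 n = x]] = 0%E }.

Lemma infinite_nat_cofinal (A : set nat) :
  infinite_set A <-> forall n, exists m, (n <= m)%N /\ A m.
Proof.
split=> [Ainf n|Acof /finite_seqP[s As]].
  apply: contrapT => /forallNP An; apply: Ainf.
  apply: (@sub_finite_set _ _ `I_n); last exact: finite_II.
  by move=> m Am /=; rewrite ltnNge; apply/negP => nm; exact: (An m).
have [m [sm]] := Acof (\max_(i <- s) i).+1.
by rewrite As/= => ms; move: sm; rewrite ltnNge leq_bigmax_seq.
Qed.

Section escaping_path.
Context (R : realType) (E : pointedType) (N : transient_network R E).
Implicit Types (x y : E) (h z : nat -> E) (n m : nat).

Let hist h n : set (vertex_paths nat E) :=
  [set w | forall i, (i <= n)%N -> w i = h i].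

Let measurable_coord i (B : set E) :
  measurable ((fun w : vertex_paths nat E => w i) @^-1` B).
Proof.
by apply: sub_sigma_algebra; exists i => //; exists B => //; rewrite setTI.
Qed.

Let measurable_hist h n : measurable (hist h n).
Proof.
rewrite [hist h n](_ : _ = \bigcap_(i in [set i | (i <= n)%N])
    (fun w : vertex_paths nat E => w i) @^-1` [set h i]); last first.
  by apply/seteqP; split.
by apply: bigcap_measurableType => i _; exact: measurable_coord.
Qed.

Let histories_cover : {hs : nat -> nat -> E |
  forall n w, exists k, hist (hs k) n w}.
Proof.
apply/cid; have /pcard_surjP[e e_surj] := countable_vertices N.
exists (fun k i => e (nth 0%N (odflt [::] (choice.unpickle k)) i)) => n w.
have /choice[c ec] x : exists k, e k = x.
  by have [k _ <-] := e_surj x I; exists k.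
exists (choice.pickle [seq c (w i) | i <- iota 0 n.+1]) => i lein.
rewrite choice.pickleK (_ : odflt _ _ = [seq c (w j) | j <- iota 0 n.+1])//.
by rewrite (nth_map 0%N) ?size_iota// nth_iota// ec.
Qed.

Let measurable_event (A : set (vertex_paths nat E)) :
  measurable A -> measurable (fst @^-1` A : set (walk_space R E)).
Proof.
move=> mA; rewrite -[X in measurable X]setTI.
exact: (@measurable_fst _ _ (vertex_paths nat E) (real_fields nat R)).
Qed.

Let measurable_shift n :
  measurable_fun setT
    (fun w : walk_space R E => (fun i => w.1 (n + i)%N) : vertex_paths nat E).
Proof.
apply: (@measurability _ _ (vertex_paths nat E * real_fields nat R)%type
  (vertex_paths nat E) _ _
  (family_events (fun i (w : nat -> E) => w i) discrete_measurable)) => //.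
move=> _ [_ [i _ [B _ <-]] <-]; rewrite !setTI.
exact: (measurable_event (measurable_coord (n + i) B)).
Qed.

Let histories : set (set (vertex_paths nat E)) :=
  [set A | A = set0 \/ exists h n, A = hist h n].

Let histories_setI : setI_closed histories.
Proof.
move=> A B [->|[h [n ->]]]; first by left; rewrite set0I.
case=> [->|[z [m ->]]]; first by left; rewrite setI0.
wlog lenm : h n z m / (n <= m)%N => [hw|].
  by case: (leqP n m) => [|/ltnW] lenm; [|rewrite setIC]; exact: hw.
have [hz|hz] := pselect (forall i, (i <= n)%N -> h i = z i).
  right; exists z, m; apply/seteqP; split=> [w []//|w zw]; split=> // i lein.
  by rewrite hz// zw// (leq_trans lein).
left; apply/seteqP; split=> // w [hw zw]; apply: hz => i lein.
by rewrite -hw// zw// (leq_trans lein).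
Qed.

Let measurable_histories :
  @measurable _ (vertex_paths nat E) = <<s histories >>.
Proof.
apply/seteqP; split; apply: smallest_sub.
- exact: smallest_sigma_algebra.
- move=> _ [i _ [B _ <-]]; have [hs hsP] := histories_cover.
  rewrite setTI [X in <<s _ >> X](_ : _ =
    \bigcup_k (if hs k i \in B then hist (hs k) i else set0)); last first.
    apply/seteqP; split=> w.
      move=> Bw; have [k kw] := hsP i w; exists k => //.
      by rewrite ifT// inE -kw.
    by move=> [k _]; case: ifPn => // /[!inE] Bk kw; rewrite /preimage/= kw.
  apply: (@sigma_algebra_bigcup _ setT) => k; apply: sub_sigma_algebra.
  by case: ifPn => _; [right; exists (hs k), i|left].
- exact: sigma_algebra_measurable.
- by move=> _ [->|[h [n ->]]]; [exact: measurable0|exact: measurable_hist].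
Qed.

(* the Markov property at time n, in the only case needed *)
Let markov0 x h n (A : set (vertex_paths nat E)) : measurable A ->
  walk N (h n) (fst @^-1` A) = 0%E ->
  walk N x [set w | hist h n w.1 /\ A (fun i => w.1 (n + i)%N)] = 0%E.
Proof.
move=> mA A0.
have mH := measurable_event (measurable_hist h n).
pose sh (w : walk_space R E) : vertex_paths nat E := fun i => w.1 (n + i)%N.
pose f0 (w : walk_space R E) : vertex_paths nat E := w.1.
have mf0 : measurable_fun setT f0 by exact: measurable_fst.
pose push :=
  @measure_function_pushforward__canonical__measure_function_Measure _ _
    (vertex_paths nat E * real_fields nat R)%type (vertex_paths nat E) R.
pose c := fine (walk N x (fst @^-1` hist h n)).
have c0 : 0 <= c by rewrite fine_ge0.
have cE : c%:E = walk N x (fst @^-1` hist h n).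
  by rewrite fineK// fin_num_measure.
have [m1 m1E] : exists m1 : {measure set vertex_paths nat E -> \bar R},
    forall B, m1 B = walk N x (sh @^-1` B `&` (fst @^-1` hist h n)).
  by exists (push (mrestr (walk N x) mH) _ (measurable_shift n)).
have [m2 m2E] : exists m2 : {measure set vertex_paths nat E -> \bar R},
    forall B, m2 B = (c%:E * walk N (h n) (fst @^-1` B))%E.
  by exists (mscale (NngNum c0) (push (walk N (h n)) _ mf0)).
suff : m1 A = m2 A.
  rewrite m1E m2E A0 mule0 => <-; congr (walk N x _).
  by apply/seteqP; split=> w [].
have [hs hsP] := histories_cover.
apply: (measure_unique histories (fun k => hist (hs k) 0%N)) => //.
- by move=> k; right; exists (hs k), 0%N.
- by apply/seteqP; split=> // w _; have [k kw] := hsP 0%N w; exists k.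
- move=> _ [->|[z [m ->]]]; first by rewrite !measure0.
  rewrite m1E m2E cE.
  have [/(_ x)[srwx _ _] /(_ (h n))[srwn _ _]] := (walkP N, walkP N).
  rewrite (srwx n h : walk N x (fst @^-1` hist h n) = _).
  rewrite (srwn m z : walk N (h n) (fst @^-1` hist z m) = _).
  have [z0|z0] := eqVneq (z 0%N) (h n); last first.
    rewrite mul0r mule0 (_ : _ `&` _ = set0) ?measure0//.
    apply/seteqP; split=> // w [/(_ 0%N isT)/= + /(_ n (leqnn n))/= wn].
    by rewrite /sh addn0 wn => /esym/eqP; rewrite (negbTE z0).
  pose hz i := if (i <= n)%N then h i else z (i - n)%N.
  rewrite [X in walk N x X](_ : _ = fst @^-1` hist hz (n + m)); last first.
    apply/seteqP; split=> w.
      move=> [/= zw hw] i lei; rewrite /hz; case: leqP => lin; first exact: hw.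
      by rewrite -zw ?leq_subLR// /sh subnKC// ltnW.
    move=> /= hzw; split=> i lei /=.
      rewrite /sh hzw ?leq_add2l// /hz; case: leqP => [|_].
        by rewrite -[X in (_ <= X)%N]addn0 leq_add2l leqn0 => /eqP ->; rewrite addn0.
      by rewrite addKn.
    by rewrite hzw ?(leq_trans lei) ?leq_addr// /hz lei.
  rewrite (srwx (n + m)%N hz : walk N x (fst @^-1` hist hz (n + m)) = _).
  rewrite -EFinM mul1r -mulrA big_split_ord/=; congr (_ * (_ * _))%:E.
  + by apply: eq_bigr => i _; rewrite /hz ltnW// ltn_ord.
  + apply: eq_bigr => i _; rewrite /hz ltnNge leq_addr/= -addnS !addKn.
    case: leqP => [|//].
    rewrite -[X in (_ <= X)%N]addn0 leq_add2l leqn0 => /eqP ->.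
    by rewrite addn0 z0.
- move=> k; rewrite m1E; apply: (le_lt_trans (probability_le1 _ _)).
    apply: measurableI => //; rewrite -[X in measurable X]setTI.
    exact: (measurable_shift n).
  exact: ltey.
Qed.

Lemma escaping_path : exists2 z : nat -> E,
  (forall n, neighbors N (z n) (z n.+1)) &
  forall x, finite_set [set n | z n = x].
Proof.
have [hs hsP] := histories_cover.
pose io y : set (vertex_paths nat E) := [set w | infinite_set [set n | w n = y]].
have mio y : measurable (io y).
  rewrite [io y](_ : _ = \bigcap_n \bigcup_(m in [set m | (n <= m)%N])
     (fun w : vertex_paths nat E => w m) @^-1` [set y]); last first.
    apply/seteqP; split=> w.
      move=> /infinite_nat_cofinal wy n _.
      by have [m [nm wm]] := wy n; exists m.
    move=> wy; apply/infinite_nat_cofinal => n.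
    by have [m nm wm] := wy n I; exists m.
  apply: bigcapT_measurable => n; apply: bigcup_measurable => m _.
  exact: measurable_coord.
pose B1 k n : set (walk_space R E) := [set w | hist (hs k) n.+1 w.1 /\
  ~~ neighbors N (w.1 n) (w.1 n.+1)].
pose B2 k n : set (walk_space R E) := [set w | hist (hs k) n w.1 /\
  io (hs k n) (fun i => w.1 (n + i)%N)].
have B10 k n : (walk N point).-negligible (B1 k n).
  have [nb|nb] := boolP (neighbors N (hs k n) (hs k n.+1)).
    exists set0; split=> //= w [hw] /negP; apply.
    by rewrite !hw// leqnSn.
  exists (fst @^-1` hist (hs k) n.+1); split; last by move=> w [].
    exact: measurable_event.
  have [srw _ _] := walkP N point.
  rewrite (srw n.+1 (hs k) : walk N point (fst @^-1` hist _ _) = _).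
  rewrite big_ord_recr/=.
  move: nb; rewrite /neighbors -weight_gt0 -leNgt => w0.
  have -> : trans_prob N (hs k n) (hs k n.+1) = 0.
    rewrite /trans_prob; suff -> : weight N (hs k n) (hs k n.+1) = 0.
      by rewrite mul0r.
    by apply/eqP; rewrite eq_le w0 weight_ge0.
  by rewrite !mulr0.
have B20 k n : (walk N point).-negligible (B2 k n).
  exists (B2 k n); split=> //; last first.
    by apply: markov0 => //; exact: (walk_transient N (hs k n)).
  apply: measurableI; first exact: measurable_event.
  rewrite -[X in measurable X]setTI.
  exact: (measurable_shift n).
have B12 : (walk N point).-negligible
    (\bigcup_k \bigcup_n (B1 k n `|` B2 k n)).
  apply: negligible_bigcup => k; apply: negligible_bigcup => n.
  exact: negligibleU.
have [w Bw] : exists w, ~ (\bigcup_k \bigcup_n (B1 k n `|` B2 k n)) w.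
  apply/existsNP => Ball; case: B12 => A [mA A0 BA].
  have := @probability_setT _ _ _ (walk N point).
  rewrite (_ : setT = A) ?A0; first by move/eqP; rewrite eqe eq_sym oner_eq0.
  by apply/seteqP; split=> // w _; apply: BA; exact: Ball.
exists w.1 => [n|y].
  apply/negP => /negP nb; apply: Bw.
  by have [k kw] := hsP n.+1 w.1; exists k => //; exists n => //; left.
apply: contrapT => wy; apply: Bw.
have [n wn] : exists n, w.1 n = y.
  apply: contrapT => /forallNP ny; apply: wy.
  by rewrite (_ : [set _ | _] = set0)//; apply/seteqP; split=> // n /ny.
have [k kw] := hsP n w.1; exists k => //; exists n => //; right; split=> //.
rewrite /io/= -(kw _ (leqnn n)) wn.
apply/infinite_nat_cofinal => m.
have /infinite_nat_cofinal/(_ (n + m)%N)[p [nmp wp]] := wy.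
exists (p - n)%N; split; first by rewrite leq_subRL// (leq_trans _ nmp)// leq_addr.
by rewrite /= subnKC// (leq_trans _ nmp)// leq_addr.
Qed.

End escaping_path.

Section green_function.
Context (R : realType) (E : pointedType) (N : transient_network R E).

(* X_t = y, for the continuous-time walk X of the jump chain w.1 with holding
   times w.2 *)
Definition walk_at (w : walk_space R E) (t : R) (y : E) :=
  exists k, [/\ \sum_(i < k) w.2 i <= t, t < \sum_(i < k.+1) w.2 i
              & w.1 k = y].

Definition green (x y : E) : \bar R :=
  (((total_weight N y)^-1)%:E *
    \int[walk N x]_w \int[lebesgue_measure]_(t in `[0%R, +oo[)
      (\1_[set s | walk_at w s y] t)%:E)%E.

Definition never_returns (K : {fset E}) : set (vertex_paths nat E) :=
  [set z | forall n, (1 <= n)%N -> z n \notin K].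

Definition equilibrium (K : {fset E}) (x : E) : \bar R :=
  (walk N x (fst @^-1` never_returns K) *
    (total_weight N x * (x \in K)%:R)%:E)%E.

End green_function.

Section trajectories.
Context (R : realType) (E : pointedType) (N : transient_network R E).

Record dtrajectory := DTrajectory {
  vertex : int -> E ;
  holding : int -> R ;
  holding_gt0 : forall n, 0 < holding n ;
  vertex_neighbors : forall n, neighbors N (vertex n) (vertex (n + 1)) ;
  vertex_transient : forall K : {fset E},
    finite_set [set n | vertex n \in K] ;
  holding_forward : (\sum_(0 <= n <oo) (holding n%:Z)%:E = +oo)%E ;
  holding_backward : (\sum_(0 <= n <oo) (holding (- n.+1%:Z))%:E = +oo)%E }.

HB.instance Definition _ := gen_eqMixin dtrajectory.
HB.instance Definition _ := gen_choiceMixin dtrajectory.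

Let dtrajectory_inhabited : $| dtrajectory |.
Proof.
have [z zN zfin] := escaping_path N.
have sum1 : (\sum_(0 <= n <oo) (1%R : R)%:E = +oo)%E.
  apply: eq_infty => r; have [n rn] : exists n, r <= n%:R :> R.
    by exists (Num.trunc r).+1; exact/ltW/truncnS_gt.
  apply: (@le_trans _ _ (\sum_(0 <= i < n) (1%R : R)%:E)%E).
    by rewrite sumEFin sumr_const_nat subn0 lee_fin.
  exact: nneseries_lim_ge.
apply: squash; apply: (@DTrajectory (fun n => z `|n|%N) (fun=> 1)) => //.
- move=> [] n; first by rewrite -PoszD addn1; exact: zN.
  have -> : absz (Negz n + 1) = n by lia.
  by rewrite /neighbors eq_sym edge_sym; exact: zN.
- move=> K.
  have zK : finite_set (\bigcup_(x in [set` K]) [set n | z n = x]).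
    exact: bigcup_finite.
  apply: (@sub_finite_set _ _
    ((Posz @` \bigcup_(x in [set` K]) [set n | z n = x]) `|`
     ((fun n => - Posz n) @` \bigcup_(x in [set` K]) [set n | z n = x]))).
    move=> n /= nK; have [n0|n0] := leP 0 n.
      by left; exists `|n|%N; [exists (z `|n|%N)|lia].
    by right; exists `|n|%N; [exists (z `|n|%N)|lia].
  by rewrite finite_setU; split; exact: finite_image.
Qed.

HB.instance Definition _ :=
  isPointed.Build dtrajectory (unsquash dtrajectory_inhabited).

Definition trajectories := g_sigma_algebraType
  (family_events (fun n w => vertex w n) discrete_measurable `|`
   family_events (fun n w => holding w n) measurable).

Definition shift_equiv : rel trajectories := fun w w' =>
  `[< exists k : int, forall n, vertex w n = vertex w' (n + k) /\
                                holding w n = holding w' (n + k) >].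

Let shift_equiv_refl : reflexive shift_equiv.
Proof. by move=> w; apply/asboolP; exists 0 => n; rewrite addr0. Qed.

Let shift_equiv_sym : symmetric shift_equiv.
Proof.
suff sym w w' : shift_equiv w w' -> shift_equiv w' w.
  by move=> w w'; apply/idP/idP; exact: sym.
move=> /asboolP[k wk]; apply/asboolP; exists (- k) => n.
by have [-> ->] := wk (n - k); rewrite subrK.
Qed.

Let shift_equiv_trans : transitive shift_equiv.
Proof.
move=> w2 w1 w3 /asboolP[k wk] /asboolP[l wl]; apply/asboolP.
exists (k + l) => n; have [-> ->] := wk n.
by have [-> ->] := wl (n + k); rewrite addrA.
Qed.

Canonical shift_equiv_rel :=
  EquivRel shift_equiv shift_equiv_refl shift_equiv_sym shift_equiv_trans.

Definition trajectories_mod_shift := {eq_quot shift_equiv_rel}%qT.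

HB.instance Definition _ := Choice.on trajectories_mod_shift.

Definition mod_shift (w : trajectories) : trajectories_mod_shift :=
  (\pi_{eq_quot shift_equiv_rel} w)%qT.

HB.instance Definition _ :=
  isPointed.Build trajectories_mod_shift (mod_shift point).

Definition mod_shift_display : measure_display. Proof. exact. Qed.

Let mod_shift_measurable : set (set trajectories_mod_shift) :=
  [set A | measurable (mod_shift @^-1` A)].

Let mod_shift_measurable0 : mod_shift_measurable set0.
Proof. by rewrite /mod_shift_measurable/= preimage_set0. Qed.

Let mod_shift_measurableC A :
  mod_shift_measurable A -> mod_shift_measurable (~` A).
Proof.
by rewrite /mod_shift_measurable/= preimage_setC; exact: measurableC.
Qed.

Let mod_shift_bigcup (F : (set trajectories_mod_shift)^nat) :
  (forall i, mod_shift_measurable (F i)) ->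
  mod_shift_measurable (\bigcup_i F i).
Proof.
rewrite /mod_shift_measurable/= preimage_bigcup => mF.
exact: bigcupT_measurable.
Qed.

HB.instance Definition _ := isMeasurable.Build mod_shift_display
  trajectories_mod_shift mod_shift_measurable0 mod_shift_measurableC
  mod_shift_bigcup.

End trajectories.

Section interlacements.
Context (R : realType) (E : pointedType) (N : transient_network R E).

Definition forward_path (w : trajectories N) : vertex_paths nat E :=
  fun n => vertex w n%:Z.

Definition backward_path (w : trajectories N) : vertex_paths nat E :=
  fun n => vertex w (- n%:Z).

Definition holding_times (w : trajectories N) : real_fields int R :=
  fun n => holding w n.

(* Qx is the conditional law given Z_0 = x. *)
Definition is_QK (K : {fset E}) (Q : set (trajectories N) -> \bar R) :=
  (forall x, Q [set w | vertex w 0 = x] = equilibrium N K x) /\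
  forall x, (0 < equilibrium N K x)%E ->
  let Qx (A : set (trajectories N)) :=
    (Q (A `&` [set w | vertex w 0 = x]) / Q [set w | vertex w 0 = x])%E in
  [/\ forall (A B : set (vertex_paths nat E)) (C : set (real_fields int R)),
        measurable A -> measurable B -> measurable C ->
        Qx (forward_path @^-1` A `&` backward_path @^-1` B `&`
            holding_times @^-1` C) =
        (Qx (forward_path @^-1` A) * Qx (backward_path @^-1` B) *
         Qx (holding_times @^-1` C))%E,
      forall A : set (vertex_paths nat E), measurable A ->
        Qx (forward_path @^-1` A) = walk N x (fst @^-1` A),
      forall B : set (vertex_paths nat E), measurable B ->
        Qx (backward_path @^-1` B) =
        (walk N x (fst @^-1` (B `&` never_returns K)) /
         walk N x (fst @^-1` never_returns K))%E
    & iid_exp1 Qx (fun n w => holding w n)].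

Definition enters (K : {fset E}) : set (trajectories_mod_shift N) :=
  @mod_shift R E N @` [set w | exists n, vertex w n \in K].

Definition is_interlacement_measure
    (Q : {fset E} -> set (trajectories N) -> \bar R)
    (nu : set (trajectories_mod_shift N) -> \bar R) :=
  forall (K : {fset E}) A, measurable A ->
    nu (A `&` enters K) = pushforward (Q K) (@mod_shift R E N) A.

Definition interlacement_intensity
    (nu : set (trajectories_mod_shift N) -> \bar R)
    (A : set (trajectories_mod_shift N * R)) : \bar R :=
  (nu \x lebesgue_measure)%E (A `&` (setT `*` `[0%R, +oo[)).

(* L_{x,a} of the point measure with points (mod_shift (w i), u i); under the
   law of the interlacements it is almost surely finite. *)
Definition occupation (w : nat -> trajectories N) (u : nat -> R)
    (x : E) (a : R) : \bar R :=
  (((total_weight N x)^-1)%:E *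
    \sum_(0 <= i <oo) \esum_(n in [set: int])
      (holding (w i) n * ((vertex (w i) n == x) && (u i <= a))%:R)%:E)%E.

End interlacements.

Section poisson_point_process.
Context d d' (Omega : measurableType d) (X : measurableType d')
  (R : realType).

(* The Poisson probabilities are written out because the library's
   poisson_pmf is constantly 1 at rate 0. *)
Record is_poisson_point_process (P : probability Omega R)
    (omega : Omega -> set X -> \bar R) (mu : set X -> \bar R) : Prop := {
  ppp_measurable : forall A, measurable A ->
    measurable_fun [set: Omega] (omega ^~ A : Omega -> \bar R) ;
  ppp_finite : forall A k, measurable A -> (mu A < +oo)%E ->
    P [set o | omega o A = k%:R%:E] =
    (expR (- fine (mu A)) * fine (mu A) ^+ k / k`!%:R)%:E ;
  ppp_infinite : forall A, measurable A -> mu A = +oo%E ->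
    P [set o | omega o A = +oo%E] = 1%E ;
  ppp_independent : forall n (A : 'I_n -> set X) (B : 'I_n -> set (\bar R)),
    (forall i, measurable (A i)) -> (forall i, measurable (B i)) ->
    trivIset setT A ->
    P (\bigcap_i [set o | B i (omega o (A i))]) =
    (\prod_(i < n) P [set o | B i (omega o (A i))])%E }.

End poisson_point_process.

Section gaussian_free_field.
Context (R : realType) (E : pointedType) (N : transient_network R E).

(* The library's normal_prob m 0 is not the degenerate Gaussian law. *)
Definition gaussian_law (m s : R) (B : set R) : \bar R :=
  if s == 0 then \d_m B else normal_prob m s B.

Definition is_gaussian_field (P : probability (real_fields E R) R) :=
  forall n (x : 'I_n -> E) (a : 'I_n -> R), exists m s,
    forall B, measurable B ->
      P [set phi | B (\sum_(i < n) a i * phi (x i))] = gaussian_law m s B.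

Record is_gff (P : probability (real_fields E R) R) : Prop := {
  gff_gaussian : is_gaussian_field P ;
  gff_centered : forall x, ('E_P[fun phi => phi x] = 0)%E ;
  gff_covariance : forall x y,
    ('E_P[fun phi => (phi x * phi y)%R] = green N x y)%E }.

End gaussian_free_field.

(* Convergence in law, as u -> +oo, of all finite-dimensional marginals of the
   field (Y u x)_x under P to those of (Y' x)_x under P'. *)
Definition cvg_in_fdd (R : realType) (E : Type) d d'
    (T : measurableType d) (T' : measurableType d')
    (P : probability T R) (Y : R -> E -> T -> R)
    (P' : probability T' R) (Y' : E -> T' -> R) :=
  forall n (x : 'I_n -> E) (f : 'rV[R]_n -> R),
    continuous f -> (exists M : R, forall v, `|f v| <= M) ->
    ('E_P[fun o => f (\row_(i < n) Y u (x i) o)])%E @[u --> +oo] -->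
    ('E_P'[fun o => f (\row_(i < n) Y' (x i) o)])%E.

(* Main.v *)
(* The argument goes through characteristic functions. Writing h_x(w) for the
   total time spent by the trajectory w at x, divided by lambda_x, the field
   L_{x,u} is the integral of h_x against a Poisson point process of intensity
   u nu, so that, for g = sum_i t_i h_{x_i} and by approximation with simple
   functions,
     E exp (i s (L_u(g) - u nu(g))) = exp (u nu (exp (i s g) - 1 - i s g)).
   With s = 1 / sqrt (2 u) the right-hand side tends to exp (- nu(g^2) / 4).
   Describing nu near a finite set K by Q_K, the Markov property and the last
   exit decomposition of K give nu(h_x) = 1 and nu(h_x h_y) = 2 g(x, y), hence
   the Gaussian limit with covariance g. Convergence of characteristic functions
   is turned into convergence in law by approximating a bounded continuous
   function, on large cubes, by trigonometric polynomials that are bounded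
   everywhere by the same constant, a second moment bound giving tightness. *)
Require Import Defs.
From HB Require Import structures.
From mathcomp Require Import all_boot all_order all_algebra finmap.
From mathcomp Require Import generic_quotient.
From mathcomp Require Import ring lra.
From mathcomp Require Import all_classical all_reals all_analysis.
From mathcomp Require Import measurable_realfun.

Set Implicit Arguments.
Unset Strict Implicit.
Unset Printing Implicit Defensive.
Import Order.TTheory GRing.Theory Num.Theory.
Import numFieldNormedType.Exports.
Local Open Scope classical_set_scope.
Local Open Scope ring_scope.

(** * Approximation by trigonometric polynomials *)

(** Complex exponentials are replaced by cosines with a free phase b: the phase -pi/2 turns a cosine
    into a sine, so no information is lost. The uniform bound B on the trigonometric polynomials is
    what lets an approximation on cubes suffice: outside the cube the error is at most 2 B, and
    Chebyshev's inequality makes the probability of being there small. The second moments of the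
    occupation times are bounded through the characteristic function, by expanding it at 0. The sum
    over all trajectories becomes finite, off a null event, because only trajectories entering a
    finite set K matter and these have finite intensity. As for the constants, nu(g^2) is twice the
    quadratic form of the Green function, two visits being possible in either order, so exp (-
    nu(g^2) / 4) belongs to a centered Gaussian variable whose variance is this form. Symmetry and
    finiteness of the Green function are read off the free field, whose covariance it is. The law of
    large numbers uses the same criterion, with a second moment of order 1 / u in place of the
    exponent. *)

Section bernstein.
Context (R : realType).
Implicit Types (p : R) (m n k : nat).

Definition bernstein_coef m p k : R := 'C(m, k)%:R * p ^+ k * (1 - p) ^+ (m - k).

Lemma bernstein_coef_ge0 m p k : 0 <= p <= 1 -> 0 <= bernstein_coef m p k.
Proof.
by move=> /andP[p0 p1]; rewrite !mulr_ge0// exprn_ge0// subr_ge0.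
Qed.

(** Pascal's rule: the binomial expectation of [F] is conditioned on one of the m + 1 Bernoulli
    trials. The moment identities below follow from it by induction. *)
Lemma bernstein_coefS m p (F : nat -> R) :
  \sum_(k < m.+2) bernstein_coef m.+1 p k * F k =
  p * \sum_(k < m.+1) bernstein_coef m p k * F k.+1 +
  (1 - p) * \sum_(k < m.+1) bernstein_coef m p k * F k.
Proof.
rewrite big_ord_recl [in X in _ = _ + X]big_ord_recl mulrDr addrCA.
rewrite {1 2}/bernstein_coef !bin0 !expr0 !subn0 !mul1r exprS -!mulrA; congr (_ + _).
  by rewrite /= bin0 expr0 subn0 !mul1r.
rewrite /=; have -> : \sum_(i < m) bernstein_coef m p (lift ord0 i) * F (lift ord0 i) =
    \sum_(i < m.+1) bernstein_coef m p i.+1 * F i.+1.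
  by rewrite [RHS]big_ord_recr/= /bernstein_coef bin_small// !mul0r addr0.
rewrite !mulr_sumr -big_split/=; apply: eq_bigr => i _.
rewrite /bernstein_coef binS natrD subSS exprS.
have [im|im] := ltnP i m.
  rewrite (_ : m - i = (m - i.+1).+1)%N; last by rewrite -subSn.
  by rewrite exprS; ring.
have -> : val i = m by apply/eqP; rewrite eqn_leq im -ltnS ltn_ord.
by rewrite binn bin_small//; ring.
Qed.

Lemma bernstein_coef_sum1 m p : \sum_(k < m.+1) bernstein_coef m p k = 1.
Proof.
under eq_bigr do rewrite -[bernstein_coef _ _ _]mulr1.
elim: m => [|m IH].
  by rewrite big_ord_recl big_ord0 /bernstein_coef/= bin0 subnn !expr0; ring.
by rewrite (bernstein_coefS m p (fun=> 1)) IH; ring.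
Qed.

(** The free shift [a] makes the induction work, since one more success shifts the argument by 1;
    the choice a = - m p gives the binomial variance. *)
Lemma bernstein_coef_sqr m p a : \sum_(k < m.+1) bernstein_coef m p k * (k%:R + a) ^+ 2 =
  (m%:R * p + a) ^+ 2 + m%:R * p * (1 - p).
Proof.
elim: m a => [|m IH] a.
  by rewrite big_ord_recl big_ord0 /bernstein_coef/= bin0 subnn !expr0; ring.
rewrite (bernstein_coefS m p (fun k => (k%:R + a) ^+ 2)) IH.
under eq_bigr do rewrite -natr1 -addrA.
by rewrite IH -natr1; ring.
Qed.

Lemma bernstein_coef_variance m p : 0 <= p <= 1 ->
  \sum_(k < m.+2) bernstein_coef m.+1 p k * (k%:R / m.+1%:R - p) ^+ 2 <= m.+1%:R^-1.
Proof.
move=> /andP[p0 p1].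
have := bernstein_coef_sqr m.+1 p (- (m.+1%:R * p)).
rewrite subrr expr0n/= add0r => /(congr1 (fun x => m.+1%:R^-1 ^+ 2 * x)).
rewrite mulr_sumr => h.
rewrite (eq_bigr (fun k : 'I_m.+2 => m.+1%:R^-1 ^+ 2 *
    (bernstein_coef m.+1 p k * (k%:R - m.+1%:R * p) ^+ 2))); last first.
  move=> k _; rewrite [RHS]mulrCA -exprMn; congr (_ * _ ^+ 2).
  by rewrite mulrBr mulKf ?pnatr_eq0// mulrC.
rewrite h.
rewrite expr2 -!mulrA mulKf ?pnatr_eq0//.
by rewrite ler_piMr ?invr_ge0// mulr_ile1 ?subr_ge0// lerBlDr lerDl.
Qed.

Definition bernstein_weight m n (p : 'rV[R]_n) (k : {ffun 'I_n -> 'I_m.+1}) :=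
  \prod_i bernstein_coef m (p ord0 i) (k i).

Definition bernstein_node m n (k : {ffun 'I_n -> 'I_m.+1}) : 'rV[R]_n :=
  \row_i ((k i)%:R / m%:R).

Definition bernstein m n (g : 'rV[R]_n -> R) (p : 'rV[R]_n) : R :=
  \sum_(k : {ffun 'I_n -> 'I_m.+1}) g (bernstein_node k) * bernstein_weight p k.

Definition unit_cube n : set 'rV[R]_n := [set p | forall i, 0 <= p ord0 i <= 1].

Lemma bernstein_weight_ge0 m n (p : 'rV[R]_n) (k : {ffun 'I_n -> 'I_m.+1}) :
  unit_cube p -> 0 <= bernstein_weight p k.
Proof. by move=> up; apply: prodr_ge0 => i _; exact: bernstein_coef_ge0. Qed.

Lemma bernstein_weight_sum1 m n (p : 'rV[R]_n) :
  \sum_(k : {ffun 'I_n -> 'I_m.+1}) bernstein_weight p k = 1.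
Proof.
rewrite -(bigA_distr_bigA (fun i (j : 'I_m.+1) => bernstein_coef m (p ord0 i) j)).
by rewrite big1// => i _; rewrite bernstein_coef_sum1.
Qed.

(** The weights form a product law: the coordinates other than [i] sum to one and a one-dimensional
    binomial variance remains. *)
Lemma bernstein_weight_variance m n (p : 'rV[R]_n) i : unit_cube p ->
  \sum_(k : {ffun 'I_n -> 'I_m.+2})
     bernstein_weight p k * (bernstein_node k ord0 i - p ord0 i) ^+ 2 <= m.+1%:R^-1.
Proof.
move=> up.
pose F j (l : 'I_m.+2) := bernstein_coef m.+1 (p ord0 j) l *
   (if j == i then (l%:R / m.+1%:R - p ord0 j) ^+ 2 else 1).
rewrite (eq_bigr (fun k : {ffun 'I_n -> 'I_m.+2} => \prod_j F j (k j))); last first.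
  move=> k _; rewrite /F big_split/=; congr (_ * _).
  rewrite (bigD1 i)//= eqxx big1 ?mulr1 /bernstein_node ?mxE//.
  by move=> j /negbTE ->.
rewrite -bigA_distr_bigA (bigD1 i)//= [X in _ * X]big1 ?mulr1.
  by rewrite /F eqxx; exact: bernstein_coef_variance.
move=> j /negbTE ji; rewrite /F ji.
by under eq_bigr do rewrite mulr1; rewrite bernstein_coef_sum1.
Qed.

Lemma unit_cube_compact n : compact (@unit_cube n).
Proof.
rewrite (_ : @unit_cube n = [set v | forall i, `[0, 1]%classic (v ord0 i)]).
  apply: (@rV_compact R n (fun=> `[0, 1]%classic)) => i; exact: segment_compact.
by apply/seteqP; split => p /= up i; have := up i; rewrite /= in_itv.
Qed.

(** Compactness of the cube, in covering form with the radius as parameter, gives one radius for all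
    [x]. The point [y] is left unrestricted, so that a Bernstein node can be inserted without
    showing that it lies in the cube. *)
Lemma uniform_continuity_cube n (g : 'rV[R]_n -> R) (e : R) :
  continuous g -> 0 < e -> exists2 d : R, 0 < d & forall x y : 'rV[R]_n, unit_cube x ->
    (forall i, `|x ord0 i - y ord0 i| < d) -> `|g x - g y| < e.
Proof.
move=> cg e0.
have /compact_near_coveringP/(_ R 0^'+
  (fun d x => forall y : 'rV[R]_n, (forall i, `|x ord0 i - y ord0 i| < d) -> `|g x - g y| < e)) :=
  @unit_cube_compact n.
case=> [x _|].
  have e2 : 0 < e / 2 by rewrite divr_gt0.
  have : \forall y \near (x : 'rV[R]_n), `|g x - g y| < e / 2.
    exact: (@cvgr_dist_lt _ _ _ _ _ g (g x) (cg x) _ e2).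
  move=> /nbhs_ballP[d/= d0 xd].
  exists (ball x (d / 2), [set d' | d' < d / 2]) => /=.
    split; first by apply: nbhsx_ballx; rewrite divr_gt0.
    by apply: nbhs_right_lt; rewrite divr_gt0.
  move=> [x' d'] /= [[_ xx']] dd' y x'y.
  have xx2 i : `|x ord0 i - x' ord0 i| < d / 2 by have := xx' ord0 i.
  have h1 : `|g x - g x'| < e / 2.
    apply: xd; split => // i j; rewrite (ord1 i); apply: (lt_trans (xx2 j)).
    by rewrite ltr_pdivrMr// ltr_pMr// ltr1n.
  have h2 : `|g x - g y| < e / 2.
    apply: xd; split => // i j; rewrite (ord1 i) /ball/=.
    apply: (le_lt_trans (ler_distD (x' ord0 j) _ _)).
    by rewrite [ltRHS](splitr d) ltrD// (lt_trans (x'y j)).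
  apply: (le_lt_trans (ler_distD (g x) _ _)).
  by rewrite [ltRHS](splitr e) ltrD// distrC.
move=> d /= d0 h; exists (d / 2); first by rewrite divr_gt0.
move=> x y ux xy; apply: (h (d / 2)) => //=; last by rewrite divr_gt0.
by rewrite sub0r normrN gtr0_norm ?divr_gt0// ltr_pdivrMr// ltr_pMr// ltr1n.
Qed.

(** On the cube the Bernstein values are convex combinations of values of [g]. This preservation of
    the bound is what singles out Bernstein polynomials among polynomial approximations. *)
Lemma bernstein_bound m n (g : 'rV[R]_n -> R) (B : R) (p : 'rV[R]_n) : (forall v, `|g v| <= B) ->
  unit_cube p -> `|bernstein m g p| <= B.
Proof.
move=> gB up; apply: (le_trans (ler_norm_sum _ _ _)).
rewrite -[leRHS]mulr1 -(bernstein_weight_sum1 m p) mulr_sumr; apply: ler_sum => k _.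
rewrite normrM (ger0_norm (bernstein_weight_ge0 _ up)).
by rewrite ler_wpM2r// bernstein_weight_ge0.
Qed.

Lemma bernstein_approx n (g : 'rV[R]_n -> R) (B e : R) : continuous g ->
  (forall v, `|g v| <= B) -> 0 < e ->
  exists m, forall p : 'rV[R]_n, unit_cube p -> `|bernstein m g p - g p| <= e.
Proof.
move=> cg gB e0.
have B0 : 0 <= B by apply: (le_trans _ (gB 0)).
have e2 : 0 < e / 2 by rewrite divr_gt0.
have [d d0 dP] := uniform_continuity_cube cg e2.
(* Chosen so that the variance term 2 B n / d^2 / (m + 1) is at most e / 2. *)
pose m := Num.trunc (2 * B * n%:R / d ^+ 2 / (e / 2)).
have C0 : 0 <= 2 * B / d ^+ 2 by rewrite divr_ge0 ?sqr_ge0 ?mulr_ge0.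
exists m.+1 => p up.
(* A near node is handled by uniform continuity; for a far one some squared coordinate difference is
   at least d^2, so the last term alone exceeds the trivial bound 2 B. *)
have step (k : {ffun 'I_n -> 'I_m.+2}) : `|g (bernstein_node k) - g p| <=
    e / 2 + 2 * B / d ^+ 2 * \sum_i (bernstein_node k ord0 i - p ord0 i) ^+ 2.
  have [kp|/existsNP[i kp]] :=
      pselect (forall i, `|p ord0 i - bernstein_node k ord0 i| < d).
    rewrite distrC (le_trans (ltW (dP _ _ up kp)))// lerDl mulr_ge0//.
    by apply: sumr_ge0 => i _; rewrite sqr_ge0.
  apply: (@le_trans _ _ (2 * B)).
    apply: (le_trans (ler_normB _ _)); rewrite mulr2n mulrDl mul1r.
    by rewrite lerD.
  rewrite -[leLHS]add0r lerD// ?(ltW e2)// -mulrA ler_peMr ?mulr_ge0//.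
  rewrite mulrC ler_pdivlMr ?exprn_gt0// mul1r (bigD1 i)//=.
  rewrite -[leLHS]addr0 lerD//; last by apply: sumr_ge0 => j _; rewrite sqr_ge0.
  rewrite -[leRHS]real_normK ?num_real// lerXn2r ?nnegrE ?normr_ge0 ?(ltW d0)//.
  by rewrite distrC leNgt; exact/negP.
rewrite /bernstein -[X in _ - X]mulr1 -(bernstein_weight_sum1 m.+1 p) mulr_sumr.
rewrite -sumrB; apply: (le_trans (ler_norm_sum _ _ _)).
apply: (@le_trans _ _ (\sum_(k : {ffun 'I_n -> 'I_m.+2}) bernstein_weight p k *
   (e / 2 + 2 * B / d ^+ 2 * \sum_i (bernstein_node k ord0 i - p ord0 i) ^+ 2))).
  apply: ler_sum => k _; rewrite -mulrBl normrM mulrC.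
  by rewrite (ger0_norm (bernstein_weight_ge0 _ up)) ler_wpM2l// bernstein_weight_ge0.
under eq_bigr do rewrite mulrDr.
rewrite big_split/= -mulr_suml bernstein_weight_sum1 mul1r [leRHS]splitr lerD2l.
under eq_bigr do rewrite mulrCA mulr_sumr.
rewrite -mulr_sumr exchange_big/=.
apply: (@le_trans _ _ (2 * B / d ^+ 2 * (n%:R * m.+1%:R^-1))).
  apply: ler_wpM2l => //.
  apply: (@le_trans _ _ (\sum_(i < n) m.+1%:R^-1)).
    by apply: ler_sum => i _; exact: bernstein_weight_variance.
  by rewrite sumr_const card_ord mulr_natl.
rewrite mulrA ler_pdivrMr// [leRHS]mulrC -ler_pdivrMr//.
by rewrite [X in X / (e / 2)]mulrAC ltW// truncnS_gt.
Qed.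

End bernstein.

(** * Trigonometric polynomials in several real variables *)

Section trigonometric_polynomials.
Context (R : realType) (n : nat).
Implicit Types (f g : 'rV[R]_n -> R) (y t : 'rV[R]_n) (b c : R).

Definition dotr t y : R := \sum_i t ord0 i * y ord0 i.

(** A triple consists of an amplitude, a frequency vector and a phase; the phase makes sines
    available without complex numbers. *)
Definition trig_eval (s : seq (R * 'rV[R]_n * R)) y : R :=
  \sum_(q <- s) q.1.1 * cos (dotr q.1.2 y + q.2).

Definition trig_poly f := exists s, f = trig_eval s.

Lemma dotrDl t t' y : dotr (t + t') y = dotr t y + dotr t' y.
Proof. by rewrite -big_split; apply: eq_bigr => i _; rewrite mxE mulrDl. Qed.

Lemma dotrNl t y : dotr (- t) y = - dotr t y.
Proof. by rewrite -sumrN; apply: eq_bigr => i _; rewrite mxE mulNr. Qed.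

Lemma trig_poly_cos c t b : trig_poly (fun y => c * cos (dotr t y + b)).
Proof. by exists [:: (c, t, b)]; apply/funext => y; rewrite /trig_eval big_seq1. Qed.

Lemma trig_poly_cst c : trig_poly (cst c).
Proof.
exists [:: (c, 0, 0)]; apply/funext => y; rewrite /trig_eval big_seq1/=.
by rewrite /dotr big1 ?addr0 ?cos0 ?mulr1// => i _; rewrite mxE mul0r.
Qed.

Lemma trig_polyD f g : trig_poly f -> trig_poly g -> trig_poly (fun y => f y + g y).
Proof.
move=> [s ->] [s' ->]; exists (s ++ s'); apply/funext => y.
by rewrite /trig_eval big_cat.
Qed.

Lemma trig_poly_sum (I : Type) (r : seq I) (F : I -> 'rV[R]_n -> R) :
  (forall i, trig_poly (F i)) -> trig_poly (fun y => \sum_(i <- r) F i y).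
Proof.
move=> tF; elim: r => [|i r IH].
  rewrite (_ : (fun _ => _) = cst 0); first exact: trig_poly_cst.
  by apply/funext => y; rewrite big_nil.
rewrite (_ : (fun _ => _) = fun y => F i y + \sum_(i <- r) F i y).
  exact: trig_polyD.
by apply/funext => y; rewrite big_cons.
Qed.

(** The product-to-sum formula 2 cos a cos b = cos (a + b) + cos (a - b), applied to each pair of
    terms. *)
Lemma trig_polyM f g : trig_poly f -> trig_poly g -> trig_poly (fun y => f y * g y).
Proof.
move=> [s ->] [s' ->].
rewrite (_ : (fun _ => _) = fun y => \sum_(q <- s) \sum_(r <- s')
  (q.1.1 * r.1.1 / 2 * cos (dotr (q.1.2 + r.1.2) y + (q.2 + r.2)) +
   q.1.1 * r.1.1 / 2 * cos (dotr (q.1.2 - r.1.2) y + (q.2 - r.2)))).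
  apply: trig_poly_sum => q; apply: trig_poly_sum => r.
  by apply: trig_polyD; exact: trig_poly_cos.
apply/funext => y; rewrite /trig_eval mulr_suml; apply: eq_bigr => q _.
rewrite mulr_sumr; apply: eq_bigr => r _.
rewrite !dotrDl dotrNl addrACA [X in _ + _ / 2 * cos X](_ : _ =
  (dotr q.1.2 y + q.2) - (dotr r.1.2 y + r.2)); last by ring.
by move: (dotr q.1.2 y + _) (dotr r.1.2 y + _) => a b; rewrite cosB (cosD a); field.
Qed.

Lemma trig_polyX f k : trig_poly f -> trig_poly (fun y => f y ^+ k).
Proof.
move=> tf; elim: k => [|k IH].
  by under eq_fun do rewrite expr0; exact: trig_poly_cst.
by under eq_fun do rewrite exprS; exact: trig_polyM.
Qed.

Lemma trig_poly_prod (I : Type) (r : seq I) (F : I -> 'rV[R]_n -> R) :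
  (forall i, trig_poly (F i)) -> trig_poly (fun y => \prod_(i <- r) F i y).
Proof.
move=> tF; elim: r => [|i r IH].
  rewrite (_ : (fun _ => _) = cst 1); first exact: trig_poly_cst.
  by apply/funext => y; rewrite big_nil.
rewrite (_ : (fun _ => _) = fun y => F i y * \prod_(i <- r) F i y).
  exact: trig_polyM.
by apply/funext => y; rewrite big_cons.
Qed.

Lemma trig_poly_sin_coord i c : trig_poly (fun y => sin (y ord0 i * c)).
Proof.
rewrite (_ : (fun _ => _) = fun y =>
    1 * cos (dotr (\row_j ((j == i)%:R * c)) y + - (pi / 2))).
  exact: trig_poly_cos.
apply/funext => y; rewrite mul1r cosBpihalf; congr sin.
rewrite /dotr (bigD1 i)//= big1; first by rewrite addr0 mxE eqxx mul1r mulrC.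
by move=> j /negbTE ji; rewrite mxE ji !mul0r.
Qed.

Lemma row_continuous (T : topologicalType) (F : T -> 'rV[R]_n) :
  (forall i : 'I_n, continuous (fun x => F x ord0 i)) -> continuous F.
Proof.
move=> cF x; apply/cvg_ballP => e e0.
have : \forall y \near x, forall i, `|F x ord0 i - F y ord0 i| < e.
  by apply: filter_forall => i; exact: (@cvgr_dist_lt _ _ _ _ _ _ _ (cF i x)).
by move=> h; apply: filterS h => y xy; split=> // i j; rewrite (ord1 i); exact: xy.
Qed.

(** Truncation to an interval strictly inside ]-1, 1[, where [asin] is continuous. The endpoint sin
    (1/2) is the value that the substitution sin (y / 2M) takes at y = M, so nothing is truncated on
    the cube of interest. *)
Let clamp (x : R) := Num.max (- sin 2^-1) (Num.min (sin 2^-1) x).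

Let half_pihalf : (2^-1 : R) < pi / 2.
Proof. by rewrite -[ltLHS]mul1r ltr_pM2r// (lt_le_trans _ (pi_ge2 R))// ltr1n. Qed.

Let sin_half_ge0 : 0 <= sin 2^-1 :> R.
Proof.
apply: sin_ge0_pi; rewrite invr_ge0 ler0n/=.
by rewrite (le_trans (ltW half_pihalf))// ler_pdivrMr// ler_peMr ?pi_ge0// ler1n.
Qed.

Let sin_half_lt1 : sin 2^-1 < 1 :> R.
Proof.
have h := half_pihalf.
by rewrite -[ltRHS]sin_pihalf ltr_sin// in_itv/=; apply/andP; split; lra.
Qed.

Let continuous_asin_clamp : continuous (fun x => asin (clamp x)).
Proof.
move=> x; apply: continuous_comp.
  apply: continuous_max; first exact: cvg_cst.
  by apply: continuous_min; [exact: cvg_cst|exact: cvg_id].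
apply: continuous_asin; rewrite /clamp; apply/andP; split.
  by rewrite lt_max ltrN2 sin_half_lt1.
by rewrite gt_max gt_min sin_half_lt1/= andbT ltrNl (lt_le_trans _ sin_half_ge0)// ltrN10.
Qed.

(* The substitution p_i = (1 + sin (y_i / 2M)) / 2 maps R^n into the unit cube,
   injectively on [-M, M]^n, and turns Bernstein polynomials in p into
   trigonometric polynomials in y that are bounded by sup |f| on all of R^n. *)
Lemma trig_poly_approx f (B M e : R) : continuous f -> (forall y, `|f y| <= B) ->
  0 < M -> 0 < e -> exists T, [/\ trig_poly T, forall y, `|T y| <= B &
    forall y, (forall i, `|y ord0 i| <= M) -> `|T y - f y| <= e].
Proof.
move=> cf fB M0 e0.
(* The function [f] read in the variable p, through an inverse of the substitution that the
   truncation extends continuously to all of R^n. *)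
pose g (p : 'rV[R]_n) := f (\row_i (2 * M * asin (clamp (2 * p ord0 i - 1)))).
pose sub y : 'rV[R]_n := \row_i ((1 + sin (y ord0 i * (2 * M)^-1)) / 2).
have usub y : unit_cube (sub y).
  move=> i; rewrite mxE.
  have := sin_geN1 (y ord0 i / (2 * M)); have := sin_le1 (y ord0 i / (2 * M)).
  by move=> ? ?; apply/andP; split; lra.
have cg : continuous g.
  move=> p; apply: continuous_comp; last exact: cf.
  apply: row_continuous => i {}p.
  rewrite (_ : (fun _ => _) = (fun p : 'rV[R]_n =>
    2 * M * asin (clamp (2 * p ord0 i - 1)))); last first.
    by apply/funext => q; rewrite mxE.
  apply: (@continuous_comp _ _ _ (fun p : 'rV[R]_n => p ord0 i)
    (fun x => 2 * M * asin (clamp (2 * x - 1)))); first exact: coord_continuous.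
  apply: cvgM; first exact: cvg_cst.
  apply: (@continuous_comp _ _ _ (fun x : R => 2 * x - 1) (fun x => asin (clamp x))).
    by apply: cvgB; [apply: cvgM; [exact: cvg_cst|exact: cvg_id]|exact: cvg_cst].
  exact: continuous_asin_clamp.
have gB p : `|g p| <= B by exact: fB.
have [m mP] := bernstein_approx cg gB e0.
exists (bernstein m g \o sub); split.
- apply: trig_poly_sum => k; apply: trig_polyM; first exact: trig_poly_cst.
  apply: trig_poly_prod => i; rewrite /bernstein_coef.
  have tp : trig_poly (fun y => sub y ord0 i).
    rewrite (_ : (fun _ => _) =
        fun y => (1 + sin (y ord0 i * (2 * M)^-1)) * 2^-1); last first.
      by apply/funext => y; rewrite mxE.
    apply: trig_polyM; last exact: trig_poly_cst.
    by apply: trig_polyD; [exact: trig_poly_cst|exact: trig_poly_sin_coord].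
  apply: trig_polyM.
    by apply: trig_polyM; [exact: trig_poly_cst|exact: trig_polyX].
  apply: trig_polyX; apply: trig_polyD; first exact: trig_poly_cst.
  under eq_fun do rewrite -mulN1r; apply: trig_polyM => //; exact: trig_poly_cst.
- by move=> y; exact: bernstein_bound.
- move=> y yM; suff <- : g (sub y) = f y by exact: mP.
  rewrite /g; congr f; apply/rowP => i; rewrite !mxE.
  have yi : - 2^-1 <= y ord0 i * (2 * M)^-1 <= 2^-1.
    rewrite -ler_norml normrM normfV (gtr0_norm (_ : 0 < 2 * M)) ?mulr_gt0//.
    by rewrite ler_pdivrMr ?mulr_gt0// mulKf.
  have h := half_pihalf.
  have p2 : (2^-1 : R) \in `[(- (pi / 2)), (pi / 2)].
    by rewrite in_itv/=; apply/andP; split; lra.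
  have pN2 : (- 2^-1 : R) \in `[(- (pi / 2)), (pi / 2)].
    by rewrite in_itv/=; apply/andP; split; lra.
  have py : y ord0 i * (2 * M)^-1 \in `[(- (pi / 2)), (pi / 2)]%R.
    move: p2 pN2 yi; rewrite !in_itv/= => /andP[_ a] /andP[b _] /andP[c d].
    by rewrite (le_trans b c) (le_trans d a).
  rewrite [X in clamp X](_ : _ = sin (y ord0 i * (2 * M)^-1)); last by field.
  have -> : clamp (sin (y ord0 i * (2 * M)^-1)) = sin (y ord0 i * (2 * M)^-1).
    move/andP: yi => [yl yr].
    rewrite /clamp min_r; last by rewrite leNgt ltr_sin// -leNgt.
    by rewrite max_r// -sinN leNgt ltr_sin// -leNgt.
  by rewrite sinK// mulrC divfK// mulf_neq0// gt_eqF.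
Qed.

End trigonometric_polynomials.

(** * From cosines to bounded continuous functions *)

Section convergence_criterion.
Context (R : realType).

Lemma bounded_integrable d (T : measurableType d) (mu : {finite_measure set T -> \bar R})
    (f : T -> R) (B : R) :
  measurable_fun setT f -> (forall x, `|f x| <= B) -> mu.-integrable setT (EFin \o f).
Proof.
move=> mf fB; apply: (@le_integrable _ _ _ _ _ measurableT _ (EFin \o cst B)).
- exact/measurable_EFinP.
- move=> x _; rewrite lee_fin (le_trans (fB x))// ger0_norm// (le_trans _ (fB x))//.
- exact: finite_measure_integrable_cst.
Qed.

(** Constants are integrable and |x| <= 1 + x^2. *)
Lemma integrable_of_sqr d (T : measurableType d) (P : {finite_measure set T -> \bar R})
    (X : T -> R) : measurable_fun setT X ->
  P.-integrable setT (EFin \o (fun o => X o ^+ 2)) -> P.-integrable setT (EFin \o X).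
Proof.
move=> mX iX2.
have i1 : P.-integrable setT (EFin \o (fun=> 1 : R)) by exact: finite_measure_integrable_cst.
apply: (@le_integrable _ _ _ _ _ measurableT _ (EFin \o (fun o => 1 + X o ^+ 2))).
- exact/measurable_EFinP.
- move=> o _ /=; rewrite lee_fin [leRHS]ger0_norm; last by rewrite addr_ge0// sqr_ge0.
  rewrite -subr_ge0 -[X o ^+ 2]real_normK ?num_real//.
  have -> : 1 + `|X o| ^+ 2 - `|X o| = (`|X o| - 1 / 2) ^+ 2 + 3 / 4 by field.
  by rewrite addr_ge0 ?sqr_ge0.
- exact: (integrableD measurableT i1 iX2).
Qed.

Lemma expectation_Rintegral d (T : measurableType d) (P : probability T R) (X : T -> R) :
  P.-integrable setT (EFin \o X) -> 'E_P[X]%E = (\int[P]_o X o)%:E.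
Proof.
by move=> iX; rewrite unlock /Rintegral fineK//; exact: integrable_fin_num.
Qed.

Section random_vector.
Context d (T : measurableType d) (P : probability T R) (n : nat) (V : T -> 'rV[R]_n).
Hypothesis mV : forall i, measurable_fun setT (fun o => V o ord0 i).

Lemma measurable_dotr t b : measurable_fun setT (fun o => dotr t (V o) + b).
Proof.
apply: measurable_funD => //; apply: measurable_sum => i.
exact: measurable_funM.
Qed.

Lemma measurable_cos_dotr t b : measurable_fun setT (fun o => cos (dotr t (V o) + b)).
Proof.
apply: (measurableT_comp (f := cos)); last exact: measurable_dotr.
by apply: continuous_measurable_fun; exact: continuous_cos.
Qed.

Lemma measurable_trig_poly (Q : 'rV[R]_n -> R) : trig_poly Q ->
  measurable_fun setT (Q \o V).
Proof.
move=> [s ->]; rewrite /comp /trig_eval; apply: measurable_sum => q.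
by apply: measurable_funM => //; exact: measurable_cos_dotr.
Qed.

(** Only the coordinates of [V] are known to be measurable. The composite is a pointwise limit of
    trigonometric polynomials in them, the k-th one being within 1 / (k + 1) of [f] on the cube of
    half-side k + 1. *)
Lemma measurable_bounded_continuous (f : 'rV[R]_n -> R) (B : R) : continuous f ->
  (forall v, `|f v| <= B) -> measurable_fun setT (f \o V).
Proof.
move=> cf fB.
have /choice[Q QP] (k : nat) : exists Q : 'rV[R]_n -> R, trig_poly Q /\
    forall y : 'rV[R]_n, (forall i, `|y ord0 i| <= k.+1%:R) -> `|Q y - f y| <= k.+1%:R^-1.
  have k0 : (0 : R) < k.+1%:R by [].
  have k1 : (0 : R) < k.+1%:R^-1 by rewrite invr_gt0.
  by have [Q [tQ _ Qf]] := trig_poly_approx cf fB k0 k1; exists Q.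
apply: (@measurable_fun_cvg _ _ _ setT (fun k => Q k \o V)) => [k|o _].
  by apply: measurable_trig_poly; have [] := QP k.
apply/cvgrPdist_le => e /= e0.
(* The first summand puts the point [V o] in the k-th cube, the second makes 1 / (k + 1) at most
   [e]. *)
exists ((Num.trunc (\sum_j `|V o ord0 j|)).+1 + (Num.trunc e^-1).+1)%N => // k /= hk.
rewrite distrC; apply: (@le_trans _ _ k.+1%:R^-1).
  have [_ /(_ (V o)) h] := QP k; apply: h => i.
  apply: (@le_trans _ _ (\sum_j `|V o ord0 j|)).
    by rewrite (bigD1 i)//= lerDl; apply: sumr_ge0.
  apply/ltW/(lt_le_trans (truncnS_gt _)); rewrite ler_nat.
  by rewrite (leq_trans _ (leqnSn k))// (leq_trans _ hk)// leq_addr.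
rewrite -[leRHS]invrK lef_pV2 ?posrE ?invr_gt0//.
apply/ltW/(lt_le_trans (truncnS_gt _)); rewrite ler_nat.
by rewrite (leq_trans _ (leqnSn k))// (leq_trans _ hk)// leq_addl.
Qed.

(** Chebyshev's inequality in integrated form: off the cube the integrands differ by at most 2 B,
    while some coordinate has square larger than M^2, so that 2 B / M^2 times the sum of squares
    dominates. *)
Lemma Rintegral_close (f Q : 'rV[R]_n -> R) (B e M C : R) :
  measurable_fun setT (f \o V) -> measurable_fun setT (Q \o V) ->
  (forall v, `|f v| <= B) -> (forall v, `|Q v| <= B) -> 0 < M -> 0 <= e ->
  (forall v : 'rV[R]_n, (forall i, `|v ord0 i| <= M) -> `|Q v - f v| <= e) ->
  (forall i, \int[P]_o ((V o ord0 i) ^+ 2)%:E <= C%:E)%E ->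
  `|\int[P]_o Q (V o) - \int[P]_o f (V o)| <= e + 2 * B / M ^+ 2 * (n%:R * C).
Proof.
move=> mf mQ fB QB M0 e0 Qf VC.
have B0 : 0 <= B by apply: (le_trans _ (fB 0)).
have K0 : 0 <= 2 * B / M ^+ 2 by rewrite divr_ge0 ?sqr_ge0 ?mulr_ge0.
have iQ := bounded_integrable P mQ (fun o => QB (V o)).
have ifV := bounded_integrable P mf (fun o => fB (V o)).
have mV2 i : measurable_fun setT (fun o => (V o ord0 i) ^+ 2) by exact: measurable_funX.
have mVS : measurable_fun setT (fun o => \sum_i (V o ord0 i) ^+ 2).
  exact: measurable_sum.
rewrite -RintegralB//; have iB : P.-integrable setT (EFin \o (fun o => Q (V o) - f (V o))).
  apply: (@bounded_integrable _ _ _ _ (B + B)); first exact: measurable_funB.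
  by move=> o; apply: (le_trans (ler_normB _ _)); exact: lerD.
rewrite -lee_fin EFin_normr_Rintegral//.
apply: (le_trans (le_abse_integral _ _ _)) => //; first exact: measurable_int iB.
apply: (@le_trans _ _ (\int[P]_o (e + 2 * B / M ^+ 2 * \sum_i (V o ord0 i) ^+ 2)%:E)%E).
  apply: ge0_le_integral => //.
  - by apply: measurableT_comp => //; exact: measurable_int iB.
  - apply/measurable_EFinP; apply: measurable_funD => //; exact: measurable_funM.
  move=> o _; rewrite lee_fin.
  have [Vo|/existsNP[i Vi]] := pselect (forall i, `|V o ord0 i| <= M).
    rewrite (le_trans (Qf _ Vo))// lerDl mulr_ge0// sumr_ge0// => i _.
    exact: sqr_ge0.
  apply: (@le_trans _ _ (2 * B)).
    by apply: (le_trans (ler_normB _ _)); rewrite mulr2n mulrDl mul1r lerD.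
  rewrite -[leLHS]add0r lerD// -mulrA ler_peMr ?mulr_ge0//.
  rewrite mulrC ler_pdivlMr ?exprn_gt0// mul1r (bigD1 i)//=.
  rewrite -[leLHS]addr0 lerD//; last by apply: sumr_ge0 => j _; rewrite sqr_ge0.
  rewrite -[leRHS]real_normK ?num_real// lerXn2r ?nnegrE ?normr_ge0 ?(ltW M0)//.
  by rewrite leNgt; apply/negP => /ltW.
under eq_integral do rewrite EFinD EFinM.
rewrite ge0_integralD//; last 2 first.
- by move=> o _; rewrite -EFinM lee_fin mulr_ge0// sumr_ge0// => i _; rewrite sqr_ge0.
- by apply: measurable_funeM; exact/measurable_EFinP.
rewrite integral_cst//= probability_setT mule1 EFinD; apply: leeD => //.
rewrite ge0_integralZl_EFin//; last 2 first.
- by move=> o _; rewrite lee_fin sumr_ge0// => i _; rewrite sqr_ge0.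
- exact/measurable_EFinP.
rewrite [leRHS]EFinM; apply: lee_wpmul2l => //.
under eq_integral do rewrite -sumEFin.
rewrite ge0_integral_sum//; last 2 first.
- by move=> i; exact/measurable_EFinP.
- by move=> i o _; rewrite lee_fin sqr_ge0.
apply: (@le_trans _ _ (\sum_(i < n) C%:E)%E); first exact: lee_sum.
by rewrite sumEFin sumr_const card_ord mulr_natl.
Qed.

End random_vector.

(** A continuity theorem with uniform second moments in the role of tightness: [f] is replaced by
    one trigonometric polynomial, at a small cost under both laws, and the cosines are assumed to
    converge. *)
Lemma cvg_bounded_continuous d d' (T : measurableType d) (T' : measurableType d')
    (P : probability T R) (P' : probability T' R) (n : nat) (Y : R -> T -> 'rV[R]_n)
    (Y' : T' -> 'rV[R]_n) (C : R) (f : 'rV[R]_n -> R) (B : R) :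
  (forall u i, measurable_fun setT (fun o => Y u o ord0 i)) ->
  (forall i, measurable_fun setT (fun o => Y' o ord0 i)) ->
  (\forall u \near +oo, forall i, (\int[P]_o ((Y u o ord0 i) ^+ 2)%:E <= C%:E)%E) ->
  (forall i, \int[P']_o ((Y' o ord0 i) ^+ 2)%:E <= C%:E)%E ->
  (forall t b, \int[P]_o cos (dotr t (Y u o) + b) @[u --> +oo] -->
     \int[P']_o cos (dotr t (Y' o) + b)) ->
  continuous f -> (forall v, `|f v| <= B) ->
  'E_P[fun o => f (Y u o)]%E @[u --> +oo] --> 'E_P'[fun o => f (Y' o)]%E.
Proof.
move=> mY mY' YC Y'C trigY cf fB.
have mfY u := measurable_bounded_continuous (mY u) cf fB.
have mfY' := measurable_bounded_continuous mY' cf fB.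
have -> : (fun u => 'E_P[fun o => f (Y u o)]%E) = EFin \o (fun u => \int[P]_o f (Y u o)).
  apply/funext => u; apply: expectation_Rintegral.
  exact: (bounded_integrable P (mfY u) (fun o => fB _)).
rewrite expectation_Rintegral; last exact: (bounded_integrable P' mfY' (fun o => fB _)).
apply: cvg_EFin; first by near=> u.
have trigQ Q : trig_poly Q ->
    \int[P]_o Q (Y u o) @[u --> +oo] --> \int[P']_o Q (Y' o).
  move=> [s ->]; elim: s => [|q s IH].
    rewrite /trig_eval; under eq_fun do under eq_Rintegral do rewrite big_nil.
    by under eq_Rintegral do rewrite big_nil; rewrite !Rintegral_cst//= !mul0r; exact: cvg_cst.
  have DE d1 (T1 : measurableType d1) (P1 : probability T1 R) (V : T1 -> 'rV[R]_n) :
      (forall i, measurable_fun setT (fun o => V o ord0 i)) ->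
      \int[P1]_o trig_eval (q :: s) (V o) =
      q.1.1 * \int[P1]_o cos (dotr q.1.2 (V o) + q.2) + \int[P1]_o trig_eval s (V o).
    move=> mV; rewrite -RintegralZl//; last first.
      apply: (@bounded_integrable _ _ _ _ 1); first exact: measurable_cos_dotr.
      by move=> o; exact: cos_max.
    rewrite -RintegralD//.
    - by apply: eq_Rintegral => o _; rewrite /trig_eval big_cons.
    - apply: (@bounded_integrable _ _ _ _ `|q.1.1|).
        by apply: measurable_funM => //; exact: measurable_cos_dotr.
      by move=> o; rewrite normrM ler_piMr// cos_max.
    - apply: (@bounded_integrable _ _ _ _ (\sum_(r <- s) `|r.1.1|)).
        by apply: (@measurable_trig_poly _ _ _ V mV (trig_eval s)); exists s.
      move=> o; apply: (le_trans (ler_norm_sum _ _ _)); apply: ler_sum => r _.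
      by rewrite normrM ler_piMr// cos_max.
  rewrite DE//; under eq_fun do rewrite DE//.
  by apply: cvgD => //; apply: cvgMr.
(* For n = 0 the moment bounds say nothing about the sign of [C]; the product is nonnegative in all
   cases. *)
have C0 : 0 <= n%:R * C.
  have [n0|n0] := posnP n; first by rewrite n0 mul0r.
  rewrite mulr_ge0// -lee_fin (le_trans _ (Y'C (Ordinal n0)))//.
  by apply: integral_ge0 => o _; rewrite lee_fin sqr_ge0.
have B0 : 0 <= B by apply: (le_trans _ (fB 0)).
apply/cvgrPdist_lt => e e0.
have e8 : 0 < e / 8 by rewrite divr_gt0.
(* With M = 1 + K the tail term 2 B n C / M^2 is at most e / 8, because K <= (1 + K)^2. *)
pose K := 2 * B * (n%:R * C) / (e / 8).
have K0 : 0 <= K by rewrite divr_ge0 ?(ltW e8)// mulr_ge0// mulr_ge0.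
have M0 : 0 < 1 + K by rewrite ltr_pwDl.
have [Q [tQ QB Qf]] := trig_poly_approx cf fB M0 e8.
have small : e / 8 + 2 * B / (1 + K) ^+ 2 * (n%:R * C) <= e / 4.
  have -> : e / 4 = e / 8 + e / 8 by field.
  rewrite lerD2l mulrAC ler_pdivrMr ?exprn_gt0// [leRHS]mulrC -ler_pdivrMr//.
  by rewrite -/K expr2 mulrDl mul1r -[leLHS]add0r -addrA lerD ?lerDl// mulr_ge0// ltW.
have /cvgrPdist_lt/(_ (e / 4)) := trigQ _ tQ.
rewrite divr_gt0// => /(_ isT) trQ.
near=> u.
have h1 : `|\int[P]_o Q (Y u o) - \int[P]_o f (Y u o)| <= e / 4.
  apply: (le_trans _ small); apply: Rintegral_close => //.
  - exact: measurable_trig_poly.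
  - exact: ltW.
  - by near: u.
have h2 : `|\int[P']_o Q (Y' o) - \int[P']_o f (Y' o)| <= e / 4.
  apply: (le_trans _ small); apply: Rintegral_close => //.
  - exact: measurable_trig_poly.
  - exact: ltW.
have h3 : `|\int[P']_o Q (Y' o) - \int[P]_o Q (Y u o)| < e / 4 by near: u.
apply: (le_lt_trans (ler_distD (\int[P']_o Q (Y' o)) _ _)).
rewrite [ltRHS](_ : e = e / 4 + (e / 4 + e / 4 + e / 4)); last by field.
apply: ler_ltD; first by rewrite distrC.
apply: (le_lt_trans (ler_distD (\int[P]_o Q (Y u o)) _ _)).
by rewrite -addrA ltr_leD// ler_wpDl// ltW// divr_gt0.
Unshelve. all: by end_near. Qed.

End convergence_criterion.

(** * Poisson functionals *)

Section poisson_cosine_series.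
Context (R : realType) (c : R).
Implicit Types (b x : R).

Let coef b k : R := cos (c * k%:R + b) / k`!%:R.

Let diffs_coef b : pseries_diffs (coef b) = coef (b + c).
Proof.
apply/funext => k; rewrite /pseries_diffs /coef factS natrM invfM mulrCA mulVKf ?pnatr_eq0//.
by congr (cos _ / _); rewrite -natr1; ring.
Qed.

Let cvg_coef b x : cvgn (pseries (coef b) x).
Proof.
apply: normed_cvg; rewrite /normed_series_of/=.
apply: (@series_le_cvg _ _ (exp_coeff `|x|)) => [n|n|n|].
- exact: normr_ge0.
- by rewrite /exp_coeff/= divr_ge0// exprn_ge0.
- rewrite /coef /exp_coeff/= !normrM normfV (ger0_norm (ler0n _ _)) normrX.
  rewrite -mulrA [X in _ * X]mulrC ler_piMl ?cos_max//.
- exact: is_cvg_series_exp_coeff.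
Qed.

Let G b x : R := limn (pseries (coef b) x).

(** Termwise differentiation shifts the index by one, hence the phase by [c]. *)
Let derive_G b x : is_derive x 1 (G b) (G (b + c) x).
Proof.
rewrite /G -diffs_coef; apply: (@pseries_snd_diffs _ _ (`|x| + 1)) => //.
- by rewrite diffs_coef.
- by rewrite !diffs_coef.
- by rewrite [ltRHS]ger0_norm// ltrDl.
Qed.

(** The addition formula for the cosine, term by term: every phase is a combination of the phases b
    and b - pi/2. *)
Let G_rot b b' x : G (b + b') x = cos b' * G b x - sin b' * G (b - pi / 2) x.
Proof.
apply/cvg_lim => //.
rewrite (_ : pseries _ x = cos b' \*: pseries (coef b) x -
    sin b' \*: pseries (coef (b - pi / 2)) x).
  by apply: cvgB; apply: cvgMr; exact: cvg_coef.
apply/funext => n; rewrite !fctE /pseries /series/= !scaler_sumr -sumrB.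
apply: eq_bigr => k _; rewrite /coef addrA cosD.
have -> : c * k%:R + (b - pi / 2) = (c * k%:R + b) - pi / 2 by ring.
by rewrite cosBpihalf /GRing.scale/=; ring.
Qed.

Let G0 b : G b 0 = cos b.
Proof.
apply/cvg_lim => //; rewrite -(cvg_shiftS _).
rewrite (_ : (fun _ => _) = cst (cos b)); first exact: cvg_cst.
apply/funext => n; rewrite /pseries /series/= big_nat_recl//= big1 ?addr0.
  by rewrite /coef expr0 mulr0 add0r divr1 mulr1.
by move=> i _; rewrite expr0n/= mulr0.
Qed.

(** This is the real part of the exponential series of x e^{ic}, multiplied by e^{ib}. The two sums
    with phases 0 and -pi/2 solve a linear differential system whose solution is an exponential
    times a rotation. *)
Lemma poisson_cos_series x b :
  series (fun k => x ^+ k / k`!%:R * cos (c * k%:R + b)) @ \oo -->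
  expR (x * cos c) * cos (x * sin c + b).
Proof.
rewrite (_ : (fun _ => _) = (fun k => coef b k * x ^+ k)); last first.
  by apply/funext => k; rewrite /coef; ring.
suff <- : G b x = expR (x * cos c) * cos (x * sin c + b) by exact: cvg_coef.
pose b0 := b + sin c * x.
pose A := G 0; pose D := G (0 - pi / 2).
have dA (y : R) : is_derive y 1 A (cos c * A y - sin c * D y).
  by rewrite -G_rot; exact: derive_G.
have dD (y : R) : is_derive y 1 D (sin c * A y + cos c * D y).
  rewrite (_ : _ + _ = cos (c - pi / 2) * A y - sin (c - pi / 2) * D y).
    rewrite -G_rot (_ : 0 + (c - pi / 2) = 0 - pi / 2 + c); last by ring.
    exact: derive_G.
  by rewrite cosBpihalf sinBpihalf; ring.
(* Undoing the exponential and the rotation gives a constant function. The phase [b0] is such that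
   phase [b] remains at y = x; at y = 0 the value is cos b0. *)
pose H (y : R) := expR (- cos c * y) *
  (cos (b0 - sin c * y) * A y - sin (b0 - sin c * y) * D y).
have dH (y : R) : is_derive y 1 H 0.
  rewrite /H; apply: trigger_derive.
  by rewrite /GRing.scale/=; ring.
have HE y : H y = expR (- cos c * y) * G (b0 - sin c * y) y.
  by rewrite /H -G_rot add0r.
have := is_derive_0_is_cst x 0 dH; rewrite !HE !mulr0 expR0 mul1r subr0 G0 /b0 addrK.
move=> /(congr1 ( *%R (expR (cos c * x)))).
rewrite mulrA -expRD mulNr subrr expR0 mul1r => ->.
by rewrite [cos c * _]mulrC [sin c * _]mulrC [b + _]addrC.
Qed.

End poisson_cosine_series.

Section independent_poisson.
Context (R : realType) d (T : measurableType d) (P : probability T R).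
Context (N : nat -> T -> \bar R) (law : nat -> set (\bar R) -> \bar R).
Context (m c : nat -> R).
Hypothesis mN : forall i, measurable_fun setT (N i).
Hypothesis lawT : forall i, law i setT = 1%E.
Hypothesis law1 : forall i k,
  law i [set k%:R%:E] = (expR (- m i) * m i ^+ k / k`!%:R)%:E.

(** The case c = 0 of the cosine series. *)
Lemma poisson_series_sum1 (x : R) :
  series (fun k => expR (- x) * x ^+ k / k`!%:R) @ \oo --> (1 : R).
Proof.
have h := @poisson_cos_series R 0 x 0.
rewrite cos0 sin0 mulr0 addr0 cos0 !mulr1 in h.
rewrite [X in _ --> X](_ : 1 = expR (- x) * expR x); last first.
  by rewrite mulrC expRxMexpNx_1.
rewrite (_ : series _ =
  expR (- x) \*: series (fun k => x ^+ k / k`!%:R * cos (0 * k%:R + 0))).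
  exact: cvgMr.
apply/funext => n; rewrite /series/= scaler_sumr; apply: eq_bigr => k _.
by rewrite /GRing.scale/= mul0r addr0 cos0 mulr1 mulrA.
Qed.

(** Induction on the number of variables. The event [D], of mass [p], records the values of the
    variables already fixed and is independent of the others; splitting it by the value of the last
    variable reduces to n variables with another phase, and the sum over that value is the Poisson
    cosine series. *)
Lemma independent_poisson_cos n (D : set T) (p b : R) : measurable D ->
  (forall B : nat -> set (\bar R), (forall i, measurable (B i)) ->
    P (D `&` \bigcap_(i < n) (N i @^-1` B i)) = (p%:E * \prod_(i < n) law i (B i))%E) ->
  \int[P]_(o in D) cos (\sum_(i < n) c i * fine (N i o) + b) =
  p * expR (\sum_(i < n) m i * (cos (c i) - 1)) * cos (\sum_(i < n) m i * sin (c i) + b).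
Proof.
elim: n D p b => [|n IH] D p b mD PD.
  have PDp : P D = p%:E.
    have := PD (fun=> setT) (fun=> measurableT).
    by rewrite big_ord0 mule1 bigcap_mkord big_ord0 setIT.
  rewrite (@eq_Rintegral _ _ _ P _ (cst (cos b))); last first.
    by move=> o _; rewrite big_ord0 add0r.
  by rewrite Rintegral_cst//= !big_ord0 expR0 add0r PDp/= mulr1 mulrC.
pose q k := expR (- m n) * m n ^+ k / k`!%:R.
pose D' k := D `&` N n @^-1` [set k%:R%:E].
have mNB i (B : set (\bar R)) : measurable B -> measurable (N i @^-1` B).
  by move=> mB; rewrite -[X in measurable X]setTI; exact: mN.
have mD' k : measurable (D' k) by apply: measurableI => //; exact: mNB.
have PD' k (B : nat -> set (\bar R)) : (forall i, measurable (B i)) ->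
    P (D' k `&` \bigcap_(i < n) (N i @^-1` B i)) =
    ((p * q k)%:E * \prod_(i < n) law i (B i))%E.
  move=> mB; pose B' i := if i == n then [set k%:R%:E] else B i.
  have B'lt i : (i < n)%N -> B' i = B i by move=> lin; rewrite /B' ltn_eqF.
  have B'n : B' n = [set k%:R%:E] by rewrite /B' eqxx.
  have mB' i : measurable (B' i) by rewrite /B'; case: ifP.
  have := PD B' mB'; rewrite big_ord_recr/= B'n law1.
  rewrite (eq_bigr (fun i : 'I_n => law i (B i))); last first.
    by move=> i _; rewrite B'lt.
  move=> PDB; rewrite EFinM -muleA [X in (_ * X)%E]muleC -PDB; congr (P _); apply/seteqP; split=> o.
    move=> [[Do No] h]; split=> // i /= ilt; rewrite /B'.
    case: eqVneq => [->//|ni]; apply: h => /=.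
    by rewrite ltn_neqAle ni -ltnS.
  move=> [Do h]; split; first split=> //.
    by have := h n (ltnSn n); rewrite /B' eqxx.
  by move=> i /= ilt; have := h i (leqW ilt); rewrite /= B'lt.
have PD'1 k : P (D' k) = (p * q k)%:E.
  have := PD' k (fun=> setT) (fun=> measurableT).
  rewrite big1 ?mule1// => <-; congr (P _); apply/seteqP; split=> o; last by case.
  by move=> h; split.
have PDp : P D = p%:E.
  have := PD (fun=> setT) (fun=> measurableT).
  rewrite big1 ?mule1// => <-; congr (P _); apply/seteqP; split=> o; last by case.
  by move=> h; split.
have trivD' : trivIset setT D'.
  apply/trivIsetP => i j _ _ ij; apply/seteqP; split=> // o [[_ /= No] [_ /=]].
  rewrite No => -[/eqP].
  by rewrite eqr_nat (negbTE ij).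
have cvgq : series (fun k => p * q k) @ \oo --> p.
  rewrite -[X in _ --> X]mulr1.
  rewrite (_ : series _ = p \*: series q); first by apply: cvgMr; exact: poisson_series_sum1.
  by apply/funext => j; rewrite /series/= scaler_sumr.
have mU : measurable (\bigcup_k D' k) by exact: bigcup_measurable.
(* The Poisson weights sum to one, so on [D] the last variable is almost surely a natural number and
   the pieces [D' k] exhaust [D] up to a null set. *)
have PU : P (\bigcup_k D' k) = p%:E.
  rewrite measure_bigcup//= (eq_eseriesr (fun k _ => PD'1 k)).
  rewrite (_ : (fun j : nat => _) = EFin \o series (fun k => p * q k)).
    by rewrite EFin_lim ?(cvg_lim _ cvgq)//; apply/cvg_ex; exists p.
  apply/funext => j; rewrite /series/= -sumEFin.
  by apply: eq_bigl => i; rewrite in_setT.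
pose f o := cos (\sum_(i < n.+1) c i * fine (N i o) + b).
have mf : measurable_fun setT f.
  apply: (measurableT_comp (f := cos)).
    by apply: continuous_measurable_fun; exact: continuous_cos.
  apply: measurable_funD => //; apply: measurable_sum => i.
  apply: measurable_funM => //; apply: measurableT_comp => //; exact: mN.
have iF A : measurable A -> P.-integrable A (EFin \o f).
  move=> mA; apply: (integrableS measurableT mA) => //.
  by apply: (@bounded_integrable _ _ _ P f 1) => // o; exact: cos_max.
have UD : \bigcup_k D' k `<=` D by move=> o [k _ []].
have N0 : P (D `\` \bigcup_k D' k) = 0%E.
  rewrite measureD//; last by rewrite (le_lt_trans (probability_le1 _ _))// ltry.
  by rewrite setIidr//= PU PDp subee.
rewrite -/f /Rintegral.
rewrite (negligible_integral _ _ _ N0)//; last 2 first.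
- exact: measurableD.
- exact: iF.
rewrite setDD setIidr// integral_bigcup//; last exact: iF.
pose E := expR (\sum_(i < n) m i * (cos (c i) - 1)).
pose th := \sum_(i < n) m i * sin (c i).
have step k : (\int[P]_(o in D' k) (EFin \o f) o =
    (p * q k * E * cos (th + (c n * k%:R + b)))%:E)%E.
  rewrite -(IH (D' k) (p * q k))//.
  rewrite /Rintegral.
  rewrite fineK.
    apply: eq_integral => o; rewrite inE => -[_ /= No].
    by rewrite /f big_ord_recr/= No/= addrA.
  apply: integrable_fin_num => //.
  apply: (eq_integrable _ (EFin \o f)) => //; last exact: iF.
  by move=> o; rewrite inE => -[_ /= No]; rewrite /f big_ord_recr/= No/= addrA.
  exact: PD'.
rewrite (eq_eseriesr (fun k _ => step k)).
have cvgs : series (fun k => p * q k * E * cos (th + (c n * k%:R + b))) @ \oo -->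
    p * E * expR (- m n) * (expR (m n * cos (c n)) * cos (m n * sin (c n) + (th + b))).
  rewrite (_ : series _ = (p * E * expR (- m n)) \*:
      series (fun k => m n ^+ k / k`!%:R * cos (c n * k%:R + (th + b)))).
    by apply: cvgMr; exact: poisson_cos_series.
  apply/funext => j; rewrite /series/= scaler_sumr; apply: eq_bigr => k _.
  by rewrite /q /GRing.scale/= [th + _]addrCA; ring.
rewrite (_ : (fun j : nat => _) =
    EFin \o series (fun k => p * q k * E * cos (th + (c n * k%:R + b)))); last first.
  by apply/funext => j; rewrite /series/= sumEFin.
rewrite EFin_lim; last by apply/cvg_ex; eexists; exact: cvgs.
rewrite (cvg_lim _ cvgs)//= !big_ord_recr/= expRD -/E -/th.
rewrite mulrBr mulr1 expRD addrA [_ + th]addrC; ring.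
Qed.

End independent_poisson.

(** * Taylor bounds for sine and cosine *)

Section trigonometric_bounds.
Context (R : realType).
Implicit Types x : R.

(** Each Taylor bound below is obtained from the preceding one, which states that the derivative of
    the new difference is nonnegative. *)
Lemma ge0_of_derive_ge0 (F dF : R -> R) x : F 0 = 0 ->
  (forall y : R, is_derive y 1 F (dF y)) -> (forall y, 0 <= y -> 0 <= dF y) ->
  0 <= x -> 0 <= F x.
Proof.
move=> F0 dFE dF0 x0; rewrite -F0.
apply: (@ger0_derive1_ndecry _ F 0) => //.
- move=> y; rewrite in_itv/= andbT => y0; rewrite derive1E.
  by have -> := @derive_val _ _ _ _ _ _ _ (dFE y); exact/dF0/ltW.
- apply: continuous_subspaceT => y.
  by apply/differentiable_continuous/derivable1_diffP; exact: ex_derive.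
Qed.

Lemma sin_le_id x : 0 <= x -> sin x <= x.
Proof.
move=> x0; rewrite -subr_ge0.
apply: (@ge0_of_derive_ge0 (fun y => y - sin y) (fun y => 1 - cos y)) => //.
by rewrite sin0 subr0.
Qed.

Lemma cos_ge_quadratic x : 1 - x ^+ 2 / 2 <= cos x.
Proof.
wlog x0 : x / 0 <= x.
  by move=> h; case: (leP 0 x) => [/h//|x0]; rewrite -sqrrN -cosN h// oppr_ge0 ltW.
rewrite -subr_ge0.
apply: (@ge0_of_derive_ge0 (fun y => cos y - (1 - y ^+ 2 / 2)) (fun y => y - sin y)) => //.
- by rewrite cos0 expr0n/= mul0r !subr0 subrr.
- move=> y; apply: trigger_derive; rewrite /GRing.scale/=; by field.
- by move=> y y0; rewrite subr_ge0 sin_le_id.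
Qed.

Lemma sin_ge_cubic x : 0 <= x -> x - x ^+ 3 / 6 <= sin x.
Proof.
move=> x0; rewrite -subr_ge0.
apply: (@ge0_of_derive_ge0 (fun y => sin y - (y - y ^+ 3 / 6))
  (fun y => cos y - (1 - y ^+ 2 / 2))) => //.
- by rewrite sin0 expr0n/= mul0r !subr0.
- move=> y; apply: trigger_derive; rewrite /GRing.scale/=; by field.
- by move=> y y0; rewrite subr_ge0 cos_ge_quadratic.
Qed.

Lemma cos_le_quartic x : cos x <= 1 - x ^+ 2 / 2 + x ^+ 4 / 24.
Proof.
wlog x0 : x / 0 <= x.
  move=> h; case: (leP 0 x) => [/h//|x0]; rewrite -cosN.
  by have := h (- x); rewrite sqrrN exprNn -signr_odd/= expr0 mul1r; apply; rewrite oppr_ge0 ltW.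
rewrite -subr_ge0.
apply: (@ge0_of_derive_ge0 (fun y => 1 - y ^+ 2 / 2 + y ^+ 4 / 24 - cos y)
  (fun y => sin y - (y - y ^+ 3 / 6))) => //.
- by rewrite cos0 !expr0n/= !mul0r !subr0 addr0 subrr.
- move=> y; apply: trigger_derive; rewrite /GRing.scale/=; by field.
- by move=> y y0; rewrite subr_ge0 sin_ge_cubic.
Qed.

Lemma sin_sub_cubic x : `|sin x - x| <= `|x| ^+ 3 / 6.
Proof.
wlog x0 : x / 0 <= x.
  move=> h; case: (leP 0 x) => [/h//|x0].
  have := h (- x); rewrite sinN -opprD !normrN; apply; rewrite oppr_ge0 ltW//.
rewrite (ger0_norm x0) ler0_norm ?subr_le0 ?sin_le_id//.
by have := sin_ge_cubic x0; lra.
Qed.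

(** A quadratic bound valid for all [x], so that second moments control the compensated sine. For x
    > 2 it comes from the trivial estimate x + 1. *)
Lemma sin_sub_sqr x : `|sin x - x| <= x ^+ 2.
Proof.
wlog x0 : x / 0 <= x.
  move=> h; case: (leP 0 x) => [/h//|x0].
  by have := h (- x); rewrite sinN -opprD normrN sqrrN; apply; rewrite oppr_ge0 ltW.
have := sin_sub_cubic x; rewrite (ger0_norm x0) => h.
have [x2|x2] := leP x 2.
  apply: (le_trans h); rewrite exprS mulrAC ler_piMl ?sqr_ge0//.
  by rewrite ler_pdivrMr// mul1r (le_trans x2)// ler_nat.
rewrite ler0_norm ?subr_le0 ?sin_le_id//.
rewrite opprB; apply: (@le_trans _ _ (x + 1)); first by rewrite lerD2l lerNl sin_geN1.
apply: (@le_trans _ _ (2 * x)); first by lra.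
by rewrite expr2 ler_wpM2r// ltW.
Qed.

Lemma cos_sub_quartic x : `|1 - cos x - x ^+ 2 / 2| <= x ^+ 4 / 24.
Proof.
have x4 : 0 <= x ^+ 4 by rewrite exprn_even_ge0.
have := cos_le_quartic x; have := cos_ge_quadratic x => *.
by rewrite ler_norml; apply/andP; split; lra.
Qed.

Lemma cos_1Lipschitz (a b : R) : `|cos a - cos b| <= `|a - b|.
Proof.
have sin_le (y : R) : `|sin y| <= `|y|.
  wlog y0 : y / 0 <= y.
    move=> h; case: (leP 0 y) => [/h//|y0].
    by rewrite -normrN -sinN -[leRHS]normrN h// oppr_ge0 ltW.
  have [y1|y1] := leP y 1.
    rewrite (ger0_norm y0) ger0_norm ?sin_le_id// sin_ge0_pi// y0/=.
    by rewrite (le_trans y1)// (le_trans _ (pi_ge2 R))// ler1n.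
  by rewrite (le_trans (sin_max y))// (ger0_norm y0) ltW.
have -> : cos a - cos b = - 2 * sin ((a + b) / 2) * sin ((a - b) / 2).
  have -> : cos a = cos ((a + b) / 2 + (a - b) / 2) by congr cos; field.
  have -> : cos b = cos ((a + b) / 2 - (a - b) / 2) by congr cos; field.
  by rewrite cosB (cosD ((a + b) / 2) ((a - b) / 2)); ring.
rewrite !normrM normrN (ger0_norm (ler0n _ _)).
apply: (@le_trans _ _ (2 * 1 * `|(a - b) / 2|)).
  by rewrite ler_pM// ?mulr_ge0// ler_pM2l// sin_max.
by rewrite mulr1 normrM normfV (ger0_norm (ler0n _ _)) mulrC divfK.
Qed.

End trigonometric_bounds.

Section integration_lemmas.
Context (R : realType).

Lemma Rintegral_dominated_cvg d (T : measurableType d) (mu : {measure set T -> \bar R})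
    (f_ : nat -> T -> R) (f G : T -> R) :
  (forall n, measurable_fun setT (f_ n)) -> (forall x, f_ n x @[n --> \oo] --> f x) ->
  mu.-integrable setT (EFin \o G) -> (forall n x, `|f_ n x| <= G x) ->
  \int[mu]_x f_ n x @[n --> \oo] --> \int[mu]_x f x.
Proof.
move=> mf ff iG fG.
have mlim : measurable_fun setT f by apply: (measurable_fun_cvg mf) => x _; exact: ff.
have [ifm _ cv] : [/\ mu.-integrable setT (EFin \o f),
  [sequence (\int[mu]_x (fun n x => `|(EFin \o f_ n) x - (EFin \o f) x|) n x)%E]_n
    @ \oo --> 0%E &
  [sequence (\int[mu]_x (EFin \o f_ n) x)%E]_n @ \oo --> (\int[mu]_x (EFin \o f) x)%E].
  apply: (@dominated_convergence _ _ _ mu setT measurableT _ _ (EFin \o G)) => //.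
  - by move=> n; exact/measurable_EFinP.
  - exact/measurable_EFinP.
  - by apply: aeW => x _; apply: cvg_EFin; [near=> n|exact: ff].
  - by apply: aeW => x n _; rewrite lee_fin.
apply: fine_cvg; rewrite /Rintegral fineK//; exact: integrable_fin_num.
Unshelve. all: by end_near. Qed.

Lemma nneseries_eventually0 (f : nat -> \bar R) M : (forall i, (0 <= f i)%E) ->
  (forall i, (M <= i)%N -> f i = 0%E) ->
  (\sum_(0 <= i <oo) f i = \sum_(i < M) f i)%E.
Proof.
move=> f0 fM; rewrite (@nneseries_split _ _ 0%N M)// add0n [X in (_ + X)%E]eseries0.
  by rewrite adde0 big_mkord.
by move=> i iM _; exact: fM.
Qed.

(** The tails of the series tend to 0, hence fall below 1, whereas a single nonzero term in a tail
    makes it at least 1. *)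
Lemma nneseries_bool_lty (a : nat -> bool) :
  (\sum_(0 <= i <oo) (a i)%:R%:E < +oo :> \bar R)%E ->
  exists M, forall i, (M <= i)%N -> ~~ a i.
Proof.
move=> afin.
have a0 i : (0 <= (a i)%:R%:E :> \bar R)%E by rewrite lee_fin.
have /= := nneseries_tail_cvg afin (fun k _ => a0 k).
move=> /fine_cvgP[[M0 _ Mfin]] /cvgrPdist_lt/(_ 1 ltr01)[M1 _ M1P].
exists (M0 + M1)%N => i Mi; apply/negP => ai.
have := M1P i (leq_trans (leq_addl _ _) Mi).
rewrite /= sub0r normrN ltNge => /negP; apply.
apply: le_trans (ler_norm _); rewrite -lee_fin fineK; last first.
  by apply: (Mfin i); exact: (leq_trans (leq_addr _ _) Mi).
rewrite (@nneseries_split _ _ i 1%N)// addn1 big_nat1 ai.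
by rewrite leeDl// nneseries_ge0.
Qed.

(** The level set of 0 may have infinite measure; the condition [phi 0 = 0] removes it from the
    integral. *)
Lemma Rintegral_simple d (S : measurableType d) (mu : {measure set S -> \bar R})
    (g : S -> R) (ys : seq R) (phi : R -> R) :
  measurable_fun setT g -> uniq ys -> (forall x, g x != 0 -> g x \in ys) ->
  0 \notin ys -> phi 0 = 0 ->
  (forall y, y \in ys -> mu (g @^-1` [set y]) < +oo)%E ->
  \int[mu]_x phi (g x) = \sum_(y <- ys) phi y * fine (mu (g @^-1` [set y])).
Proof.
move=> mg uys gys ys0 phi0 muys.
have mA y : measurable (g @^-1` [set y]).
  by rewrite -[X in measurable X]setTI; exact: mg.
have iA y : y \in ys -> mu.-integrable setT (fun x => (phi y * \1_(g @^-1` [set y]) x)%:E).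
  move=> yys; under eq_fun do rewrite EFinM; apply: integrableZl => //.
  apply/integrableP; split; first by apply/measurable_EFinP; exact: measurable_indic.
  under eq_integral do rewrite gee0_abs ?lee_fin//.
  by rewrite integral_indic// setIT muys.
have -> : (fun x => phi (g x)) = (fun x => \sum_(y <- ys) phi y * \1_(g @^-1` [set y]) x).
  apply/funext => x; have [gx0|gx0] := eqVneq (g x) 0.
    rewrite gx0 phi0 big1_seq// => y /= yys.
    rewrite indicE memNset ?mulr0// => gy; move: ys0; rewrite -gx0 gy yys.
    by [].
  rewrite (bigD1_seq (g x))//=; last exact: gys.
  rewrite indicE mem_set// mulr1 big1 ?addr0// => y yg.
  by rewrite indicE memNset ?mulr0// => /= gy; rewrite gy eqxx in yg.
rewrite big_tnth /Rintegral; under eq_integral do rewrite big_tnth -sumEFin.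
rewrite integral_sum// => [|i]; last by apply: iA; exact: mem_tnth.
rewrite -[RHS]/(fine _%:E) -sumEFin; congr fine; apply: eq_bigr => i _.
set y := tnth _ _; have yys : y \in ys by exact: mem_tnth.
under eq_integral do rewrite EFinM.
rewrite integralZl//; last first.
  apply/integrableP; split; first by apply/measurable_EFinP; exact: measurable_indic.
  under eq_integral do rewrite gee0_abs ?lee_fin//.
  by rewrite integral_indic// setIT muys.
rewrite integral_indic// setIT EFinM fineK//.
by rewrite ge0_fin_numE// muys.
Qed.

End integration_lemmas.

Import HBSimple.

(** * Campbell's formula in real form *)

Section poisson_functional.
Context (R : realType) d (Omega : measurableType d) (P : probability Omega R).
Context d' (S : measurableType d') (mu : {measure set S -> \bar R}).
Context (w : nat -> Omega -> S) (sel : nat -> Omega -> bool).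

(** The flags [sel] will keep the points below a given level without renumbering the sequence. *)
Definition selected_count (o : Omega) (B : set S) : \bar R :=
  (\sum_(0 <= i <oo) (sel i o && (w i o \in B))%:R%:E)%E.

Hypothesis ppp : is_poisson_point_process P selected_count mu.

Context (U : set S) (mU : measurable U) (muU : (mu U < +oo)%E).

(* The value is 0 on the null event that infinitely many selected points lie in U. *)
Definition cutoff (o : Omega) : nat :=
  if pselect (exists M, forall i, (M <= i)%N -> ~~ (sel i o && (w i o \in U)))
  is left h then sval (cid h) else 0.

(** The range of summation is finite and does not depend on [g], so pointwise limits in [g] pass
    through the sum. *)
Definition selected_sum (g : S -> R) (o : Omega) : R :=
  \sum_(i < cutoff o | sel i o) g (w i o).

Let good : set Omega := [set o | (selected_count o U < +oo)%E].

Lemma cutoffP o : good o -> forall i, (cutoff o <= i)%N -> ~~ (sel i o && (w i o \in U)).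
Proof.
move=> /nneseries_bool_lty h; rewrite /cutoff; case: pselect => [h'|/(_ h)//].
by case: cid.
Qed.

Lemma cutoff_bad o : ~ good o -> cutoff o = 0%N.
Proof.
move=> bad; rewrite /cutoff; case: pselect => // -[M MP]; case: bad.
rewrite /good/= /selected_count (@nneseries_eventually0 _ _ M).
- by rewrite sumEFin ltry.
- by move=> i; rewrite lee_fin.
- by move=> i Mi; rewrite (negbTE (MP _ Mi)).
Qed.

Lemma selected_count_fin o B : good o -> B `<=` U ->
  selected_count o B = (\sum_(i < cutoff o | sel i o) (w i o \in B)%:R)%:E.
Proof.
move=> go BU; rewrite /selected_count (@nneseries_eventually0 _ _ (cutoff o)).
- rewrite sumEFin [in RHS]big_mkcond/=; congr EFin; apply: eq_bigr => i _.
  by case: (sel i o).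
- by move=> i; rewrite lee_fin.
- move=> i oi; have := cutoffP go oi; case: (sel i o) => //= wU.
  by rewrite memNset// => /BU wiU; move: wU; rewrite mem_set.
Qed.

Lemma measurable_selected_count B : measurable B ->
  measurable_fun setT (selected_count ^~ B).
Proof. by move=> mB; exact: ppp_measurable ppp _ mB. Qed.

Let mgood : measurable good.
Proof.
rewrite -[good]setTI; apply: (emeasurable_fun_infty_o measurableT).
exact: measurable_selected_count.
Qed.

Let P_good : P good = 1%E.
Proof.
pose m := fine (mu U).
pose F k : set Omega := [set o | selected_count o U = k%:R%:E].
have mF k : measurable (F k).
  rewrite -[F k]setTI.
  exact: (measurable_selected_count mU measurableT (emeasurable_set1 k%:R%:E)).
have PF k : P (F k) = (expR (- m) * m ^+ k / k`!%:R)%:E.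
  exact: (ppp_finite ppp).
have PU : P (\bigcup_k F k) = 1%E.
  rewrite measure_bigcup//=; last first.
    apply/trivIsetP => i j _ _ ij; apply/seteqP; split=> // o; rewrite /F => -[/= -> /eqP].
    by rewrite eqe eqr_nat (negbTE ij).
  rewrite (eq_eseriesr (fun k _ => PF k)).
  rewrite (_ : (fun j : nat => _) = EFin \o series (fun k => expR (- m) * m ^+ k / k`!%:R)).
    rewrite EFin_lim; last by apply/cvg_ex; exists 1; exact: poisson_series_sum1.
    by congr EFin; apply: cvg_lim => //; exact: poisson_series_sum1.
  apply/funext => j; rewrite /series/= -sumEFin.
  by apply: eq_bigl => i; rewrite in_setT.
apply/eqP; rewrite eq_le probability_le1//= -PU le_measure ?inE//.
  exact: bigcup_measurable.
by move=> o [k _ /= ok]; rewrite /good/= ok ltry.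
Qed.

Lemma selected_count_lty : measurable [set o | (selected_count o U < +oo)%E] /\
  P [set o | (selected_count o U < +oo)%E] = 1%E.
Proof. by split; [exact: mgood|exact: P_good]. Qed.

Lemma selected_sum_bad g o : ~ good o -> selected_sum g o = 0.
Proof. by move=> bad; rewrite /selected_sum cutoff_bad// big_ord0. Qed.

Section simple.
Context (g : S -> R) (ys : seq R).
Hypothesis mg : measurable_fun setT g.
Hypothesis gU : forall x, ~ U x -> g x = 0.
Hypothesis uys : uniq ys.
Hypothesis ys0 : 0 \notin ys.
Hypothesis gys : forall x, g x != 0 -> g x \in ys.

(** The level sets of [g] for its nonzero values, continued by empty sets into a sequence. *)
Let A i := if (i < size ys)%N then g @^-1` [set ys`_i] else set0.

Let mA i : measurable (A i).
Proof.
rewrite /A; case: ifP => // _.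
by rewrite -[X in measurable X]setTI; exact: mg.
Qed.

Let AU i : A i `<=` U.
Proof.
move=> x; rewrite /A; case: ifP => // si /= gx; apply: contrapT => /gU gx0.
by move: ys0; rewrite -gx0 gx mem_nth.
Qed.

Let muA i : (mu (A i) < +oo)%E.
Proof. by apply: (le_lt_trans _ muU); apply: le_measure; rewrite ?inE. Qed.

Lemma selected_sum_simple o : good o -> selected_sum g o =
  \sum_(i < size ys) ys`_i * fine (selected_count o (A i)).
Proof.
move=> go; under eq_bigr do rewrite selected_count_fin//= mulr_sumr.
rewrite exchange_big/=; apply: eq_bigr => i _.
have [gx0|gx0] := eqVneq (g (w i o)) 0.
  rewrite gx0 big1// => j _; rewrite memNset ?mulr0// /A ltn_ord/= gx0 => y0.
  by move: ys0; rewrite y0 mem_nth.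
have gin := gys gx0.
have ilt : (index (g (w i o)) ys < size ys)%N by rewrite index_mem.
rewrite (bigD1 (Ordinal ilt))//= nth_index// mem_set ?mulr1; last first.
  by rewrite /A ilt/= nth_index.
rewrite big1 ?addr0// => j ji; rewrite memNset ?mulr0// /A ltn_ord/= => gj.
by move: ji; rewrite -val_eqE/= gj index_uniq// eqxx.
Qed.

Lemma measurable_selected_sum_simple : measurable_fun setT (selected_sum g).
Proof.
rewrite (_ : selected_sum g = (fun o => (\1_good o) *
    \sum_(i < size ys) ys`_i * fine (selected_count o (A i)))).
  apply: measurable_funM; first exact: measurable_indic.
  apply: measurable_sum => i; apply: measurable_funM => //.
  by apply: measurableT_comp => //; exact: measurable_selected_count.
apply/funext => o; rewrite indicE; have [go|bad] := pselect (good o).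
  by rewrite mem_set// mul1r selected_sum_simple.
by rewrite memNset// mul0r selected_sum_bad.
Qed.

(** Off a null event the sum is a linear combination of the counts of disjoint level sets. These are
    independent Poisson variables, and the product of their characteristic functions is the
    exponential of an integral. *)
Lemma selected_sum_simple_cos b : \int[P]_o cos (selected_sum g o + b) =
  expR (\int[mu]_x (cos (g x) - 1)) * cos (\int[mu]_x sin (g x) + b).
Proof.
have mcos (f : Omega -> R) : measurable_fun setT f -> measurable_fun setT (fun o => cos (f o + b)).
  move=> mf; apply: (measurableT_comp (f := cos)).
    by apply: continuous_measurable_fun; exact: continuous_cos.
  exact: measurable_funD.
have -> : \int[P]_o cos (selected_sum g o + b) =
    \int[P]_o cos (\sum_(i < size ys) ys`_i * fine (selected_count o (A i)) + b).
  rewrite /Rintegral; congr fine; apply: ae_eq_integral => //.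
  - by apply/measurable_EFinP; apply: mcos; exact: measurable_selected_sum_simple.
  - apply/measurable_EFinP; apply: mcos.
    apply: measurable_sum => i; apply: measurable_funM => //.
    by apply: measurableT_comp => //; exact: measurable_selected_count.
  - exists (~` good); split; first exact: measurableC.
      have /= -> := probability_setC P mgood.
      by rewrite P_good subee.
    move=> o /= h go; apply: h => _; rewrite selected_sum_simple//.
rewrite (@independent_poisson_cos _ _ _ P (fun i o => selected_count o (A i))
  (fun i B => P [set o | B (selected_count o (A i))]) (fun i => fine (mu (A i)))
  (fun i => ys`_i) _ _ _ (size ys) setT 1 b)//.
- rewrite mul1r (@Rintegral_simple _ _ _ mu g ys (fun y => cos y - 1))//; last 2 first.
  + by rewrite cos0 subrr.
  + move=> y yys; have ilt : (index y ys < size ys)%N by rewrite index_mem.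
    by have := muA (index y ys); rewrite /A ilt nth_index.
  rewrite (@Rintegral_simple _ _ _ mu g ys sin)//; last 2 first.
  + by rewrite sin0.
  + move=> y yys; have ilt : (index y ys < size ys)%N by rewrite index_mem.
    by have := muA (index y ys); rewrite /A ilt nth_index.
  have sumE (F : R -> R) : \sum_(y <- ys) F y = \sum_(i < size ys) F ys`_i.
    by rewrite (big_nth 0) big_mkord.
  rewrite !sumE; congr (expR _ * cos (_ + _)).
    by apply: eq_bigr => i _; rewrite /A ltn_ord mulrC.
  by apply: eq_bigr => i _; rewrite /A ltn_ord mulrC.
- by move=> i; exact: measurable_selected_count.
- by move=> i; rewrite (_ : [set o | _] = setT) ?probability_setT//; apply/seteqP.
- by move=> i k; exact: (ppp_finite ppp).
- move=> B mB; rewrite mul1e setTI.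
  have /= := ppp_independent ppp (fun i : 'I_(size ys) => mA i) (fun i => mB i).
  move=> <-.
    congr (P _); apply/seteqP; split=> o h.
      by move=> i _; exact: (h i (ltn_ord i)).
    by move=> i /= ilt; exact: (h (Ordinal ilt) I).
  apply/trivIsetP => i j _ _ ij; apply/seteqP; split=> // x.
  rewrite /A !ltn_ord/= => -[-> /eqP]; rewrite nth_uniq//.
  by rewrite val_eqE (negbTE ij).
Qed.

End simple.

Section general.
Context (g : S -> R).
Hypothesis mg : measurable_fun setT g.
Hypothesis gU : forall x, ~ U x -> g x = 0.

(** The factor [\1_U] keeps the approximations zero outside [U], the set known to have finite
    intensity. *)
Let simple_approx : exists s : nat -> S -> R, [/\
  forall k, measurable_fun setT (s k), forall k x, ~ U x -> s k x = 0,
  forall k, finite_set (range (s k)) & forall x, s k x @[k --> \oo] --> g x].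
Proof.
have mgE : measurable_fun setT (EFin \o g) by exact/measurable_EFinP.
have [s sg] := approximation_sfun measurableT mgE.
exists (fun k x => s k x * \1_U x); split.
- by move=> k; apply: measurable_funM => //; exact: measurable_indic.
- by move=> k x Ux; rewrite indicE memNset ?mulr0.
- move=> k; apply: (@sub_finite_set _ _ (range (s k) `|` [set 0])).
    move=> _ [x _ <-]; rewrite indicE; case: (x \in U); rewrite ?mulr1 ?mulr0; last by right.
    by left; exists x.
  by rewrite finite_setU; split.
- move=> x; have [Ux|Ux] := pselect (U x); last first.
    by rewrite gU// indicE memNset//; under eq_fun do rewrite mulr0; exact: cvg_cst.
  rewrite indicE mem_set//; under eq_fun do rewrite mulr1.
  exact: (fine_cvg (sg x I)).
Qed.

Let cos_bound (x : S) (h : S -> R) : (forall x, ~ U x -> h x = 0) ->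
  `|cos (h x) - 1| <= 2 * \1_U x.
Proof.
move=> hU; rewrite indicE; have [Ux|Ux] := pselect (U x); last first.
  by rewrite hU// cos0 subrr normr0 memNset ?mulr0.
rewrite mem_set// mulr1 ler_norml; have := cos_geN1 (h x); have := cos_le1 (h x).
by move=> *; apply/andP; split; lra.
Qed.

Let sin_bound (x : S) (h : S -> R) : (forall x, ~ U x -> h x = 0) ->
  `|sin (h x)| <= 2 * \1_U x.
Proof.
move=> hU; rewrite indicE; have [Ux|Ux] := pselect (U x); last first.
  by rewrite hU// sin0 normr0 memNset ?mulr0.
rewrite mem_set// mulr1 ler_norml; have := sin_geN1 (h x); have := sin_le1 (h x).
by move=> *; apply/andP; split; lra.
Qed.

Let selected_sum_cvg (s : nat -> S -> R) o : (forall x, s k x @[k --> \oo] --> g x) ->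
  selected_sum (s k) o @[k --> \oo] --> selected_sum g o.
Proof. by move=> sg; apply: cvg_big => [|i _]; [exact: add_continuous|exact: sg]. Qed.

Let simple_values (s : S -> R) : finite_set (range s) -> exists ys : seq R,
  [/\ uniq ys, 0 \notin ys & forall x, s x != 0 -> s x \in ys].
Proof.
move=> /finite_seqP[zs zsE]; exists (undup [seq y <- zs | y != 0]); split.
- exact: undup_uniq.
- by rewrite mem_undup mem_filter eqxx.
- move=> x sx; rewrite mem_undup mem_filter sx/=.
  have : range s (s x) by exists x.
  by rewrite zsE.
Qed.

Lemma measurable_selected_sum : measurable_fun setT (selected_sum g).
Proof.
have [s [ms sU sfin sg]] := simple_approx.
apply: (@measurable_fun_cvg _ _ _ setT (fun k => selected_sum (s k))) => [k|o _].
  have [ys [uys ys0 sys]] := simple_values (sfin k).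
  exact: (measurable_selected_sum_simple (ms k) (sU k) uys ys0 sys).
exact: selected_sum_cvg.
Qed.

(** Passage from simple functions by dominated convergence: cosines are bounded by 1 under [P], and
    the integrands under [mu] by 2 on [U] and 0 elsewhere. *)
Lemma selected_sum_cos b : \int[P]_o cos (selected_sum g o + b) =
  expR (\int[mu]_x (cos (g x) - 1)) * cos (\int[mu]_x sin (g x) + b).
Proof.
have [s [ms sU sfin sg]] := simple_approx.
have ccos := @continuous_cos R; have csin := @continuous_sin R.
have mcos := continuous_measurable_fun ccos.
have msin := continuous_measurable_fun csin.
have mS k : measurable_fun setT (selected_sum (s k)).
  have [ys [uys ys0 sys]] := simple_values (sfin k).
  exact: (measurable_selected_sum_simple (ms k) (sU k) uys ys0 sys).
have iU : mu.-integrable setT (EFin \o (fun x => 2 * \1_U x)).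
  rewrite (_ : EFin \o _ = fun x => (2%:E * (\1_U x)%:E)%E)//.
  apply: integrableZl => //; apply/integrableP; split.
    by apply/measurable_EFinP; exact: measurable_indic.
  under eq_integral do rewrite gee0_abs ?lee_fin//.
  by rewrite integral_indic// setIT.
have cvL : \int[P]_o cos (selected_sum (s k) o + b) @[k --> \oo] -->
    \int[P]_o cos (selected_sum g o + b).
  apply: (@Rintegral_dominated_cvg _ _ _ P _ _ (cst 1)).
  - move=> k; apply: (measurableT_comp (f := cos)) => //; exact: measurable_funD.
  - move=> o; apply: continuous_cvg; first exact: ccos.
    by apply: cvgD; [exact: selected_sum_cvg|exact: cvg_cst].
  - exact: finite_measure_integrable_cst.
  - by move=> k o; exact: cos_max.
have cvc : \int[mu]_x (cos (s k x) - 1) @[k --> \oo] --> \int[mu]_x (cos (g x) - 1).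
  apply: (Rintegral_dominated_cvg _ _ iU).
  - by move=> k; apply: measurable_funB => //; exact: measurableT_comp.
  - move=> x; apply: cvgB; last exact: cvg_cst.
    by apply: continuous_cvg; [exact: ccos|exact: sg].
  - by move=> k x; exact: (cos_bound x (sU k)).
have cvs : \int[mu]_x sin (s k x) @[k --> \oo] --> \int[mu]_x sin (g x).
  apply: (Rintegral_dominated_cvg _ _ iU).
  - by move=> k; exact: measurableT_comp.
  - by move=> x; apply: continuous_cvg; [exact: csin|exact: sg].
  - by move=> k x; exact: (sin_bound x (sU k)).
apply/(cvg_unique _ cvL) => //.
rewrite (_ : (fun k => _) = fun k => expR (\int[mu]_x (cos (s k x) - 1)) *
    cos (\int[mu]_x sin (s k x) + b)); last first.
  apply/funext => k; have [ys [uys ys0 sys]] := simple_values (sfin k).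
  exact: (selected_sum_simple_cos (ms k) (sU k) uys ys0 sys).
apply: cvgM; apply: continuous_cvg => //; first exact: continuous_expR.
  exact: ccos.
by apply: cvgD => //; exact: cvg_cst.
Qed.

End general.

End poisson_functional.

(** * Second moments and scaling limits of characteristic exponents *)

Section second_moment.
Context (R : realType).

(* Fatou's lemma for 2 (1 - cos (t X)) / t ^ 2, as t -> 0. *)
Lemma second_moment_le d (T : measurableType d) (P : probability T R) (X : T -> R)
    (C K : R) : measurable_fun setT X -> 0 <= K ->
  (forall t, 0 < t -> 1 - \int[P]_o cos (t * X o) <= C * t ^+ 2 / 2 + K * t ^+ 4) ->
  (\int[P]_o (X o ^+ 2)%:E <= C%:E)%E.
Proof.
move=> mX K0 hC.
pose t k : R := k.+1%:R^-1.
have t0 k : 0 < t k by rewrite invr_gt0.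
have tN0 k : t k != 0 by rewrite gt_eqF.
have t2 : t k ^+ 2 @[k --> \oo] --> (0 : R).
  rewrite (_ : (fun _ => _) = t \* t); last by apply/funext => k /=; rewrite expr2.
  by rewrite -[X in _ --> X](mulr0 0); apply: cvgM; exact: cvg_harmonic.
pose f k o : R := 2 * (1 - cos (t k * X o)) / t k ^+ 2.
have mcos k : measurable_fun setT (fun o => cos (t k * X o)).
  apply: (measurableT_comp (f := cos)); last exact: measurable_funM.
  by apply: continuous_measurable_fun; exact: continuous_cos.
have icos k : P.-integrable setT (EFin \o (fun o => cos (t k * X o))).
  by apply: (@bounded_integrable _ _ _ P _ 1) => // o; exact: cos_max.
have mf k : measurable_fun setT (f k).
  by apply: measurable_funM => //; apply: measurable_funM => //; exact: measurable_funB.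
have f0 k o : 0 <= f k o.
  by rewrite divr_ge0 ?sqr_ge0// mulr_ge0// subr_ge0 cos_le1.
have fX o : f k o @[k --> \oo] --> X o ^+ 2.
  apply/cvgrPdist_le => e e0.
  have /cvgrPdist_lt/(_ _ e0) : X o ^+ 4 / 12 * t k ^+ 2 @[k --> \oo] --> (0 : R).
    by rewrite -[X in _ --> X](mulr0 (X o ^+ 4 / 12)); apply: cvgM => //; exact: cvg_cst.
  apply: filterS => k; rewrite sub0r normrN => h; apply: (le_trans _ (ltW h)).
  apply: le_trans (ler_norm _).
  have -> : X o ^+ 2 - f k o =
      - (2 / t k ^+ 2 * (1 - cos (t k * X o) - (t k * X o) ^+ 2 / 2)).
    by rewrite /f; field.
  rewrite normrN normrM ger0_norm; last by rewrite divr_ge0// sqr_ge0.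
  apply: (le_trans (ler_wpM2l _ (cos_sub_quartic _))); first by rewrite divr_ge0// sqr_ge0.
  by rewrite le_eqVlt; apply/orP; left; apply/eqP; field.
have intf k : (\int[P]_o (f k o)%:E <= (C + 2 * K * t k ^+ 2)%:E)%E.
  have -> : (\int[P]_o (f k o)%:E = (\int[P]_o f k o)%:E)%E.
    rewrite /Rintegral fineK//; apply: integrable_fin_num => //.
    apply: (@bounded_integrable _ _ _ P _ (4 / t k ^+ 2)) => // o.
    rewrite ger0_norm// ler_wpM2r ?invr_ge0 ?sqr_ge0//.
    by have := cos_geN1 (t k * X o); lra.
  rewrite lee_fin (_ : (fun o => f k o) =
    fun o => 2 / t k ^+ 2 * (1 - cos (t k * X o))); last first.
    by apply/funext => o; rewrite /f; field.
  have i1 : P.-integrable setT (EFin \o (fun=> 1%R)) by exact: finite_measure_integrable_cst.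
  rewrite RintegralZl//; last exact: (integrableB measurableT i1 (icos k)).
  rewrite RintegralB// Rintegral_cst//= probability_setT/= mul1r.
  apply: (le_trans (ler_wpM2l _ (hC _ (t0 k)))); first by rewrite divr_ge0// sqr_ge0.
  by rewrite le_eqVlt; apply/orP; left; apply/eqP; field.
have -> : (\int[P]_o (X o ^+ 2)%:E = \int[P]_o limn_einf (fun k => (f k o)%:E))%E.
  apply: eq_integral => o _; apply/esym.
  have h : (f k o)%:E @[k --> \oo] --> (X o ^+ 2)%:E by apply: cvg_EFin; [near=> k|exact: fX].
  exact: (cvg_limn_einf_sup h).1.
apply: (le_trans (fatou _ _ _ _)) => //.
- by move=> k; exact/measurable_EFinP.
- by move=> k o _; rewrite lee_fin.
rewrite limn_einf_lim.
have cv : (C + 2 * K * t k ^+ 2)%:E @[k --> \oo] --> C%:E.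
  apply: cvg_EFin; first by near=> k.
  rewrite -[X in _ --> X]addr0; apply: cvgD; first exact: cvg_cst.
  by rewrite -[X in _ --> X](mulr0 (2 * K)); apply: cvgM => //; exact: cvg_cst.
rewrite -(cvg_lim _ cv)//; apply: lee_lim.
- exact: is_cvg_einfs.
- by apply/cvg_ex; exists C%:E.
- near=> k; apply: le_trans (intf k).
  by apply: ereal_inf_lbound; exists k => /=.
Unshelve. all: by end_near. Qed.

End second_moment.

Section characteristic_exponent.
Context (R : realType) d (S : measurableType d) (nu : {measure set S -> \bar R}) (g : S -> R).
Hypothesis ig : nu.-integrable setT (EFin \o g).
Hypothesis ig2 : nu.-integrable setT (EFin \o (fun x => g x ^+ 2)).

Let mg : measurable_fun setT g.
Proof. by apply/measurable_EFinP; exact: measurable_int ig. Qed.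

Let V := \int[nu]_x (g x ^+ 2).

Let V0 : 0 <= V. Proof. by apply: Rintegral_ge0 => x _; exact: sqr_ge0. Qed.

Let mcos t : measurable_fun setT (fun x => cos (t * g x) - 1).
Proof.
apply: measurable_funB => //; apply: (measurableT_comp (f := cos)).
  by apply: continuous_measurable_fun; exact: continuous_cos.
exact: measurable_funM.
Qed.

Let msin t : measurable_fun setT (fun x => sin (t * g x) - t * g x).
Proof.
apply: measurable_funB; last exact: measurable_funM.
apply: (measurableT_comp (f := sin)).
  by apply: continuous_measurable_fun; exact: continuous_sin.
exact: measurable_funM.
Qed.

Let cos_bound x : `|cos x - 1| <= x ^+ 2 / 2 :> R.
Proof.
rewrite ler_norml; have := cos_ge_quadratic x; have := cos_le1 x.
have := sqr_ge0 x.
by move=> *; apply/andP; split; lra.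
Qed.

Let ig2Z (c : R) : nu.-integrable setT (EFin \o (fun x => c * g x ^+ 2)).
Proof.
rewrite (_ : EFin \o _ = fun x => (c%:E * (g x ^+ 2)%:E)%E)//.
exact: integrableZl.
Qed.

Lemma integrable_cosB1 t : nu.-integrable setT (EFin \o (fun x => cos (t * g x) - 1)).
Proof.
apply: (le_integrable measurableT _ _ (ig2Z (t ^+ 2 / 2))).
  exact/measurable_EFinP.
move=> x _; rewrite lee_fin; apply: (le_trans (cos_bound _)).
by rewrite exprMn mulrAC (le_trans _ (ler_norm _)).
Qed.

Lemma integrable_sinB t : nu.-integrable setT (EFin \o (fun x => sin (t * g x) - t * g x)).
Proof.
apply: (le_integrable measurableT _ _ (ig2Z (t ^+ 2))).
  exact/measurable_EFinP.
move=> x _; rewrite lee_fin; apply: (le_trans (sin_sub_sqr _)).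
by rewrite exprMn (le_trans _ (ler_norm _)).
Qed.

Let Rintegral_norm_le c (f : S -> R) : nu.-integrable setT (EFin \o f) ->
  (forall x, `|f x| <= c * g x ^+ 2) -> `|\int[nu]_x f x| <= c * V.
Proof.
move=> iF fc; apply: (le_trans (le_normr_Rintegral measurableT iF)).
rewrite /V -RintegralZl//; apply: le_Rintegral => //; exact: integrable_norm.
Qed.

Lemma Rintegral_cosB1_bound t : `|\int[nu]_x (cos (t * g x) - 1)| <= t ^+ 2 / 2 * V.
Proof.
apply: Rintegral_norm_le; first exact: integrable_cosB1.
by move=> x; apply: (le_trans (cos_bound _)); rewrite exprMn mulrAC.
Qed.

Lemma Rintegral_sinB_bound t : `|\int[nu]_x (sin (t * g x) - t * g x)| <= t ^+ 2 * V.
Proof.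
apply: Rintegral_norm_le; first exact: integrable_sinB.
by move=> x; apply: (le_trans (sin_sub_sqr _)); rewrite exprMn.
Qed.

Lemma Rintegral_sinE t : \int[nu]_x sin (t * g x) =
  \int[nu]_x (sin (t * g x) - t * g x) + t * \int[nu]_x g x.
Proof.
rewrite -RintegralZl// -RintegralD//.
- by apply: eq_Rintegral => x _; rewrite subrK.
- exact: integrable_sinB.
- rewrite (_ : EFin \o _ = fun x => (t%:E * (g x)%:E)%E)//; exact: integrableZl.
Qed.

Let cvg_inv_seq (r : nat -> R) : r k @[k --> \oo] --> +oo -> (r k)^-1 @[k --> \oo] --> (0 : R).
Proof.
by move=> ry; apply/gtr0_cvgV0 => //; exact: cvgry_gt.
Qed.

(** For r = sqrt (2 u) the prefactor r^2 / 2 is the level u. The integrands converge pointwise to -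
    g^2 / 4 and are dominated by g^2 / 4. *)
Lemma cvg_Rintegral_cosB1 :
  r ^+ 2 / 2 * \int[nu]_x (cos (r^-1 * g x) - 1) @[r --> +oo] --> - (V / 4).
Proof.
apply/cvg_pinftyP => r ry; have rV0 := cvg_inv_seq ry.
have -> : (fun n => r n ^+ 2 / 2 * \int[nu]_x (cos ((r n)^-1 * g x) - 1)) =
    fun n => \int[nu]_x (r n ^+ 2 / 2 * (cos ((r n)^-1 * g x) - 1)).
  by apply/funext => n; rewrite RintegralZl//; exact: integrable_cosB1.
have -> : - (V / 4) = \int[nu]_x (- 4^-1 * g x ^+ 2).
  by rewrite RintegralZl// mulNr mulrC.
apply: (Rintegral_dominated_cvg _ _ (ig2Z 4^-1)).
- by move=> n; exact: measurable_funM.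
- move=> x; apply/cvgrPdist_le => e e0.
  have /cvgrPdist_le/(_ _ e0) : g x ^+ 4 / 48 * ((r n)^-1 * (r n)^-1) @[n --> \oo] --> (0 : R).
    rewrite -[X in _ --> X](mulr0 (g x ^+ 4 / 48)); apply: cvgM; first exact: cvg_cst.
    by rewrite -[X in _ --> X](mulr0 0); exact: cvgM.
  move=> lim0; apply: filterS2 (cvgry_gt ry 0) lim0 => n r0; rewrite sub0r normrN => h.
  apply: (le_trans _ h); apply: le_trans (ler_norm _).
  have rn0 : r n != 0 by rewrite gt_eqF.
  have -> : - 4^-1 * g x ^+ 2 - r n ^+ 2 / 2 * (cos ((r n)^-1 * g x) - 1) =
      r n ^+ 2 / 2 * (1 - cos ((r n)^-1 * g x) - ((r n)^-1 * g x) ^+ 2 / 2) by field.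
  have r2 : 0 <= r n ^+ 2 / 2 by rewrite divr_ge0// sqr_ge0.
  rewrite normrM ger0_norm//.
  apply: (le_trans (ler_wpM2l r2 (cos_sub_quartic _))).
  by rewrite le_eqVlt; apply/orP; left; apply/eqP; field.
(* The domination is required for every [n], including those with [r n = 0], whose inverse is 0 by
   convention. *)
- move=> n x; have [->|rn0] := eqVneq (r n) 0.
    by rewrite expr0n/= mul0r mul0r normr0 mulr_ge0 ?sqr_ge0// invr_ge0.
  have r2 : 0 <= r n ^+ 2 / 2 by rewrite divr_ge0// sqr_ge0.
  rewrite normrM ger0_norm//.
  apply: (le_trans (ler_wpM2l r2 (cos_bound _))).
  by rewrite le_eqVlt; apply/orP; left; apply/eqP; field.
Qed.

(** The cubic bound on sin y - y gives the pointwise limit, at speed 1 / r; the domination rests on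
    the quadratic bound, since [g] comes with two moments only. *)
Lemma cvg_Rintegral_sinB :
  r ^+ 2 / 2 * \int[nu]_x (sin (r^-1 * g x) - r^-1 * g x) @[r --> +oo] --> (0 : R).
Proof.
apply/cvg_pinftyP => r ry; have rV0 := cvg_inv_seq ry.
have -> : (fun n => r n ^+ 2 / 2 * \int[nu]_x (sin ((r n)^-1 * g x) - (r n)^-1 * g x)) =
    fun n => \int[nu]_x (r n ^+ 2 / 2 * (sin ((r n)^-1 * g x) - (r n)^-1 * g x)).
  by apply/funext => n; rewrite RintegralZl//; exact: integrable_sinB.
have -> : 0 = \int[nu]_(x in setT) 0 :> R by rewrite Rintegral_cst ?mul0r.
apply: (Rintegral_dominated_cvg _ _ (ig2Z 2^-1)).
- by move=> n; exact: measurable_funM.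
- move=> x; apply/cvgrPdist_le => e e0.
  have /cvgrPdist_le/(_ _ e0) : `|g x| ^+ 3 / 12 * (r n)^-1 @[n --> \oo] --> (0 : R).
    by rewrite -[X in _ --> X](mulr0 (`|g x| ^+ 3 / 12)); apply: cvgM => //; exact: cvg_cst.
  move=> lim0; apply: filterS2 (cvgry_gt ry 0) lim0 => n r0; rewrite !sub0r !normrN => h.
  apply: (le_trans _ h); apply: le_trans (ler_norm _).
  have rn0 : r n != 0 by rewrite gt_eqF.
  have r2 : 0 <= r n ^+ 2 / 2 by rewrite divr_ge0// sqr_ge0.
  rewrite normrM ger0_norm//.
  apply: (le_trans (ler_wpM2l r2 (sin_sub_cubic _))).
  rewrite normrM normfV (ger0_norm (ltW r0)).
  by rewrite le_eqVlt; apply/orP; left; apply/eqP; field.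
- move=> n x; have [->|rn0] := eqVneq (r n) 0.
    by rewrite expr0n/= mul0r mul0r normr0 mulr_ge0 ?sqr_ge0// invr_ge0.
  have r2 : 0 <= r n ^+ 2 / 2 by rewrite divr_ge0// sqr_ge0.
  rewrite normrM ger0_norm//.
  apply: (le_trans (ler_wpM2l r2 (sin_sub_sqr _))).
  by rewrite le_eqVlt; apply/orP; left; apply/eqP; field.
Qed.

End characteristic_exponent.

Lemma Rintegral_mscale (R : realType) d (S : measurableType d)
    (mu : {measure set S -> \bar R}) (k : {nonneg R}) (f : S -> R) :
  mu.-integrable setT (EFin \o f) ->
  \int[mscale k mu]_x f x = k%:num * \int[mu]_x f x.
Proof.
move=> iF; have mf := measurable_int _ iF.
have ip := integrable_pos_fin_num measurableT iF.
have iN := integrable_neg_fin_num measurableT iF.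
rewrite /Rintegral [in LHS]integralE [in RHS]integralE.
rewrite !ge0_integral_mscale//; [|exact: measurable_funeneg|exact: measurable_funepos].
by rewrite -(fineK ip) -(fineK iN) -!EFinM -!EFinB/= mulrBr.
Qed.

(** * Poisson processes restricted to levels below a threshold *)

Section poisson_level.
Context (R : realType) d (Omega : measurableType d) (P : probability Omega R).
Context d' (S : measurableType d') (nu : {sigma_finite_measure set S -> \bar R}).
Context (w : nat -> Omega -> S) (u_ : nat -> Omega -> R).
Hypothesis u_ge0 : forall i o, 0 <= u_ i o.
Hypothesis ppp : is_poisson_point_process P
  (fun o A => \sum_(0 <= i <oo) \d_(w i o, u_ i o) A)%E
  (fun A => (nu \x lebesgue_measure)%E (A `&` (setT `*` `[0%R, +oo[))).

Definition below (a : R) i o : bool := u_ i o <= a.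

Lemma selected_count_below a o (B : set S) : selected_count R w (below a) o B =
  (\sum_(0 <= i <oo) \d_(w i o, u_ i o) (B `*` `[0%R, a]))%E.
Proof.
apply: eq_eseriesr => i _; rewrite diracE; congr (_%:R%:E)%E.
congr nat_of_bool.
rewrite /below andbC; apply/idP/idP => [/andP[wB ua]|].
  by rewrite mem_set//=; split; [rewrite inE in wB|rewrite in_itv/= u_ge0].
by rewrite inE => -[/= wB]; rewrite in_itv/= => /andP[_ ->]; rewrite mem_set.
Qed.

Let intensity_below (a : R) (a0 : 0 <= a) (B : set S) : measurable B ->
  (nu \x lebesgue_measure)%E ((B `*` `[0%R, a]) `&` (setT `*` `[0%R, +oo[)) =
  mscale (NngNum a0) nu B.
Proof.
move=> mB; rewrite (_ : _ `&` _ = B `*` `[0%R, a]).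
  rewrite product_measure1E//= lebesgue_measure_itv/= lte_fin /mscale/= muleC.
  move: a0; rewrite le_eqVlt => /predU1P[<-|a0]; first by rewrite ltxx.
  by rewrite a0 oppr0 adde0.
apply/seteqP; split=> [[x y]/= [[]]//|[x y]/= [Bx]].
by rewrite !in_itv/= => /andP[y0 ya]; rewrite y0 ya.
Qed.

(** Counting the points of [B] below level [a] is counting in the cylinder B x [0, a], of intensity
    a nu(B); disjoint bases give disjoint cylinders. *)
Lemma poisson_below (a : R) (a0 : 0 <= a) :
  is_poisson_point_process P (selected_count R w (below a)) (mscale (NngNum a0) nu).
Proof.
have mBa (B : set S) : measurable B -> measurable (B `*` `[0%R, a]%classic : set (S * R)).
  by move=> mB; exact: measurableX.
split.
- move=> B mB; under eq_fun do rewrite selected_count_below.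
  exact: (ppp_measurable ppp (mBa B mB)).
- move=> B k mB; rewrite -(intensity_below a0 mB) => h.
  rewrite -(ppp_finite ppp k (mBa B mB) h); congr (P _).
  by apply/seteqP; split=> o /=; rewrite selected_count_below.
- move=> B mB; rewrite -(intensity_below a0 mB) => h.
  rewrite -(ppp_infinite ppp (mBa B mB) h); congr (P _).
  by apply/seteqP; split=> o /=; rewrite selected_count_below.
- move=> n A B mA mB tA.
  have mE o i : selected_count R w (below a) o (A i) =
    (\sum_(0 <= j <oo) \d_(w j o, u_ j o) (A i `*` `[0%R, a]))%E.
    exact: selected_count_below.
  under eq_bigr do under eq_set do rewrite mE.
  rewrite -(ppp_independent ppp (fun i => mBa _ (mA i)) mB).
    congr (P _); apply/seteqP; split=> o h i _; have := h i I; by rewrite /= mE.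
  apply/trivIsetP => i j _ _ ij; apply/seteqP; split=> // -[x y] [[/= Ai _] [/= Aj _]].
  by have /trivIsetP/(_ _ _ I I ij) := tA; move/seteqP => [/(_ x) h _]; exact: h.
Qed.

(** Measurability is given for the counts of sets rather than for individual points. The sum is
    therefore written as an integral against the random counting measure, regarded as a kernel. *)
Lemma measurable_sum_below a (k : S -> \bar R) : measurable_fun setT k ->
  (forall x, (0 <= k x)%E) ->
  measurable_fun setT (fun o => \sum_(0 <= i <oo) ((below a i o)%:R%:E * k (w i o)))%E.
Proof.
move=> mk k0.
pose l o : {measure set (S * R) -> \bar R} := mseries (fun i => \d_(w i o, u_ i o)) 0.
pose F (z : S * R) : \bar R := (k z.1 * (\1_`]-oo, a]%classic z.2)%:E)%E.
have F0 z : (0 <= F z)%E by rewrite mule_ge0// lee_fin.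
have mF : measurable_fun setT F.
  apply: emeasurable_funM; first exact: measurableT_comp.
  by apply/measurable_EFinP; apply: measurableT_comp.
have ml A : measurable A -> measurable_fun setT (fun o => l o A).
  by move=> mA; exact: (ppp_measurable ppp mA).
have := measurable_fun_integral_kernel ml F0 mF.
congr (measurable_fun _ _); apply/funext => o.
rewrite ge0_integral_measure_series//; apply: eq_eseriesr => i _.
rewrite integral_dirac// diracT mul1e /F/= muleC indicE; congr (_%:R%:E * _)%E.
congr nat_of_bool.
by apply/idP/idP => [|h]; [rewrite inE/= in_itv|rewrite mem_set//= in_itv].
Qed.

Section level_sum.
Context (U : set S) (mU : measurable U) (nuU : (nu U < +oo)%E).
Context (g : S -> R).
Hypothesis gU : forall x, ~ U x -> g x = 0.
Hypothesis ig : nu.-integrable setT (EFin \o g).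
Hypothesis ig2 : nu.-integrable setT (EFin \o (fun x => g x ^+ 2)).

Let mg : measurable_fun setT g.
Proof. by apply/measurable_EFinP; exact: measurable_int ig. Qed.

Definition level_sum (a : R) := selected_sum w (below a) U g.

Let m := \int[nu]_x g x.
Let V := \int[nu]_x (g x ^+ 2).

Let mscaleU (a : R) (a0 : 0 <= a) : (mscale (NngNum a0) nu U < +oo)%E.
Proof.
by rewrite /mscale/= -(@fineK _ (nu U)) ?ge0_fin_numE// -EFinM ltry.
Qed.

Lemma measurable_level_sum a : 0 <= a -> measurable_fun setT (level_sum a).
Proof.
by move=> a0; exact: (measurable_selected_sum (poisson_below a0) mU mg gU).
Qed.

(** Campbell's formula with phase b - t a m. Writing the integral of sin (t g) as a compensated part
    plus t m cancels the centering. *)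
Lemma level_sum_cos a t b : 0 <= a -> \int[P]_o cos (t * (level_sum a o - a * m) + b) =
  expR (a * \int[nu]_x (cos (t * g x) - 1)) *
  cos (a * \int[nu]_x (sin (t * g x) - t * g x) + b).
Proof.
move=> a0.
have mtg : measurable_fun setT (fun x => t * g x) by exact: measurable_funM.
have tgU x : ~ U x -> t * g x = 0 by move=> /gU ->; rewrite mulr0.
have := selected_sum_cos (poisson_below a0) mU (mscaleU a0) mtg tgU (b - t * (a * m)).
rewrite !Rintegral_mscale//=; last 2 first.
- rewrite (_ : EFin \o _ = (EFin \o (fun x => sin (t * g x) - t * g x)) \+
      (fun x => t%:E * (g x)%:E)%E).
    by apply: integrableD => //; [exact: integrable_sinB|exact: integrableZl].
  by apply/funext => x/=; rewrite -EFinM -EFinD subrK.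
- exact: integrable_cosB1.
rewrite Rintegral_sinE// -/m => h.
rewrite (_ : a * _ + b = a * (\int[nu]_x (sin (t * g x) - t * g x) + t * m) +
  (b - t * (a * m))); last by ring.
rewrite -h; apply: eq_Rintegral => o _; congr cos.
rewrite (_ : selected_sum _ _ _ _ _ = t * level_sum a o); first by ring.
by rewrite /level_sum /selected_sum mulr_sumr.
Qed.

(** The characteristic function is e^A cos B with - A <= a V t^2 / 2 and B^2 <= (a V)^2 t^4. Hence 1
    - e^A cos B <= - A + B^2 / 2, the form required by the Fatou argument. *)
Lemma level_sum_second_moment a : 0 <= a ->
  (\int[P]_o ((level_sum a o - a * m) ^+ 2)%:E <= (a * V)%:E)%E.
Proof.
move=> a0.
have V0 : 0 <= V by apply: Rintegral_ge0 => x _; exact: sqr_ge0.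
apply: (@second_moment_le _ _ _ P _ _ ((a * V) ^+ 2 / 2)).
- by apply: measurable_funB => //; exact: measurable_level_sum.
- by rewrite divr_ge0// sqr_ge0.
move=> t t0; have := level_sum_cos t 0 a0.
under eq_Rintegral do rewrite addr0.
move=> ->; rewrite addr0.
set A := a * _; set B := a * _.
have B2 : B ^+ 2 <= (a * V) ^+ 2 * t ^+ 4.
  rewrite /B -real_normK ?num_real// -[t ^+ 4]/(t ^+ (2 * 2)) exprM -exprMn.
  apply: lerXn2r; rewrite ?nnegrE//; first by rewrite mulr_ge0 ?sqr_ge0// mulr_ge0.
  rewrite normrM (ger0_norm a0) -mulrA ler_wpM2l// mulrC.
  exact: Rintegral_sinB_bound.
have A2 : - A <= a * V * t ^+ 2 / 2.
  apply: (le_trans (ler_norm _)); rewrite normrN /A normrM (ger0_norm a0).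
  rewrite (_ : _ / 2 = a * (t ^+ 2 / 2 * V)); last by ring.
  by rewrite ler_wpM2l//; exact: Rintegral_cosB1_bound.
have A0 : A <= 0.
  rewrite /A -oppr_ge0 -mulrN mulr_ge0// -mulN1r -RintegralZl//.
    by apply: Rintegral_ge0 => x _; rewrite mulN1r opprB subr_ge0 cos_le1.
  exact: integrable_cosB1.
have eA1 : expR A <= 1 by rewrite expR_le1.
have eA2 := expR_ge1Dx A.
have cB := cos_ge_quadratic B.
have eB : expR A * (1 - B ^+ 2 / 2) <= expR A * cos B by rewrite ler_wpM2l// expR_ge0.
have eB2 : expR A * (B ^+ 2 / 2) <= B ^+ 2 / 2 by rewrite ler_piMl// divr_ge0// sqr_ge0.
lra.
Qed.

Lemma cvg_sqrt2 : Num.sqrt (2 * u) @[u --> +oo] --> (+oo : set_system R).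
Proof.
apply/cvgryPgt => M; exists (M ^+ 2); split; first exact: num_real.
move=> u Mu; apply: (le_lt_trans (ler_norm M)).
have u0 : 0 < u by rewrite (le_lt_trans _ Mu)// sqr_ge0.
rewrite -sqrtr_sqr ltr_sqrt ?mulr_gt0// (lt_le_trans Mu)//.
by rewrite ler_peMl ?(ltW u0)// ler1n.
Qed.

(** With t = 1 / sqrt (2 u) the factor u equals sqrt (2 u)^2 / 2, so the two scaling limits apply
    along r = sqrt (2 u). *)
Lemma level_sum_clt b :
  \int[P]_o cos ((level_sum u o - u * m) / Num.sqrt (2 * u) + b) @[u --> +oo] -->
  expR (- (V / 4)) * cos b.
Proof.
have lim_c := cvg_comp _ _ cvg_sqrt2 (cvg_Rintegral_cosB1 ig ig2).
have lim_s := cvg_comp _ _ cvg_sqrt2 (cvg_Rintegral_sinB ig ig2).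
have : expR (Num.sqrt (2 * u) ^+ 2 / 2 *
    \int[nu]_x (cos ((Num.sqrt (2 * u))^-1 * g x) - 1)) *
  cos (Num.sqrt (2 * u) ^+ 2 / 2 * \int[nu]_x (sin ((Num.sqrt (2 * u))^-1 * g x) -
    (Num.sqrt (2 * u))^-1 * g x) + b) @[u --> +oo] --> expR (- (V / 4)) * cos (0 + b).
  apply: cvgM; apply: continuous_cvg => //; first exact: continuous_expR.
    exact: continuous_cos.
  by apply: cvgD; [exact: lim_s|exact: cvg_cst].
rewrite add0r; apply: cvg_trans; apply: near_eq_cvg; near=> u.
have u0 : 0 <= u by near: u; exact: nbhs_pinfty_ge.
rewrite sqr_sqrtr ?mulr_ge0// [2 * u]mulrC mulfK// -level_sum_cos//.
by apply: eq_Rintegral => o _; congr (cos (_ + _)); exact: mulrC.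
Unshelve. all: by end_near. Qed.

End level_sum.
End poisson_level.

(** * Walks and Green function *)

Section density.
Context (R : realType) d (T : measurableType d).
Import HBNNSimple.

(** The identity holds for simple approximations of [f], and monotone convergence carries both sides
    to the limit. *)
Lemma ge0_integral_density (mu nu : {measure set T -> \bar R}) (p : T -> R) (f : T -> \bar R) :
  measurable_fun setT p -> (forall x, 0 <= p x) ->
  (forall A, measurable A -> nu A = (\int[mu]_(x in A) (p x)%:E)%E) ->
  measurable_fun setT f -> (forall x, (0 <= f x)%E) ->
  (\int[nu]_x f x = \int[mu]_x (f x * (p x)%:E))%E.
Proof.
move=> mp p0 nuE mf f0.
pose g := nnsfun_approx measurableT mf.
have ndg (x : T) : {homo (fun n => g n x) : n m / (n <= m)%N >-> n <= m}.
  by move=> n m nm; have /lefP := nd_nnsfun_approx measurableT mf nm; exact.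
have gf x : EFin \o (g ^~ x) @ \oo --> f x by apply: cvg_nnsfun_approx.
have mpE : measurable_fun setT (EFin \o p) by exact/measurable_EFinP.
have mg n : measurable_fun setT (fun x => ((g n x)%:E * (p x)%:E)%E).
  by apply: emeasurable_funM => //; exact/measurable_EFinP.
have gp0 n x : (0 <= (g n x)%:E * (p x)%:E)%E by rewrite mule_ge0 ?lee_fin.
have simple n : (\int[nu]_x (g n x)%:E = \int[mu]_x ((g n x)%:E * (p x)%:E))%E.
  rewrite integralT_nnsfun sintegralE.
  under eq_fsbigr => y _ do rewrite nuE//.
  pose F y (x : T) : \bar R := (y%:E * ((EFin \o p) \_ (g n @^-1` [set y])) x)%E.
  have mF y : measurable_fun setT (F y).
    apply: emeasurable_funM => //; apply/(measurable_restrictT _ _).1 => //.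
    exact: measurable_funTS.
  have -> : (\int[mu]_x ((g n x)%:E * (p x)%:E) =
      \int[mu]_x (\sum_(y \in range (g n)) F y x))%E.
    apply: eq_integral => x _; rewrite (fsbigD1 (g n x))/=; last 2 first.
    - exact: fimfunP.
    - by exists x.
    rewrite fsbig1 ?adde0; last first.
      by move=> y [_ /= yg]; rewrite /F patchE memNset ?mule0//= => gy; apply: yg.
    by rewrite /F patchE mem_set.
  rewrite ge0_integral_fsum//; last first.
    move=> y x _; rewrite /F patchE; case: ifPn => [|_]; last by rewrite mule0.
    by rewrite inE => /= <-; rewrite mule_ge0 ?lee_fin.
  apply: eq_fsbigr => y; rewrite inE => -[x _ gy].
  have y0 : 0 <= y by rewrite -gy.
  rewrite [in LHS]integral_mkcond /F ge0_integralZl_EFin//.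
  - by move=> z _; rewrite patchE; case: ifP => //; rewrite lee_fin.
  - by apply/(measurable_restrictT _ _).1 => //; exact: measurable_funTS.
(* One limit statement serves both measures, with weight 1 for [nu] and weight [p] for [mu]. *)
have limE (m : {measure set T -> \bar R}) (q : T -> \bar R) : measurable_fun setT q ->
    (forall x, (0 <= q x < +oo)%E) ->
    (\int[m]_x ((g n x)%:E * q x) @[n --> \oo] --> \int[m]_x (f x * q x))%E.
  move=> mq q0.
  have -> : (\int[m]_x (f x * q x) = \int[m]_x limn (fun n => (g n x)%:E * q x))%E.
    apply: eq_integral => x _; apply/esym/cvg_lim => //.
    have /andP[q0x qy] := q0 x.
    by apply: cvgeZr; [rewrite ge0_fin_numE|exact: gf].
  apply: cvg_monotone_convergence => //.
  - by move=> n; apply: emeasurable_funM => //; exact/measurable_EFinP.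
  - by move=> n x _; rewrite mule_ge0 ?lee_fin//; have /andP[] := q0 x.
  - by move=> x _ n k nk; rewrite lee_wpmul2r ?lee_fin ?ndg//; have /andP[] := q0 x.
have l1 : (\int[nu]_x ((g n x)%:E * 1) @[n --> \oo] --> \int[nu]_x (f x * 1))%E.
  by apply: limE => // x; rewrite lee_fin ler01 ltry.
have l2 : (\int[mu]_x ((g n x)%:E * (p x)%:E) @[n --> \oo] --> \int[mu]_x (f x * (p x)%:E))%E.
  by apply: limE => // x; rewrite lee_fin p0 ltry.
transitivity (\int[nu]_x (f x * 1))%E.
  by apply: eq_integral => x _; rewrite mule1.
apply/(cvg_unique _ l1) => //; rewrite (_ : (fun n => _) =
  fun n => (\int[mu]_x ((g n x)%:E * (p x)%:E))%E)//.
apply/funext => n; rewrite -simple; apply: eq_integral => x _; by rewrite mule1.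
Qed.

End density.

(** * Exponential holding times *)

Section exponential_moments.
Context (R : realType).

Definition exp1_law : probability (measurableTypeR R) R :=
  exponential_distribution.exponential_distribution_exponential_prob__canonical__probability_measure_Probability
    (@ltr01 R).

Lemma exp1_lawE B : exp1_law B = exponential_prob 1 B.
Proof. by []. Qed.

Lemma exp1_law_neg : exp1_law `]-oo, 0%R[%classic = 0%E.
Proof.
rewrite exp1_lawE /exponential_prob integral0_eq// => x.
by rewrite /= in_itv/= => x0; rewrite lt0_exponential_pdf.
Qed.

Lemma ge0_integral_exp1 (f : R -> R) : measurable_fun setT f -> (forall x, 0 <= f x) ->
  (\int[exp1_law]_x (f x)%:E =
   \int[lebesgue_measure]_(x in `[0%R, +oo[) (f x * expR (- x))%:E)%E.
Proof.
move=> mf f0; have mfE : measurable_fun setT (EFin \o f) by exact/measurable_EFinP.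
have p0 x : 0 <= exponential_pdf 1 x :> R by rewrite exponential_pdf_ge0.
rewrite (@ge0_integral_density _ _ _ lebesgue_measure _ (exponential_pdf 1))//.
- rewrite [RHS]integral_mkcond; apply: eq_integral => x _.
  rewrite patchE /=; case: ifPn.
    rewrite inE/= in_itv/= andbT => x0.
    by rewrite exponential_pdfE// mul1r mulN1r EFinM.
  rewrite notin_setE/= in_itv/= andbT => /negP; rewrite -ltNge => x0.
  by rewrite lt0_exponential_pdf// mule0.
- exact: measurable_exponential_pdf.
Qed.

(** From x^(k+1) / (k+1)! <= e^x the quantity is at most (k+1)! / x. *)
Lemma cvg_powexpN (k : nat) : x ^+ k * expR (- x) @[x --> +oo] --> (0 : R).
Proof.
have h : k.+1`!%:R * x^-1 @[x --> +oo] --> (0 : R).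
  rewrite -[X in _ --> X](mulr0 k.+1`!%:R); apply: cvgMr.
  apply/gtr0_cvgV0; last exact: cvg_id.
  exact: nbhs_pinfty_gt.
apply: (@squeeze_cvgr _ _ _ _ (cst 0) (fun x => k.+1`!%:R * x^-1)); last 2 first.
- exact: cvg_cst.
- exact: h.
near=> x; have x0 : 0 < x by near: x; exact: nbhs_pinfty_gt.
rewrite mulr_ge0 ?exprn_ge0 ?expR_ge0 ?(ltW x0)//= expRN.
rewrite ler_pdivrMr ?expR_gt0// mulrAC ler_pdivlMr// -exprSr mulrC -ler_pdivrMr.
  by rewrite (le_trans _ (expR_ge1Dxn k (ltW x0)))// lerDr.
by rewrite ltr0n fact_gt0.
Unshelve. all: by end_near. Qed.

(** The absolute value makes the integrand nonnegative on the whole line and changes nothing on the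
    half-line that carries the law. *)
Lemma exp1_moment1 : (\int[exp1_law]_x `|x|%:E = 1)%E.
Proof.
rewrite (ge0_integral_exp1 (f := fun x => `|x|))//.
transitivity (\int[@lebesgue_measure R]_(x in `[0%R, +oo[) (x * @expR R (- x))%:E)%E.
  by apply: eq_integral => x; rewrite inE/= in_itv/= andbT => x0; rewrite ger0_norm.
have dF (x : R) : is_derive x 1 (fun x => - ((x + 1) * expR (- x))) (x * expR (- x)).
  by apply: trigger_derive; rewrite /GRing.scale/=; ring.
have cF : continuous (fun x : R => - ((x + 1) * expR (- x))).
  by move=> x; apply/differentiable_continuous/derivable1_diffP; exact: ex_derive.
rewrite (@ge0_continuous_FTC2y _ (fun x => x * expR (- x)) (fun x => - ((x + 1) * expR (- x))) 0 0).
- by rewrite sub0e -EFinN opprK add0r mul1r oppr0 expR0.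
- by move=> x x0; rewrite mulr_ge0 ?expR_ge0.
- apply: continuous_subspaceT => x; apply: cvgM; first exact: cvg_id.
  by apply: (continuous_comp (f := -%R)); [exact: opp_continuous|exact: continuous_expR].
- rewrite -oppr0; apply: cvgN.
  rewrite (_ : (fun x => _) = (fun x => x ^+ 1 * expR (- x) + x ^+ 0 * expR (- x))).
    by rewrite -[X in _ --> X]addr0; apply: cvgD; exact: cvg_powexpN.
  by apply/funext => x; rewrite expr1 expr0 mulrDl.
- by move=> x _; exact: ex_derive.
- by apply: cvg_at_right_filter; exact: cF.
- by move=> x _; rewrite derive1E; exact: derive_val.
Qed.

Lemma exp1_moment2 : (\int[exp1_law]_x (x ^+ 2)%:E = 2%:E)%E.
Proof.
rewrite (ge0_integral_exp1 (f := fun x => x ^+ 2)); last 2 first.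
- exact: measurable_funX.
- by move=> x; exact: sqr_ge0.
have dF (x : R) : is_derive x 1 (fun x => - ((x ^+ 2 + 2 * x + 2) * expR (- x)))
    (x ^+ 2 * expR (- x)).
  by apply: trigger_derive; rewrite /GRing.scale/=; ring.
have cF : continuous (fun x : R => - ((x ^+ 2 + 2 * x + 2) * expR (- x))).
  by move=> x; apply/differentiable_continuous/derivable1_diffP; exact: ex_derive.
rewrite (@ge0_continuous_FTC2y _ (fun x => x ^+ 2 * expR (- x))
  (fun x => - ((x ^+ 2 + 2 * x + 2) * expR (- x))) 0 0).
- by rewrite sub0e -EFinN opprK expr0n/= mulr0 !add0r oppr0 expR0 mulr1.
- by move=> x x0; rewrite mulr_ge0 ?expR_ge0// sqr_ge0.
- apply: continuous_subspaceT => x; apply: cvgM; first exact: exprn_continuous.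
  by apply: (continuous_comp (f := -%R)); [exact: opp_continuous|exact: continuous_expR].
- rewrite -oppr0; apply: cvgN.
  rewrite (_ : (fun x => _) = (fun x => x ^+ 2 * expR (- x) +
      (2 * (x ^+ 1 * expR (- x)) + 2 * (x ^+ 0 * expR (- x))))).
    rewrite -[X in _ --> X]addr0; apply: cvgD; first exact: cvg_powexpN.
    rewrite -[X in _ --> X]addr0 -{1 2}[X in _ --> X + X](mulr0 2).
    by apply: cvgD; apply: cvgMr; exact: cvg_powexpN.
  by apply/funext => x; ring.
- by move=> x _; exact: ex_derive.
- by apply: cvg_at_right_filter; exact: cF.
- by move=> x _; rewrite derive1E; exact: derive_val.
Qed.

End exponential_moments.

Section exponential_functionals.
Context (R : realType) d (T : measurableType d) (Q : {measure set T -> \bar R}).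
Context (A : set T) (mA : measurable A).

Lemma ge0_integral_mrestr (f : T -> \bar R) : measurable_fun setT f ->
  (forall x, (0 <= f x)%E) ->
  (\int[mrestr Q mA]_x f x = \int[Q]_(x in A) f x)%E.
Proof.
move=> mf f0.
rewrite -(@eq_measure_integral _ _ _ A Q (mrestr Q mA)); last first.
  move=> B _ BA.
  by rewrite -[LHS]/(Q (B `&` A)) setIidl.
rewrite [RHS]integral_mkcond; apply: ae_eq_integral => //.
  by apply/(measurable_restrictT _ _).1 => //; exact: measurable_funTS.
exists (~` A); split; first exact: measurableC.
  by rewrite -[LHS]/(Q (~` A `&` A)) setICl measure0.
move=> x /= h Ax; apply: h => _; by rewrite patchE mem_set.
Qed.

(** The hypothesis says that [A] has mass [c] and that, on [A], the variable [X] is exponential: the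
    image of the restricted measure is c times the exponential law. *)
Lemma ge0_integral_exp1_law (X : T -> measurableTypeR R) (c : R) (f : R -> R) :
  measurable_fun setT X -> 0 <= c ->
  (forall B, measurable B -> Q (A `&` X @^-1` B) = (c%:E * exponential_prob 1 B)%E) ->
  measurable_fun setT f -> (forall x, 0 <= f x) ->
  (\int[Q]_(x in A) (f (X x))%:E = c%:E * \int[exp1_law R]_x (f x)%:E)%E.
Proof.
move=> mX c0 QX mf f0.
have mfE : measurable_fun setT (EFin \o f) by exact/measurable_EFinP.
rewrite -ge0_integral_mrestr//; last 2 first.
- by apply/measurable_EFinP; exact: measurableT_comp.
- by move=> x; rewrite lee_fin.
rewrite -(@ge0_integral_pushforward _ _ _ _ _ _ mX (mrestr Q mA) setT (EFin \o f))//.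
transitivity (\int[mscale (NngNum c0) (exp1_law R)]_x (f x)%:E)%E; last first.
  by rewrite ge0_integral_mscale// => x; rewrite lee_fin.
apply: eq_measure_integral => B mB _.
by rewrite -[LHS]/(Q (X @^-1` B `&` A)) setIC QX.
by move=> x _; rewrite /= lee_fin.
Qed.

(** The image of the restricted measure under the pair is c times a product law, as both agree on
    rectangles; Tonelli's theorem then gives c times the square of the mean 1. *)
Lemma ge0_integral_exp1_law2 (X Y : T -> measurableTypeR R) (c : R) :
  measurable_fun setT X -> measurable_fun setT Y -> 0 <= c ->
  (forall B1 B2, measurable B1 -> measurable B2 ->
    Q (A `&` (X @^-1` B1 `&` Y @^-1` B2)) =
    (c%:E * (exponential_prob 1 B1 * exponential_prob 1 B2))%E) ->
  (\int[Q]_(x in A) (`|X x| * `|Y x|)%:E = c%:E)%E.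
Proof.
move=> mX mY c0 QXY.
pose f (z : measurableTypeR R * measurableTypeR R) : \bar R := (`|z.1| * `|z.2|)%:E.
have mf : measurable_fun setT f.
  apply/measurable_EFinP; apply: measurable_funM; apply: measurableT_comp => //.
have f0 z : (0 <= f z)%E by rewrite lee_fin mulr_ge0.
have mXY : measurable_fun setT (fun x => (X x, Y x)) by exact: measurable_fun_pair.
rewrite -(@ge0_integral_mrestr (f \o (fun x => (X x, Y x))))//; last 2 first.
- exact: (measurableT_comp mf mXY).
- by move=> x; exact: f0.
rewrite -(@ge0_integral_pushforward _ _ _ _ _ _ mXY (mrestr Q mA) setT f)//.
pose E1 := exp1_law R.
rewrite (@eq_measure_integral _ _ _ setT (mscale (NngNum c0) (E1 \x E1)%E)).
  have inner (x : R) : (\int[E1]_y f (x, y) = `|x|%:E)%E.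
    transitivity (`|x|%:E * \int[E1]_y `|y : R|%:E)%E; last by rewrite exp1_moment1 mule1.
    rewrite -ge0_integralZl_EFin//.
    by apply/measurable_EFinP; exact: normr_measurable.
  rewrite ge0_integral_mscale// fubini_tonelli1//.
  transitivity (c%:E * \int[E1]_x `|x : R|%:E)%E; last by rewrite exp1_moment1 mule1.
  congr (_ * _)%E; apply: eq_integral => x _; exact: inner.
move=> B mB _.
apply: (measure_unique [set B1 `*` B2 | B1 in measurable & B2 in measurable] (fun=> setT)) => //.
- exact: measurable_prod_measurableType.
- move=> _ _ [B1 mB1 [B2 mB2 <-]] [B3 mB3 [B4 mB4 <-]].
  exists (B1 `&` B3); first exact: measurableI.
  exists (B2 `&` B4); first exact: measurableI.
  by rewrite setXI.
- move=> _; exists setT => //; exists setT => //; by rewrite setXTT.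
- by rewrite bigcup_const//; exists 0%N.
- move=> _ [B1 mB1 [B2 mB2 <-]].
  rewrite -[LHS]/(Q ((X @^-1` B1 `&` Y @^-1` B2) `&` A)).
  rewrite -[RHS]/(c%:E * (E1 \x E1) (B1 `*` B2))%E product_measure1E//.
  by rewrite setIC QXY.
- move=> _; rewrite -[ltLHS]/(Q (setT `&` A)) setTI.
  have := QXY setT setT measurableT measurableT.
  rewrite !preimage_setT !setIT => ->.
  by rewrite -exp1_lawE probability_setT !mule1 ltry.
Qed.

End exponential_functionals.

(** * The Markov property of the walk *)

Section walk_markov_property.
Context (R : realType) (E : pointedType) (N : transient_network R E).
Implicit Types (x y z : E) (h : nat -> E) (n m : nat) (A : set (vertex_paths nat E)).

Lemma measurable_vertex_path (I : Type) (i : I) (B : set E) :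
  measurable ((fun w : vertex_paths I E => w i) @^-1` B).
Proof.
by apply: sub_sigma_algebra; exists i => //; exists B => //; rewrite setTI.
Qed.

Definition history h n : set (vertex_paths nat E) :=
  [set w | forall i, (i <= n)%N -> w i = h i].

Lemma measurable_history h n : measurable (history h n).
Proof.
rewrite [history h n](_ : _ = \bigcap_(i in [set i | (i <= n)%N])
    (fun w : vertex_paths nat E => w i) @^-1` [set h i]); last first.
  by apply/seteqP; split.
by apply: bigcap_measurableType => i _; exact: measurable_vertex_path.
Qed.

(** Countability of the vertex set: an index codes a finite sequence of natural numbers, which a
    surjection from the natural numbers turns into vertices. Repetitions may occur. *)
Lemma history_cover : {hs : nat -> nat -> E |
  forall n w, exists k, history (hs k) n w}.
Proof.
apply/cid; have /pcard_surjP[e e_surj] := countable_vertices N.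
exists (fun k i => e (nth 0%N (odflt [::] (choice.unpickle k)) i)) => n w.
have /choice[c ec] x : exists k, e k = x.
  by have [k _ <-] := e_surj x I; exists k.
exists (choice.pickle [seq c (w i) | i <- iota 0 n.+1]) => i lein.
rewrite choice.pickleK (_ : odflt _ _ = [seq c (w j) | j <- iota 0 n.+1])//.
by rewrite (nth_map 0%N) ?size_iota// nth_iota// ec.
Qed.

Lemma measurable_path_event A :
  measurable A -> measurable (fst @^-1` A : set (walk_space R E)).
Proof.
move=> mA; rewrite -[X in measurable X]setTI.
exact: (@measurable_fst _ _ (vertex_paths nat E) (real_fields nat R)).
Qed.

Lemma measurable_visit n y :
  measurable [set w : walk_space R E | w.1 n = y].
Proof. exact: (measurable_path_event (measurable_vertex_path n [set y])). Qed.

Lemma measurable_path_shift n :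
  measurable_fun setT
    (fun w : walk_space R E => (fun i => w.1 (n + i)%N) : vertex_paths nat E).
Proof.
apply: (@measurability _ _ (vertex_paths nat E * real_fields nat R)%type
  (vertex_paths nat E) _ _
  (family_events (fun i (w : nat -> E) => w i) discrete_measurable)) => //.
move=> _ [_ [i _ [B _ <-]] <-]; rewrite !setTI.
exact: (measurable_path_event (measurable_vertex_path (n + i) B)).
Qed.

Lemma measurable_path_future n A : measurable A ->
  measurable [set w : walk_space R E | A (fun i => w.1 (n + i)%N)].
Proof.
move=> mA; rewrite -[X in measurable X]setTI.
exact: measurable_path_shift.
Qed.

Let histories : set (set (vertex_paths nat E)) :=
  [set A | A = set0 \/ exists h n, A = history h n].

Let histories_setI : setI_closed histories.
Proof.
move=> A B [->|[h [n ->]]]; first by left; rewrite set0I.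
case=> [->|[z [m ->]]]; first by left; rewrite setI0.
wlog lenm : h n z m / (n <= m)%N => [hw|].
  by case: (leqP n m) => [|/ltnW] lenm; [|rewrite setIC]; exact: hw.
have [hz|hz] := pselect (forall i, (i <= n)%N -> h i = z i).
  right; exists z, m; apply/seteqP; split=> [w []//|w zw]; split=> // i lein.
  by rewrite hz// zw// (leq_trans lein).
left; apply/seteqP; split=> // w [hw zw]; apply: hz => i lein.
by rewrite -hw// zw// (leq_trans lein).
Qed.

Let measurable_histories :
  @measurable _ (vertex_paths nat E) = <<s histories >>.
Proof.
apply/seteqP; split; apply: smallest_sub.
- exact: smallest_sigma_algebra.
- move=> _ [i _ [B _ <-]]; have [hs hsP] := history_cover.
  rewrite setTI [X in <<s _ >> X](_ : _ =
    \bigcup_k (if hs k i \in B then history (hs k) i else set0)); last first.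
    apply/seteqP; split=> w.
      move=> Bw; have [k kw] := hsP i w; exists k => //.
      by rewrite ifT// inE -kw.
    by move=> [k _]; case: ifPn => // /[!inE] Bk kw; rewrite /preimage/= kw.
  apply: (@sigma_algebra_bigcup _ setT) => k; apply: sub_sigma_algebra.
  by case: ifPn => _; [right; exists (hs k), i|left].
- exact: sigma_algebra_measurable.
- by move=> _ [->|[h [n ->]]]; [exact: measurable0|exact: measurable_history].
Qed.

(** Both sides are finite measures in [A], and they agree on histories, a generating family stable
    under intersection. *)
Lemma markov_history x h n A : measurable A ->
  walk N x [set w | history h n w.1 /\ A (fun i => w.1 (n + i)%N)] =
  (walk N x (fst @^-1` history h n) * walk N (h n) (fst @^-1` A))%E.
Proof.
move=> mA.
have mH := measurable_path_event (measurable_history h n).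
pose sh (w : walk_space R E) : vertex_paths nat E := fun i => w.1 (n + i)%N.
pose f0 (w : walk_space R E) : vertex_paths nat E := w.1.
have mf0 : measurable_fun setT f0 by exact: measurable_fst.
pose push :=
  @measure_function_pushforward__canonical__measure_function_Measure _ _
    (vertex_paths nat E * real_fields nat R)%type (vertex_paths nat E) R.
pose c := fine (walk N x (fst @^-1` history h n)).
have c0 : 0 <= c by rewrite fine_ge0.
have cE : c%:E = walk N x (fst @^-1` history h n).
  by rewrite fineK// fin_num_measure.
have [m1 m1E] : exists m1 : {measure set vertex_paths nat E -> \bar R},
    forall B, m1 B = walk N x (sh @^-1` B `&` (fst @^-1` history h n)).
  by exists (push (mrestr (walk N x) mH) _ (measurable_path_shift n)).
have [m2 m2E] : exists m2 : {measure set vertex_paths nat E -> \bar R},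
    forall B, m2 B = (c%:E * walk N (h n) (fst @^-1` B))%E.
  by exists (mscale (NngNum c0) (push (walk N (h n)) _ mf0)).
suff : m1 A = m2 A.
  rewrite m1E m2E cE => <-; congr (walk N x _).
  by apply/seteqP; split=> w [].
have [hs hsP] := history_cover.
apply: (measure_unique histories (fun k => history (hs k) 0%N)) => //.
- by move=> k; right; exists (hs k), 0%N.
- by apply/seteqP; split=> // w _; have [k kw] := hsP 0%N w; exists k.
- move=> _ [->|[z [m ->]]]; first by rewrite !measure0.
  rewrite m1E m2E cE.
  have [/(_ x)[srwx _ _] /(_ (h n))[srwn _ _]] := (walkP N, walkP N).
  rewrite (srwx n h : walk N x (fst @^-1` history h n) = _).
  rewrite (srwn m z : walk N (h n) (fst @^-1` history z m) = _).
  have [z0|z0] := eqVneq (z 0%N) (h n); last first.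
    rewrite mul0r mule0 (_ : _ `&` _ = set0) ?measure0//.
    apply/seteqP; split=> // w [/(_ 0%N isT)/= + /(_ n (leqnn n))/= wn].
    by rewrite /sh addn0 wn => /esym/eqP; rewrite (negbTE z0).
  (* The concatenation of [h] up to time n with [z] after it; the two agree at time n because z 0 =
     h n. *)
  pose hz i := if (i <= n)%N then h i else z (i - n)%N.
  rewrite [X in walk N x X](_ : _ = fst @^-1` history hz (n + m)); last first.
    apply/seteqP; split=> w.
      move=> [/= zw hw] i lei; rewrite /hz; case: leqP => lin; first exact: hw.
      by rewrite -zw ?leq_subLR// /sh subnKC// ltnW.
    move=> /= hzw; split=> i lei /=.
      rewrite /sh hzw ?leq_add2l// /hz; case: leqP => [|_].
        by rewrite -[X in (_ <= X)%N]addn0 leq_add2l leqn0 => /eqP ->; rewrite addn0.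
      by rewrite addKn.
    by rewrite hzw ?(leq_trans lei) ?leq_addr// /hz lei.
  rewrite (srwx (n + m)%N hz : walk N x (fst @^-1` history hz (n + m)) = _).
  rewrite -EFinM mul1r -mulrA big_split_ord/=; congr (_ * (_ * _))%:E.
  + by apply: eq_bigr => i _; rewrite /hz ltnW// ltn_ord.
  + apply: eq_bigr => i _; rewrite /hz ltnNge leq_addr/= -addnS !addKn.
    case: leqP => [|//].
    rewrite -[X in (_ <= X)%N]addn0 leq_add2l leqn0 => /eqP ->.
    by rewrite addn0 z0.
- move=> k; rewrite m1E; apply: (le_lt_trans (probability_le1 _ _)).
    apply: measurableI => //; apply: measurable_path_future.
    exact: measurable_history.
  exact: ltey.
Qed.

(** The event of being at [y] at time n is a countable union of histories ending at [y], and the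
    property is already known on each. *)
Lemma walk_markov x y n A : measurable A ->
  walk N x ([set w | w.1 n = y] `&` [set w | A (fun i => w.1 (n + i)%N)]) =
  (walk N x [set w | w.1 n = y] * walk N y (fst @^-1` A))%E.
Proof.
move=> mA; have [hs hsP] := history_cover.
pose F k : set (walk_space R E) :=
  if hs k n == y then fst @^-1` history (hs k) n else set0.
have mF k : measurable (F k).
  rewrite /F; case: ifP => // _.
  exact: measurable_path_event (measurable_history _ _).
have mD k : measurable (seqDU F k).
  by apply: measurableD => //; exact: bigsetU_measurable.
have yE : [set w : walk_space R E | w.1 n = y] = \bigcup_k seqDU F k.
  rewrite -seqDU_bigcup_eq; apply/seteqP; split=> w /=.
    move=> wy; have [k kw] := hsP n w.1; exists k => //.
    by rewrite /F -(kw n (leqnn _)) wy eqxx.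
  by move=> [k _]; rewrite /F; case: eqP => // <- /(_ n (leqnn _)).
have mAn := measurable_path_future n mA.
rewrite yE setI_bigcupl measure_bigcup//=; last 2 first.
- by move=> k _; exact: measurableI.
- by apply: trivIset_setIr; exact: trivIset_seqDU.
rewrite measure_bigcup//= muleC -[walk N y _]fineK ?fin_num_measure//; last first.
  exact: measurable_path_event.
rewrite -nneseriesZl//.
apply: eq_eseriesr => k _.
(* Two histories of the same length are equal or disjoint, so making the sequence disjoint leaves
   each event either empty or unchanged. *)
have [[j jk [v [Fj Fk]]]|noj] := pselect (exists2 j, (j < k)%N & F j `&` F k !=set0).
  have -> : seqDU F k = set0.
    apply/seteqP; split=> // w -[Fkw]; apply; rewrite /= -bigcup_mkord; exists j => //.
    move: Fj Fk Fkw; rewrite /F; case: eqP => // _ jv; case: eqP => // _ kv kw i lein.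
    by rewrite -jv// kw// kv.
  by rewrite set0I measure0 mule0.
have -> : seqDU F k = F k.
  apply/seteqP; split=> [w []//|w Fkw]; split=> //; rewrite -bigcup_mkord => -[j jk Fjw].
  by apply: noj; exists j => //; exists w.
rewrite fineK ?fin_num_measure//; last exact: measurable_path_event.
rewrite /F; case: eqP => [<-|_]; last by rewrite set0I measure0 mule0.
by rewrite muleC -markov_history.
Qed.

End walk_markov_property.

Lemma measure0_bigcup d (T : measurableType d) (R : realType)
    (mu : {measure set T -> \bar R}) (A : set T) (F : nat -> set T) :
  measurable A -> (forall n, measurable (F n)) -> A `<=` \bigcup_n F n ->
  (forall n, mu (F n) = 0%E) -> mu A = 0%E.
Proof.
move=> mA mF AF F0; apply/eqP; rewrite eq_le measure_ge0 andbT.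
by rewrite (le_trans (measure_sigma_subadditive mu mF mA AF))// eseries0.
Qed.

Lemma measure_bigcupT d (T : measurableType d) (R : realType)
    (mu : {measure set T -> \bar R}) (F : nat -> set T) :
  (forall n, measurable (F n)) -> trivIset setT F ->
  mu (\bigcup_n F n) = (\sum_(0 <= n <oo) mu (F n))%E.
Proof.
move=> mF tF; rewrite measure_bigcup//; apply: eq_eseriesl => n.
by rewrite in_setT.
Qed.

Lemma nneseries_mulr (R : realType) (f : nat -> \bar R) (c : \bar R) :
  c \is a fin_num -> (forall n, (0 <= f n)%E) ->
  ((\sum_(0 <= n <oo) f n) * c = \sum_(0 <= n <oo) (f n * c))%E.
Proof.
move=> cfin f0; rewrite muleC -(fineK cfin) -nneseriesZl//.
by apply: eq_eseriesr => n _; rewrite muleC.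
Qed.

(** * Transience, last exits and expected visits *)

Section walk_green.
Context (R : realType) (E : pointedType) (N : transient_network R E).
Implicit Types (x y z : E) (n m : nat) (K : {fset E}).

Lemma measurable_infinitely_often y :
  measurable [set w : vertex_paths nat E | infinite_set [set n | w n = y]].
Proof.
rewrite [X in measurable X](_ : _ = \bigcap_n \bigcup_(m in [set m | (n <= m)%N])
   (fun w : vertex_paths nat E => w m) @^-1` [set y]); last first.
  apply/seteqP; split=> w.
    move=> /infinite_nat_cofinal wy n _.
    by have [m [nm wm]] := wy n; exists m.
  move=> wy; apply/infinite_nat_cofinal => n.
  by have [m nm wm] := wy n I; exists m.
apply: bigcapT_measurable => n; apply: bigcup_measurable => m _.
exact: measurable_vertex_path.
Qed.

Lemma measurable_never_returns K : measurable (never_returns K).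
Proof.
rewrite [never_returns K](_ : _ = \bigcap_(n in [set n | (1 <= n)%N])
   (fun w : vertex_paths nat E => w n) @^-1` (~` [set` K])); last first.
  apply/seteqP; split=> w /=.
    by move=> wK n n1; apply/negP; exact: wK.
  by move=> wK n n1; apply/negP; exact: wK.
apply: bigcap_measurableType => n _.
exact: measurable_vertex_path.
Qed.

Lemma walk_start x : walk N x [set w | w.1 0%N = x] = 1%E.
Proof.
have [+ _ _] := walkP N x => /(_ 0%N (fun=> x)).
rewrite big_ord0 mulr1 eqxx => <-; congr (walk N x _).
apply/seteqP; split=> w /= w0; last exact: w0.
by move=> i; rewrite leqn0 => /eqP ->.
Qed.

(** Transience is given for the starting vertex only. Infinitely many visits to [y] contain, after
    some visit, a walk from [y] that returns infinitely often, which the Markov property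
    excludes. *)
Lemma walk_visits_finite x y :
  walk N x [set w | infinite_set [set n | w.1 n = y]] = 0%E.
Proof.
have mio := measurable_infinitely_often y.
pose F n : set (walk_space R E) := [set w | w.1 n = y] `&`
  [set w | infinite_set [set m | w.1 (n + m)%N = y]].
have F0 n : walk N x (F n) = 0%E.
  rewrite /F (walk_markov N x y n (A := [set w | infinite_set [set m | w m = y]]))//.
  by rewrite (walk_transient N y) mule0.
have mF n : measurable (F n).
  apply: measurableI; first exact: measurable_visit.
  exact: (measurable_path_future n mio).
have sub : [set w : walk_space R E | infinite_set [set n | w.1 n = y]] `<=` \bigcup_n F n.
  move=> w /infinite_nat_cofinal wy; have [n [_ wn]] := wy 0%N.
  exists n => //; split=> //; apply/infinite_nat_cofinal => m.
  have [p [nmp wp]] := wy (n + m)%N.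
  exists (p - n)%N; split; first by rewrite leq_subRL// (leq_trans _ nmp)// leq_addr.
  by rewrite /= subnKC// (leq_trans _ nmp)// leq_addr.
exact: (measure0_bigcup (measurable_path_event mio) mF sub F0).
Qed.

Lemma total_weight_ge0 x : 0 <= total_weight N x.
Proof. by apply: fsumr_ge0 => y _; exact: weight_ge0. Qed.

(** If the total weight vanished, all transition probabilities out of [x] would be 0, division by 0
    giving 0; every one-step history would be null, against the total mass 1. *)
Lemma total_weight_gt0 x : 0 < total_weight N x.
Proof.
rewrite lt_neqAle total_weight_ge0 andbT eq_sym; apply/eqP => l0.
have [hs hsP] := history_cover N.
have H0 k : walk N x (fst @^-1` history (hs k) 1) = 0%E.
  have [srw _ _] := walkP N x.
  rewrite (srw 1%N (hs k) : walk N x (fst @^-1` history (hs k) 1) = _).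
  by rewrite big_ord1 /trans_prob; case: eqP => [->|_]; rewrite ?l0 ?invr0 ?mulr0 ?mul0r.
have : walk N x setT = 0%E.
  apply: (measure0_bigcup _ _ _ H0) => // [k|w _].
    by apply: measurable_path_event; exact: measurable_history.
  by have [k kw] := hsP 1%N w.1; exists k.
by rewrite probability_setT => /eqP; rewrite onee_eq0.
Qed.

Definition visits x y : \bar R := (\sum_(0 <= n <oo) walk N x [set w | w.1 n = y])%E.

(** The terms are the probabilities of the possible times and places of the last visit to [K]. A
    last visit almost surely exists, since the walk starts in [K] and visits each vertex finitely
    often. *)
Lemma last_exit K x : x \in K ->
  (\sum_(z <- K) visits x z * walk N z (fst @^-1` never_returns K) = 1)%E.
Proof.
move=> xK; have mNR := measurable_never_returns K.
pose D n z : set (walk_space R E) := [set w | w.1 n = z] `&`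
  [set w | never_returns K (fun i => w.1 (n + i)%N)].
have mD n z : measurable (D n z).
  apply: measurableI; first exact: measurable_visit.
  exact: (measurable_path_future n mNR).
pose DK n := \bigcup_(z in [set` K]) D n z.
have mDK n : measurable (DK n) by exact: fin_bigcup_measurable.
have PDK n : walk N x (DK n) = (\sum_(z <- K) walk N x [set w | w.1 n = z] *
    walk N z (fst @^-1` never_returns K))%E.
  rewrite /DK measure_fin_bigcup//; last first.
    by move=> z1 z2 _ _ [w [[/= <- _] [/= <- _]]].
  rewrite -fsbig_seq//; apply: eq_bigr => z _; exact: walk_markov.
have tDK : trivIset setT DK.
  apply/trivIsetP => n m _ _; wlog nm : n m / (n < m)%N => [hw|] neq.
    have [nm|mn|nm] := ltngtP n m; first exact: hw.
      by rewrite setIC; apply: hw => //; rewrite eq_sym.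
    by rewrite nm eqxx in neq.
  apply/seteqP; split=> // w [[z zK [/= wz NR]] [z' z'K [/= wz' _]]].
  move: (NR (m - n)%N); rewrite subn_gt0 => /(_ nm) /=.
  rewrite subnKC; last exact: ltnW.
  by rewrite wz' (z'K : z' \in K).
have -> : (\sum_(z <- K) visits x z * walk N z (fst @^-1` never_returns K) =
    walk N x (\bigcup_n DK n))%E.
  rewrite measure_bigcupT//.
  transitivity (\sum_(0 <= n <oo) \sum_(z <- K)  walk N x [set w | w.1 n = z] *
    walk N z (fst @^-1` never_returns K))%E; last first.
    by apply: eq_eseriesr => n _; exact/esym/PDK.
  rewrite nneseries_sum//; last by move=> *; rewrite mule_ge0.
  apply: eq_bigr => z _; rewrite nneseries_mulr// fin_num_measure//.
  exact: measurable_path_event.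
have mU : measurable (\bigcup_n DK n) by exact: bigcup_measurable.
pose bad z : set (walk_space R E) := [set w | infinite_set [set n | w.1 n = z]].
have mbad z : measurable (bad z).
  exact: measurable_path_event (measurable_infinitely_often z).
suff : walk N x (~` (\bigcup_n DK n)) = 0%E.
  move=> h; rewrite -[X in walk N x X = _]setCK probability_setC ?h ?sube0//.
  exact: measurableC.
(* Null events covering the paths without a last visit: a wrong starting vertex for index 0, and
   infinitely many visits to an element of [K] for the others. *)
pose F n : set (walk_space R E) := if n is n'.+1 then
  (if (nth x K n') \in K then bad (nth x K n') else set0) else ~` [set w | w.1 0%N = x].
apply: (@measure0_bigcup _ _ _ _ _ F).
- exact: measurableC.
- move=> [|n] /=; first by apply: measurableC; exact: measurable_visit.
  by case: ifP.
- move=> w wDK; apply: contrapT => wF; apply: wDK.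
  have w0 : w.1 0%N = x.
    by apply: contrapT => w0; apply: wF; exists 0%N.
  have fin z : z \in K -> finite_set [set n | w.1 n = z].
    move=> zK; apply: contrapT => winf; apply: wF; exists (index z K).+1 => //=.
    by rewrite nth_index// zK.
  have [M MK] : exists M, forall n, w.1 n \in K -> (n <= M)%N.
    have : finite_set (\bigcup_(z in [set` K]) [set n | w.1 n = z]).
      exact: bigcup_finite.
    move=> /finite_seqP[s sE]; exists (\max_(i <- s) i) => n wnK.
    apply: leq_bigmax_seq => //.
    suff : [set` s] n by [].
    by rewrite -sE; exists (w.1 n).
  have ex0 : exists n, w.1 n \in K by exists 0%N; rewrite w0.
  pose n := ex_maxn ex0 MK; exists n => //.
  rewrite /n; case: ex_maxnP => l wl lmax; exists (w.1 l) => //; split=> // j j1.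
  apply/negP => /lmax; rewrite -[X in (_ <= X)%N]addn0 leq_add2l leqn0 => /eqP j0.
  by rewrite j0 in j1.
- move=> [|n] /=.
    by rewrite probability_setC ?walk_start ?subee//; exact: measurable_visit.
  by case: ifP => // _; exact: walk_visits_finite.
Qed.

End walk_green.

Lemma measurable_pred d (T : measurableType d) (f : T -> bool) :
  measurable_fun setT f -> measurable [set x | f x].
Proof. by move=> mf; rewrite -[X in measurable X]setTI; exact: (mf measurableT [set true]). Qed.

Lemma measurable_natrb d (T : measurableType d) (R : realType) (b : T -> bool) :
  measurable [set x | b x] -> measurable_fun setT (fun x => (b x)%:R : R).
Proof.
move=> mb; rewrite (_ : (fun x => _) = \1_[set x | b x]); first exact: measurable_indic.
by apply/funext => x; rewrite indicE; congr (nat_of_bool _)%:R; apply/idP/idP; rewrite inE.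
Qed.

Section green_visits.
Context (R : realType) (E : pointedType) (N : transient_network R E).
Implicit Types (x y z : E) (n k : nat).

Lemma measurable_real_field (I : Type) (i : I) :
  measurable_fun setT ((fun s => s i) : real_fields I R -> measurableTypeR R).
Proof.
move=> _ B mB; rewrite setTI; apply: sub_sigma_algebra; exists i => //.
by exists B => //; rewrite setTI.
Qed.

Lemma measurable_holding k :
  measurable_fun setT ((fun w => w.2 k) : walk_space R E -> measurableTypeR R).
Proof.
have m2 : measurable_fun setT ((fun w => w.2) : walk_space R E -> real_fields nat R).
  exact: (@measurable_snd _ _ (vertex_paths nat E) (real_fields nat R)).
exact: (measurableT_comp (measurable_real_field k) m2).
Qed.

Lemma walk_visit_holding x y k (B : set (measurableTypeR R)) : measurable B ->
  walk N x ([set w | w.1 k = y] `&` (fun w => w.2 k) @^-1` B) =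
  (walk N x [set w | w.1 k = y] * exponential_prob 1 B)%E.
Proof.
move=> mB; have [_ iid ind] := walkP N x.
have mV : measurable [set w : vertex_paths nat E | w k = y].
  exact: (measurable_vertex_path k [set y]).
have mH : measurable [set s : real_fields nat R | B (s k)].
  by have := measurable_real_field k measurableT mB; rewrite setTI.
have := ind _ _ mV mH.
rewrite (_ : _ `*` _ = [set w | w.1 k = y] `&` (fun w => w.2 k) @^-1` B); last first.
  by apply/seteqP; split=> w.
move=> ->; congr (_ * _)%E.
have := iid [fset k]%fset (fun=> B) (fun=> mB).
rewrite big_seq_fset1 => <-; congr (walk N x _).
apply/seteqP; split=> w /=; last by apply; rewrite /= inE.
by move=> Bw i /=; rewrite inE => /eqP ->.
Qed.

(** The path space allows arbitrary real holding times; the exponential law gives no mass to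
    negative ones. *)
Lemma walk_holding_ge0 x : {ae walk N x, forall w, forall k, 0 <= w.2 k}.
Proof.
have [_ iid _] := walkP N x.
have mI : measurable (`]-oo, 0%R[%classic : set (measurableTypeR R)) by exact: measurable_itv.
pose F k : set (walk_space R E) := (fun w => w.2 k) @^-1` `]-oo, 0%R[%classic.
have mF k : measurable (F k).
  by rewrite -[F k]setTI; exact: (measurable_holding k measurableT mI).
exists (\bigcup_k F k); split; first exact: bigcup_measurable.
  apply: (measure0_bigcup _ mF) => //; first exact: bigcup_measurable.
  move=> k; have := iid [fset k]%fset (fun=> `]-oo, 0%R[%classic) (fun=> mI).
  rewrite big_seq_fset1 -exp1_lawE exp1_law_neg => <-; congr (walk N x _).
  apply/seteqP; split=> w /=; last by apply; rewrite /= inE.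
  by move=> Bw i /=; rewrite inE => /eqP ->.
by move=> w /= /existsNP[k /negP]; rewrite -ltNge => wk; exists k.
Qed.

Let jump (k : nat) (w : walk_space R E) : R := \sum_(i < k) w.2 i.

Let measurable_jump k : measurable_fun setT (jump k).
Proof. by apply: measurable_sum => i; exact: measurable_holding. Qed.

(** A subset of paths times time: its joint measurability makes the Lebesgue measure of its sections
    a measurable function of the path. *)
Let occupied y k : set (walk_space R E * measurableTypeR R) :=
  [set p | jump k p.1 <= p.2] `&` [set p | p.2 < jump k.+1 p.1] `&` [set p | p.1.1 k = y].

Let measurable_occupied y k : measurable (occupied y k).
Proof.
have m1 j : measurable_fun setT (fun p : walk_space R E * measurableTypeR R => jump j p.1).
  exact: (measurableT_comp (measurable_jump j) measurable_fst).
have m2 : measurable_fun setT (fun p : walk_space R E * measurableTypeR R => p.2 : R).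
  exact: measurable_snd.
apply: measurableI; first apply: measurableI.
- exact: measurable_pred (measurable_fun_ler (m1 k) m2).
- exact: measurable_pred (measurable_fun_ltr m2 (m1 k.+1)).
- rewrite -[X in measurable X]setTI.
  exact: (measurable_fst measurableT _ (measurable_visit k y)).
Qed.

(** Nonnegative holding times make the jump times nondecreasing, so the intervals between jumps are
    disjoint and their lengths add up. *)
Let occupied_measure y (w : walk_space R E) : (forall k, 0 <= w.2 k) ->
  lebesgue_measure (xsection ((\bigcup_k occupied y k) `&` (setT `*` `[0%R, +oo[)) w) =
  (\sum_(0 <= k <oo) (w.2 k * (w.1 k == y)%:R)%:E)%E.
Proof.
move=> w0.
pose I k : set R := if w.1 k == y then `[jump k w, jump k.+1 w[%classic else set0.
have jumpS k : jump k.+1 w = jump k w + w.2 k by rewrite /jump big_ord_recr.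
have jump_homo i j : (i <= j)%N -> jump i w <= jump j w.
  move=> /subnK <-; elim: (j - i)%N => [//|l IH].
  by rewrite addSn jumpS (le_trans IH)// lerDl.
rewrite (_ : xsection _ w = \bigcup_k I k).
  rewrite measure_bigcupT.
  - apply: eq_eseriesr => k _; rewrite /I; case: eqP => wk; last first.
      by rewrite measure0 mulr0.
    rewrite -[LHS]/(lebesgue_measure (`[jump k w, jump k.+1 w[%classic : set R)).
    rewrite lebesgue_measure_itv/= lte_fin jumpS ltrDl mulr1.
    case: ltP => wk0; first by rewrite -EFinB addrAC subrr add0r.
    by congr EFin; apply/eqP; rewrite eq_le w0 wk0.
  - by move=> k; rewrite /I; case: ifP.
  - apply/trivIsetP => i j _ _; wlog ij : i j / (i < j)%N => [hw|] neq.
      have [ij|ij|ij] := ltngtP i j; first exact: hw.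
        by rewrite setIC; apply: hw => //; rewrite eq_sym.
      by rewrite ij eqxx in neq.
    apply/seteqP; split=> // t; rewrite /I; case: ifP => _; case: ifP => _; try by case.
    rewrite /= !in_itv/= => -[/andP[_ t1] /andP[t2 _]].
    by have := lt_le_trans t1 (le_trans (jump_homo _ _ ij) t2); rewrite ltxx.
apply/seteqP; split=> t.
  rewrite /xsection/= inE => -[[k _ [[/= t1 t2] wk]] _]; exists k => //.
  by rewrite /I wk eqxx/= in_itv/= t1 t2.
move=> [k _]; rewrite /I; case: eqP => // wk /=; rewrite in_itv/= => /andP[t1 t2].
rewrite /xsection/= inE; split; first by exists k.
split=> //=; rewrite in_itv/= andbT (le_trans _ t1)//.
by have := jump_homo _ _ (leq0n k); rewrite {1}/jump big_ord0.
Qed.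

(** The time spent at [y] is the sum of the holding times of the visits, and each holding time has
    mean 1 and is independent of the position. *)
Lemma green_visits x y :
  green N x y = (((total_weight N y)^-1)%:E * visits N x y)%E.
Proof.
congr (_ * _)%E.
pose S : set (walk_space R E * measurableTypeR R) :=
  (\bigcup_k occupied y k) `&` (setT `*` `[0%R, +oo[).
have mS : measurable S.
  apply: measurableI; first by apply: bigcup_measurable => k _; exact: measurable_occupied.
  by apply: measurableX => //; exact: measurable_itv.
transitivity (\int[walk N x]_w lebesgue_measure (xsection S w))%E.
  apply: eq_integral => w _.
  pose Sw : set (measurableTypeR R) := xsection (\bigcup_k occupied y k) w.
  have mSw : measurable Sw.
    by apply: measurable_xsection; apply: bigcup_measurable => k _; exact: measurable_occupied.
  rewrite (_ : [set s | walk_at w s y] = Sw).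
    rewrite integral_indic//; congr (lebesgue_measure _).
    apply/seteqP; split=> t; rewrite /Sw /S /xsection/= !inE.
      by move=> [].
    by move=> [? [_ ?]].
  apply/seteqP; split=> t; rewrite /Sw /xsection/= inE.
    by move=> [k [? ? ?]]; exists k.
  by move=> [k _ [[? ?] ?]]; exists k.
(* The absolute value makes every term nonnegative on all paths, at the price of a null set. *)
pose f k (w : walk_space R E) : \bar R := (`|w.2 k| * (w.1 k == y)%:R)%:E.
have mf k : measurable_fun setT (f k).
  apply/measurable_EFinP; apply: measurable_funM.
    by apply: measurableT_comp => //; exact: measurable_holding.
  apply: measurable_natrb; rewrite (_ : [set w | _] = [set w | w.1 k = y]).
    exact: measurable_visit.
  by apply/seteqP; split=> w /= /eqP.
transitivity (\int[walk N x]_w (\sum_(0 <= k <oo) f k w))%E.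
  apply: ae_eq_integral => //.
  - exact: (measurable_fun_xsection _ mS).
  - by apply: ge0_emeasurable_sum => // k w _ _; rewrite lee_fin mulr_ge0.
  have [B [mB B0 subB]] := walk_holding_ge0 x.
  exists B; split=> // w /= ne; apply: subB => /= w0; apply: ne => _.
  rewrite /S occupied_measure//; apply: eq_eseriesr => k _.
  by rewrite /f ger0_norm.
rewrite integral_nneseries//; last by move=> k w _; rewrite lee_fin mulr_ge0.
apply: eq_eseriesr => k _.
pose A : set (walk_space R E) := [set w | w.1 k = y].
have mA : measurable A by exact: measurable_visit.
transitivity (\int[walk N x]_(w in A) `|w.2 k|%:E)%E.
  rewrite [RHS]integral_mkcond; apply: eq_integral => w _.
  rewrite patchE /f; case: ifPn; rewrite /A ?inE ?notin_setE /=.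
    by move=> ->; rewrite eqxx mulr1.
  by move/eqP/negbTE ->; rewrite mulr0.
rewrite (@ge0_integral_exp1_law _ _ _ _ A mA (fun w => w.2 k) (fine (walk N x A))
  (fun r => `|r|))//.
- by rewrite exp1_moment1 mule1 fineK// fin_num_measure.
- exact: measurable_holding.
- by rewrite fine_ge0.
- by move=> B mB; rewrite fineK ?fin_num_measure//; exact: walk_visit_holding.
Qed.

End green_visits.

(** * Local times under the intensity measure *)

Lemma esum_int (R : realType) (a : int -> \bar R) : (forall n, (0 <= a n)%E) ->
  (\esum_(n in [set: int]) a n =
   \sum_(0 <= n <oo) a n%:Z + \sum_(0 <= n <oo) a (- n.+1%:Z)%R)%E.
Proof.
move=> a0; rewrite (esumID (range Posz))//; congr (_ + _)%E; rewrite setTI.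
  rewrite (reindex_esum setT _ Posz) ?nneseries_esumT//.
  by split=> [|? ? _ _ []//|//] n _; exists n.
rewrite (reindex_esum setT _ Negz) ?nneseries_esumT//.
split.
- by move=> n _ [m _].
- by move=> ? ? _ _ [].
- by move=> [n|n] /= h; [exfalso; apply: h; exists n|exists n].
Qed.

Section local_time.
Context (R : realType) (E : pointedType) (N : transient_network R E).
Implicit Types (x y z : E) (w : trajectories N) (ws : trajectories_mod_shift N).

Lemma shift_equivP w w' : mod_shift w = mod_shift w' ->
  exists k : int, forall n, vertex w n = vertex w' (n + k) /\
                            holding w n = holding w' (n + k).
Proof. by move=> /eqquotP/asboolP. Qed.

Lemma mod_shift_repr ws : mod_shift (repr ws) = ws.
Proof. exact: reprK. Qed.

Definition total_time x w : \bar R :=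
  (\esum_(n in [set: int]) (holding w n * (vertex w n == x)%:R)%:E)%E.

Lemma holding_visit_ge0 x w n : (0 <= (holding w n * (vertex w n == x)%:R)%:E)%E.
Proof. by rewrite lee_fin mulr_ge0// ltW// holding_gt0. Qed.

Lemma total_time_ge0 x w : (0 <= total_time x w)%E.
Proof. by apply: esum_ge0 => n _; exact: holding_visit_ge0. Qed.

Lemma total_time_fin x w : total_time x w \is a fin_num.
Proof.
have fin : finite_set [set n | vertex w n = x].
  apply: sub_finite_set (vertex_transient w [fset x]%fset) => n /= ->.
  by rewrite inE.
rewrite /total_time (esumID [set n | vertex w n = x]); last first.
  by move=> n _; exact: holding_visit_ge0.
rewrite [X in (_ + X)%E]esum1 ?adde0; last first.
  by move=> n [_ /= /eqP/negbTE ->]; rewrite mulr0.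
rewrite setTI esum_fset//; last by move=> n _; exact: holding_visit_ge0.
by rewrite fsumEFin.
Qed.

Lemma total_time_shift x w w' : mod_shift w = mod_shift w' ->
  total_time x w = total_time x w'.
Proof.
move=> /shift_equivP[k kw].
rewrite /total_time [RHS](reindex_esum setT _ (fun n => n + k)); last first.
  split => //.
    by move=> m n _ _ /addIr.
  by move=> n _; exists (n - k); rewrite //= subrK.
by apply: eq_esum => n _; have [-> ->] := kw n.
Qed.

(** Total times are invariant under shifts, so the representative is immaterial, and finite because
    a trajectory visits [x] finitely often; this gives a real-valued function. *)
Definition local_time x ws : R :=
  (total_weight N x)^-1 * fine (total_time x (repr ws)).

Lemma local_time_mod_shift x w :
  (local_time x (mod_shift w))%:E = ((total_weight N x)^-1%:E * total_time x w)%E.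
Proof.
rewrite /local_time EFinM fineK ?total_time_fin//; congr (_ * _)%E.
by apply: total_time_shift; rewrite mod_shift_repr.
Qed.

Lemma local_time_ge0 x ws : 0 <= local_time x ws.
Proof. by rewrite mulr_ge0 ?invr_ge0 ?total_weight_ge0 ?fine_ge0 ?total_time_ge0. Qed.

Lemma measurable_vertex n (B : set E) : measurable [set w : trajectories N | B (vertex w n)].
Proof.
apply: sub_sigma_algebra; left; exists n => //; exists B => //.
by rewrite setTI.
Qed.

Lemma measurable_holding_time n :
  measurable_fun setT ((fun w => holding w n) : trajectories N -> measurableTypeR R).
Proof.
move=> _ B mB; rewrite setTI; apply: sub_sigma_algebra; right; exists n => //.
by exists B => //; rewrite setTI.
Qed.

Lemma measurable_holding_visit x n :
  measurable_fun setT (fun w => (holding w n * (vertex w n == x)%:R)%:E).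
Proof.
apply/measurable_EFinP; apply: measurable_funM; first exact: measurable_holding_time.
apply: measurable_natrb; rewrite (_ : [set w | _] = [set w | [set x] (vertex w n)]).
  exact: measurable_vertex.
by apply/seteqP; split=> w /= /eqP.
Qed.

Lemma measurable_total_time x : measurable_fun setT (total_time x).
Proof.
rewrite (_ : total_time x = fun w =>
  (\sum_(0 <= n <oo) (holding w n%:Z * (vertex w n%:Z == x)%:R)%:E +
   \sum_(0 <= n <oo) (holding w (- n.+1%:Z)%R * (vertex w (- n.+1%:Z)%R == x)%:R)%:E)%E).
  apply: emeasurable_funD; apply: ge0_emeasurable_sum => //.
  - by move=> n w _ _; exact: holding_visit_ge0.
  - by move=> n _; exact: measurable_holding_visit.
  - by move=> n w _ _; exact: holding_visit_ge0.
  - by move=> n _; exact: measurable_holding_visit.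
apply/funext => w; rewrite /total_time esum_int// => n; exact: holding_visit_ge0.
Qed.

Lemma measurable_mod_shift : measurable_fun setT (@mod_shift R E N).
Proof. by move=> _ B mB; rewrite setTI. Qed.

Lemma measurable_local_time x : measurable_fun setT (local_time x).
Proof.
move=> _ B mB; rewrite setTI /measurable/=.
rewrite (_ : _ @^-1` _ =
  (fun w => (total_weight N x)^-1 * fine (total_time x w)) @^-1` B).
  rewrite -[X in measurable X]setTI; apply: measurable_funM => //.
  by apply: measurableT_comp => //; exact: measurable_total_time.
apply/seteqP; split=> w; rewrite /= /local_time.
  by rewrite (@total_time_shift x (repr _) w) ?mod_shift_repr.
by rewrite (@total_time_shift x (repr _) w) ?mod_shift_repr.
Qed.

Lemma entersE (K : {fset E}) w : enters K (mod_shift w) <-> exists n, vertex w n \in K.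
Proof.
split=> [[w' [n w'n] /shift_equivP[k kw]]|[n wn]]; last by exists w => //; exists n.
by exists (n + k); have [<- _] := kw n.
Qed.

Lemma measurable_enters (K : {fset E}) : measurable (@enters R E N K).
Proof.
rewrite /measurable/= (_ : _ @^-1` _ =
    \bigcup_(n in [set: int]) [set w : trajectories N | [set` K] (vertex w n)]).
  apply: countable_bigcupT_measurable => // n; exact: measurable_vertex.
apply/seteqP; split=> w; first by move/entersE => [n wn]; exists n.
by move=> [n _ wn]; apply/entersE; exists n.
Qed.

Lemma local_time_out (K : {fset E}) x ws : x \in K -> ~ enters K ws -> local_time x ws = 0.
Proof.
move=> xK nK; rewrite /local_time /total_time esum1 ?mulr0// => n _.
have [wx|] := eqVneq (vertex (repr ws) n) x; last by rewrite mulr0.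
exfalso; apply: nK; rewrite -(mod_shift_repr ws); apply/entersE; exists n.
by rewrite wx.
Qed.

Lemma occupation_local_time (w : nat -> trajectories N) (u : nat -> R) x a :
  occupation w u x a =
  (\sum_(0 <= i <oo) (u i <= a)%R%:R%:E * (local_time x (mod_shift (w i)))%:E)%E.
Proof.
rewrite /occupation -nneseriesZl; last first.
  move=> i _; apply: esum_ge0 => n _; rewrite lee_fin mulr_ge0//.
  by rewrite ltW// holding_gt0.
apply: eq_eseriesr => i _; rewrite local_time_mod_shift muleCA; congr (_ * _)%E.
case: (u i <= a).
  by rewrite mul1e; apply: eq_esum => n _; rewrite andbT.
by rewrite mul0e esum1// => n _; rewrite andbF mulr0.
Qed.

End local_time.

Lemma nneseries_tail (R : realType) (f : nat -> \bar R) n : (forall m, (0 <= f m)%E) ->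
  (\sum_(0 <= m <oo) (n <= m)%N%:R%:E * f m = \sum_(0 <= k <oo) f (n + k)%N)%E.
Proof.
move=> f0.
rewrite [LHS]nneseries_esumT; last by move=> m; rewrite mule_ge0// lee_fin.
rewrite (esumID [set m | (n <= m)%N]); last by move=> m _; rewrite mule_ge0// lee_fin.
rewrite [X in (_ + X)%E]esum1 ?adde0; last first.
  by move=> m [_ /= /negP/negbTE ->]; rewrite mul0e.
rewrite setTI (reindex_esum setT _ (addn n)); last first.
  split.
  - by move=> k _ /=; rewrite leq_addr.
  - by move=> i j _ _ /addnI.
  - by move=> m /= nm; exists (m - n)%N => //; rewrite subnKC.
rewrite [RHS]nneseries_esumT//; apply: eq_esum => k _.
by rewrite leq_addr mul1e.
Qed.

(** * Local times under the measures Q_K *)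

Section equilibrium_law.
Context (R : realType) (E : pointedType) (N : transient_network R E).
Context (K : {fset E}) (QK : {finite_measure set (trajectories N) -> \bar R}).
Hypothesis hQ : is_QK K QK.
Implicit Types (x y z : E).

Let measurable_start x : measurable [set w : trajectories N | vertex w 0 = x].
Proof. exact: (measurable_vertex 0 [set x]). Qed.

Let e_fin x : equilibrium N K x \is a fin_num.
Proof.
rewrite fin_numM// fin_num_measure//; apply: measurable_path_event.
exact: measurable_never_returns.
Qed.

Let QK_start x : QK [set w | vertex w 0 = x] = equilibrium N K x.
Proof. by have [+ _] := hQ; apply. Qed.

Let e_ge0 x : (0 <= equilibrium N K x)%E.
Proof. by rewrite -QK_start. Qed.

Let measurable_forward : measurable_fun setT (@forward_path R E N).
Proof.
apply: (@measurability _ _ (trajectories N) (vertex_paths nat E) _ _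
  (family_events (fun i (w : nat -> E) => w i) discrete_measurable)) => //.
move=> _ [_ [i _ [B _ <-]] <-]; rewrite !setTI.
exact: (measurable_vertex i%:Z B).
Qed.

Let measurable_backward : measurable_fun setT (@backward_path R E N).
Proof.
apply: (@measurability _ _ (trajectories N) (vertex_paths nat E) _ _
  (family_events (fun i (w : nat -> E) => w i) discrete_measurable)) => //.
move=> _ [_ [i _ [B _ <-]] <-]; rewrite !setTI.
exact: (measurable_vertex (- i%:Z) B).
Qed.

Let measurable_times : measurable_fun setT (@holding_times R E N).
Proof.
apply: (@measurability _ _ (trajectories N) (real_fields int R) _ _
  (family_events (fun i (w : int -> R) => w i) measurable)) => //.
move=> _ [_ [i _ [B mB <-]] <-]; rewrite !setTI.
by have := measurable_holding_time (N := N) i measurableT mB; rewrite setTI.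
Qed.

Let measurable_pre d (T : measurableType d) (f : trajectories N -> T) A :
  measurable_fun setT f -> measurable A -> measurable (f @^-1` A).
Proof. by move=> mf mA; rewrite -[X in measurable X]setTI; exact: mf. Qed.

Let QK_null_start (A : set (trajectories N)) : measurable A ->
  (forall x, QK (A `&` [set w | vertex w 0 = x]) = 0%E) -> QK A = 0%E.
Proof.
move=> mA A0; have [hs hsP] := history_cover N.
apply: (@measure0_bigcup _ _ _ QK A (fun k => A `&` [set w | vertex w 0 = hs k 0%N])) => //.
- by move=> k; exact: measurableI.
- move=> w Aw; have [k kw] := hsP 0%N (fun=> vertex w 0); exists k => //.
  by split=> //; exact: kw.
- by move=> k; exact: A0.
Qed.

Let QK_cond (A : set (trajectories N)) x : (0 < equilibrium N K x)%E ->
  (QK (A `&` [set w | vertex w 0 = x]) / QK [set w | vertex w 0 = x] * equilibrium N K x =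
   QK (A `&` [set w | vertex w 0 = x]))%E.
Proof. by move=> e0; rewrite QK_start -muleA mulVe ?mule1// gt_eqF. Qed.

(** The conditional law is unspecified at vertices where the equilibrium measure vanishes; such
    starting points carry no mass. *)
Let QK_null_e (A : set (trajectories N)) x : measurable A -> ~ (0 < equilibrium N K x)%E ->
  QK (A `&` [set w | vertex w 0 = x]) = 0%E.
Proof.
move=> mA /negP; rewrite -leNgt -QK_start => e0; apply/eqP; rewrite eq_le measure_ge0 andbT.
by rewrite (le_trans _ e0)// le_measure ?inE//; exact: measurableI.
Qed.

Let measurable_start_out : measurable [set w : trajectories N | vertex w 0 \notin K].
Proof.
rewrite (_ : [set w | _] = [set w : trajectories N | (~` [set` K]) (vertex w 0)]).
  exact: measurable_vertex.
by apply/seteqP; split=> w /= /negP.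
Qed.

Lemma QK_start_in : QK [set w | vertex w 0 \notin K] = 0%E.
Proof.
apply: QK_null_start => // x; have [xK|xK] := boolP (x \in K).
  rewrite (_ : _ `&` _ = set0) ?measure0//; apply/seteqP; split=> // w [/= + wx].
  by rewrite wx xK.
by apply: QK_null_e => //; rewrite /equilibrium (negbTE xK) mulr0 mule0 ltxx.
Qed.

(** The conditional law of the backward path gives to the complement of never returning the mass of
    an empty set. *)
Lemma QK_backward : QK (~` (@backward_path R E N @^-1` never_returns K)) = 0%E.
Proof.
have mNR := measurable_never_returns K.
have mA : measurable (~` (@backward_path R E N @^-1` never_returns K)).
  by apply: measurableC; exact: measurable_pre.
apply: QK_null_start => // x.
have [e0|e0] := pselect (0 < equilibrium N K x)%E; last exact: QK_null_e.
have [_ /(_ x e0)/= [_ _ bwd _]] := hQ.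
have := bwd (~` never_returns K) (measurableC mNR).
rewrite setICl preimage_set0 measure0 mul0e => h.
by rewrite -(QK_cond _ e0) preimage_setC h mul0e.
Qed.

(** Given the start, the forward path and the holding times are independent. Averaging over the
    start yields the walk with the equilibrium measure as initial measure, times the common
    conditional probability [p] of the holding event. *)
Lemma QK_forward (A : set (vertex_paths nat E)) (C : set (real_fields int R)) p :
  measurable A -> measurable C ->
  (forall x, (0 < equilibrium N K x)%E ->
    (QK ((@holding_times R E N @^-1` C) `&` [set w | vertex w 0 = x]) /
     QK [set w | vertex w 0 = x] = p)%E) ->
  QK ((@forward_path R E N @^-1` A) `&` (@holding_times R E N @^-1` C)) =
  ((\sum_(z <- K) equilibrium N K z * walk N z (fst @^-1` A)) * p)%E.
Proof.
move=> mA mC Cp.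
set S := _ `&` _.
have mS : measurable S by apply: measurableI; exact: measurable_pre.
have step z : QK (S `&` [set w | vertex w 0 = z]) =
    (equilibrium N K z * walk N z (fst @^-1` A) * p)%E.
  have [e0|e0] := pselect (0 < equilibrium N K z)%E; last first.
    rewrite QK_null_e//; have -> : equilibrium N K z = 0%E.
      apply/eqP; rewrite eq_le -{2}QK_start measure_ge0 andbT leNgt; exact/negP.
    by rewrite !mul0e.
  have [_ /(_ z e0)/= [ind fwd _ _]] := hQ.
  have := ind A setT C mA measurableT mC.
  rewrite !preimage_setT setIT fwd// Cp//.
  rewrite [X in (_ * X * _)%E](_ : _ = 1%E) ?mule1; last first.
    by rewrite setTI QK_start divee// gt_eqF.
  by move=> h; rewrite -(QK_cond _ e0) h muleC muleA.
have -> : QK S = QK (\bigcup_(z in [set` K]) (S `&` [set w | vertex w 0 = z])).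
  rewrite -[in LHS](setIT S) -(setUv [set w : trajectories N | vertex w 0 \notin K]) setIUr.
  rewrite measureU; last 3 first.
  - exact: measurableI.
  - by apply: measurableI => //; exact: measurableC.
  - by apply/seteqP; split=> // w [[_ h1] [_ h2]]; exact: h2.
  rewrite [X in (X + _)%E](_ : _ = 0%E) ?add0e; last first.
    apply/eqP; rewrite eq_le measure_ge0 andbT -QK_start_in le_measure ?inE//.
    exact: measurableI.
  congr (QK _); apply/seteqP; split=> w.
    by move=> [Sw /= /negP]; rewrite negbK => wK; exists (vertex w 0).
  by move=> [z zK [Sw wz]]; split=> //=; rewrite wz => /negP; apply; exact: zK.
rewrite measure_fin_bigcup//; last 2 first.
- by move=> z1 z2 _ _ [w [[_ /= <-] [_ /= <-]]].
- by move=> z _; exact: measurableI.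
rewrite -fsbig_seq// ge0_sume_distrl//; last by move=> z _; rewrite mule_ge0// ?e_ge0.
by apply: eq_bigr => z _; exact: step.
Qed.

(** The mass of a path event for the walk whose initial measure is the equilibrium measure of
    [K]. *)
Let c (A : set (vertex_paths nat E)) : \bar R :=
  (\sum_(z <- K) equilibrium N K z * walk N z (fst @^-1` A))%E.

Let QK_forward0 A : measurable A -> QK (@forward_path R E N @^-1` A) = c A.
Proof.
move=> mA; have := @QK_forward A setT 1%E mA measurableT.
rewrite preimage_setT setIT mule1; apply => x e0.
by rewrite setTI QK_start divee// gt_eqF.
Qed.

Let c_fin A : measurable A -> c A \is a fin_num.
Proof. by move=> mA; rewrite -QK_forward0// fin_num_measure//; exact: measurable_pre. Qed.

Let c_ge0 A : (0 <= c A)%E.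
Proof. by apply: sume_ge0 => z _; rewrite mule_ge0. Qed.

Let QK_forward1 A (n : int) (B : set (measurableTypeR R)) : measurable A -> measurable B ->
  QK ((@forward_path R E N @^-1` A) `&` (fun w => holding w n) @^-1` B) =
  (c A * exponential_prob 1 B)%E.
Proof.
move=> mA mB; pose C : set (real_fields int R) := [set s | B (s n)].
have mC : measurable C.
  by have := measurable_real_field n measurableT mB; rewrite setTI.
apply: (@QK_forward A C) => // x e0.
have [_ /(_ x e0)/= [_ _ _ iid]] := hQ.
have := iid [fset n]%fset (fun=> B) (fun=> mB); rewrite big_seq_fset1 => <-.
congr (QK _ / _)%E; apply/seteqP; split=> w [Cw wx]; split=> //.
  by move=> i /=; rewrite inE => /eqP ->.
by apply: Cw; rewrite /= inE.
Qed.

Let QK_forward2 A (n m : int) (B1 B2 : set (measurableTypeR R)) : n != m ->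
  measurable A -> measurable B1 -> measurable B2 ->
  QK ((@forward_path R E N @^-1` A) `&`
    ((fun w => holding w n) @^-1` B1 `&` (fun w => holding w m) @^-1` B2)) =
  (c A * (exponential_prob 1 B1 * exponential_prob 1 B2))%E.
Proof.
move=> nm mA mB1 mB2; pose C : set (real_fields int R) := [set s | B1 (s n)] `&` [set s | B2 (s m)].
have mC : measurable C.
  apply: measurableI.
    by have := measurable_real_field n measurableT mB1; rewrite setTI.
  by have := measurable_real_field m measurableT mB2; rewrite setTI.
apply: (@QK_forward A C) => // x e0.
have [_ /(_ x e0)/= [_ _ _ iid]] := hQ.
pose B i := if i == n then B1 else B2.
have mB i : measurable (B i) by rewrite /B; case: ifP.
have Bn : B n = B1 by rewrite /B eqxx.
have Bm : B m = B2 by rewrite /B eq_sym (negbTE nm).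
have := iid [fset n; m]%fset B mB.
rewrite big_fsetU1/= ?inE// big_seq_fset1 Bn Bm => <-.
congr (QK _ / _)%E; apply/seteqP; split=> w [Cw wx]; split=> //.
  move=> i /=; rewrite !inE => /orP[|] /eqP ->; rewrite ?Bn ?Bm; first exact: Cw.1.
  exact: Cw.2.
split.
  by have := Cw n; rewrite /= Bn !inE eqxx; exact.
by have := Cw m; rewrite /= Bm !inE eqxx orbT; exact.
Qed.

Let visit1 (n : nat) x : set (vertex_paths nat E) := [set w | w n = x].
Let visit2 (n m : nat) x y : set (vertex_paths nat E) := [set w | w n = x /\ w m = y].

Let measurable_visit1 n x : measurable (visit1 n x).
Proof. exact: (measurable_vertex_path n [set x]). Qed.

Let measurable_visit2 n m x y : measurable (visit2 n m x y).
Proof.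
apply: measurableI; first exact: (measurable_vertex_path n [set x]).
exact: (measurable_vertex_path m [set y]).
Qed.

Lemma integral_holding_visit1 (n : nat) x :
  (\int[QK]_w (holding w n%:Z * (vertex w n%:Z == x)%:R)%:E = c (visit1 n x))%E.
Proof.
pose A : set (trajectories N) := @forward_path R E N @^-1` visit1 n x.
have mA : measurable A by exact: measurable_pre.
transitivity (\int[QK]_(w in A) `|holding w n%:Z|%:E)%E.
  rewrite [RHS]integral_mkcond; apply: eq_integral => w _.
  rewrite patchE; case: ifPn; rewrite /A ?inE ?notin_setE /= /visit1 /= /forward_path.
    by move=> ->; rewrite eqxx mulr1 gtr0_norm// holding_gt0.
  by move/eqP/negbTE ->; rewrite mulr0.
rewrite (@ge0_integral_exp1_law _ _ _ _ A mA (fun w => holding w n%:Z)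
  (fine (c (visit1 n x))) (fun r => `|r|))//.
- by rewrite exp1_moment1 mule1 fineK// c_fin.
- exact: measurable_holding_time.
- by rewrite fine_ge0.
- by move=> B mB; rewrite fineK ?c_fin//; exact: QK_forward1.
Qed.

(* The factor (n <= m) + (m <= n) = 1 + (n == m) is E[s_n s_m] for independent
   exponential variables of parameter 1; it splits the double sum over visits into
   the two orders in which x and y are visited. *)
Lemma integral_holding_visit2 (n m : nat) x y :
  (\int[QK]_w (holding w n%:Z * (vertex w n%:Z == x)%:R *
     (holding w m%:Z * (vertex w m%:Z == y)%:R))%:E =
   (n <= m)%N%:R%:E * c (visit2 n m x y) + (m <= n)%N%:R%:E * c (visit2 m n y x))%E.
Proof.
pose A : set (trajectories N) := @forward_path R E N @^-1` visit2 n m x y.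
have mA : measurable A by exact: measurable_pre.
have cC : c (visit2 m n y x) = c (visit2 n m x y).
  by rewrite (_ : visit2 m n y x = visit2 n m x y)//; apply/seteqP; split=> w [].
transitivity (\int[QK]_(w in A) (`|holding w n%:Z| * `|holding w m%:Z|)%:E)%E.
  rewrite [RHS]integral_mkcond; apply: eq_integral => w _.
  rewrite patchE; case: ifPn; rewrite /A ?inE ?notin_setE /= /visit2 /= /forward_path.
    by move=> [-> ->]; rewrite !eqxx !mulr1 !gtr0_norm// holding_gt0.
  move=> h; have [wx|] := eqVneq (vertex w n) x; last by rewrite mulr0 mul0r.
  by have [wy|] := eqVneq (vertex w m) y; [exfalso; apply: h|rewrite !mulr0].
rewrite cC; have [nm|nm] := eqVneq n m.
  have [-> ->] : (n <= m)%N = true /\ (m <= n)%N = true by rewrite nm leqnn.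
  rewrite mul1e.
  transitivity (\int[QK]_(w in A) (holding w n%:Z ^+ 2)%:E)%E.
    by apply: eq_integral => w _; rewrite -nm -normrM -expr2 ger0_norm ?sqr_ge0.
  rewrite (@ge0_integral_exp1_law _ _ _ _ A mA (fun w => holding w n%:Z)
    (fine (c (visit2 n m x y))) (fun r => r ^+ 2))//.
  - rewrite exp1_moment2 -[in RHS](fineK (c_fin (measurable_visit2 n m x y))) -EFinM -EFinD.
    by congr EFin; rewrite mulr_natr mulr2n.
  - exact: measurable_holding_time.
  - by rewrite fine_ge0.
  - by move=> B mB; rewrite fineK ?c_fin//; exact: QK_forward1.
  - by move=> r; exact: sqr_ge0.
rewrite (@ge0_integral_exp1_law2 _ _ _ _ A mA (fun w => holding w n%:Z)
  (fun w => holding w m%:Z) (fine (c (visit2 n m x y))))//.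
- rewrite fineK ?c_fin//.
  by have [nm'|mn|/eqP] := ltngtP n m; rewrite ?mul0e ?mul1e ?adde0 ?add0e// (negbTE nm).
- exact: measurable_holding_time.
- exact: measurable_holding_time.
- by rewrite fine_ge0.
- by move=> B1 B2 mB1 mB2; rewrite fineK ?c_fin//; exact: QK_forward2.
Qed.

Let forward_time x (w : trajectories N) : \bar R :=
  (\sum_(0 <= n <oo) (holding w n%:Z * (vertex w n%:Z == x)%:R)%:E)%E.

Let measurable_forward_time x : measurable_fun setT (forward_time x).
Proof.
apply: ge0_emeasurable_sum => // [n w _ _|n _]; first exact: holding_visit_ge0.
exact: measurable_holding_visit.
Qed.

(** Visits to [K] at negative times are null, so the two-sided sum over times reduces to the forward
    one. *)
Let total_forward : exists A, [/\ measurable A, QK A = 0%E &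
  forall w, ~ A w -> forall x, x \in K -> total_time x w = forward_time x w].
Proof.
exists (~` (@backward_path R E N @^-1` never_returns K)); split.
- apply: measurableC; apply: measurable_pre => //; exact: measurable_never_returns.
- exact: QK_backward.
move=> w /contrapT NR x xK.
rewrite /total_time esum_int; last by move=> n; exact: holding_visit_ge0.
rewrite [X in (_ + X)%E]eseries0 ?adde0// => n _ _.
have [wx|] := eqVneq (vertex w (- n.+1%:Z)%R) x; last by rewrite mulr0.
by have := NR n.+1 isT; rewrite /backward_path wx xK.
Qed.

Let ae_total (f g : trajectories N -> \bar R) :
  measurable_fun setT f -> measurable_fun setT g ->
  (forall w, (forall x, x \in K -> total_time x w = forward_time x w) -> f w = g w) ->
  (\int[QK]_w f w = \int[QK]_w g w)%E.
Proof.
move=> mf mg fg; apply: ae_eq_integral => //; have [A [mA A0 HA]] := total_forward.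
exists A; split=> // w /= h; apply: contrapT => nA; apply: h => _.
by apply: fg => x xK; exact: HA.
Qed.

Lemma integral_total_time x : x \in K ->
  (\int[QK]_w total_time x w = \sum_(z <- K) equilibrium N K z * visits N z x)%E.
Proof.
move=> xK.
rewrite (@ae_total _ (forward_time x)); last 3 first.
- exact: measurable_total_time.
- exact: measurable_forward_time.
- by move=> w; exact.
rewrite integral_nneseries//; last 2 first.
- by move=> n; exact: measurable_holding_visit.
- by move=> n w _; exact: holding_visit_ge0.
transitivity (\sum_(0 <= n <oo) \sum_(z <- K) equilibrium N K z * walk N z [set w | w.1 n = x])%E.
  by apply: eq_eseriesr => n _; exact: integral_holding_visit1.
rewrite nneseries_sum//; last by move=> *; rewrite mule_ge0// ?e_ge0.
by apply: eq_bigr => z _; rewrite -[equilibrium N K z]fineK// nneseriesZl.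
Qed.

Hypothesis visits_fin : forall x y, visits N x y \is a fin_num.

(** The Markov property at the time [n] of the visit to [x] separates the visits to [x] from the
    later visits to [y]. *)
Let double_visits x y :
  (\sum_(0 <= n <oo) \sum_(0 <= m <oo) (n <= m)%N%:R%:E * c (visit2 n m x y) =
   \sum_(z <- K) equilibrium N K z * (visits N z x * visits N x y))%E.
Proof.
have step n : (\sum_(0 <= m <oo) (n <= m)%N%:R%:E * c (visit2 n m x y) =
    \sum_(z <- K) equilibrium N K z * (walk N z [set w | w.1 n = x] * visits N x y))%E.
  rewrite nneseries_tail//.
  transitivity (\sum_(0 <= k <oo) \sum_(z <- K) equilibrium N K z *
      (walk N z [set w | w.1 n = x] * walk N x [set w | w.1 k = y]))%E.
    apply: eq_eseriesr => k _; apply: eq_bigr => z _; congr (_ * _)%E.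
    rewrite -(walk_markov N z x n (measurable_visit1 k y)).
    by congr (walk N z _); apply/seteqP; split.
  rewrite nneseries_sum//; last by move=> *; apply: mule_ge0 => //; exact: mule_ge0.
  apply: eq_bigr => z _; rewrite -[equilibrium N K z]fineK// nneseriesZl//.
    rewrite -[walk N z _]fineK ?fin_num_measure// ?nneseriesZl//.
    exact: measurable_visit.
  by move=> *; rewrite mule_ge0// ?e_ge0.
transitivity (\sum_(0 <= n <oo) \sum_(z <- K) equilibrium N K z *
    (walk N z [set w | w.1 n = x] * visits N x y))%E.
  by apply: eq_eseriesr => n _; exact: step.
have v0 : (0 <= visits N x y)%E by apply: nneseries_ge0.
rewrite nneseries_sum//; last by move=> *; apply: mule_ge0 => //; exact: mule_ge0.
apply: eq_bigr => z _; rewrite -[equilibrium N K z]fineK// nneseriesZl//.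
  by congr (_ * _)%E; rewrite nneseries_mulr.
by move=> *; rewrite mule_ge0// ?e_ge0.
Qed.

(** The product expands into a double sum over pairs of visit times, split by their order; the
    second half becomes the first after exchanging the summations. *)
Lemma integral_total_time2 x y : x \in K -> y \in K ->
  (\int[QK]_w (total_time x w * total_time y w) =
   \sum_(z <- K) equilibrium N K z *
     (visits N z x * visits N x y + visits N z y * visits N y x))%E.
Proof.
move=> xK yK.
pose f (n m : nat) (w : trajectories N) : \bar R :=
  (holding w n%:Z * (vertex w n%:Z == x)%:R *
     (holding w m%:Z * (vertex w m%:Z == y)%:R))%:E.
have f0 n m w : (0 <= f n m w)%E.
  by rewrite /f EFinM mule_ge0//; exact: holding_visit_ge0.
have mf n m : measurable_fun setT (f n m).
  apply/measurable_EFinP; apply: measurable_funM; apply/measurable_EFinP;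
  exact: measurable_holding_visit.
have mF n : measurable_fun setT (fun w => \sum_(0 <= m <oo) f n m w)%E.
  by apply: ge0_emeasurable_sum.
rewrite (@ae_total _ (fun w => \sum_(0 <= n <oo) \sum_(0 <= m <oo) f n m w)%E); last 3 first.
- by apply: emeasurable_funM; exact: measurable_total_time.
- by apply: ge0_emeasurable_sum => // n w _ _; exact: nneseries_ge0.
- move=> w tf; have yfin := total_time_fin y w.
  rewrite (tf x xK) {1}/forward_time nneseries_mulr//; last by move=> n; exact: holding_visit_ge0.
  apply: eq_eseriesr => n _; rewrite tf// -nneseriesZl; last first.
    by move=> m _; exact: holding_visit_ge0.
  by apply: eq_eseriesr => m _; rewrite /f EFinM.
rewrite integral_nneseries//; last by move=> n w _; exact: nneseries_ge0.
have c0 (n m : nat) (a : bool) x' y' : (0 <= a%:R%:E * c (visit2 n m x' y'))%E.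
  by rewrite mule_ge0// lee_fin.
transitivity (\sum_(0 <= n <oo) \sum_(0 <= m <oo)
   ((n <= m)%N%:R%:E * c (visit2 n m x y) + (m <= n)%N%:R%:E * c (visit2 m n y x)))%E.
  apply: eq_eseriesr => n _; rewrite integral_nneseries//.
  by apply: eq_eseriesr => m _; exact: integral_holding_visit2.
transitivity (\sum_(0 <= n <oo)
   ((\sum_(0 <= m <oo) (n <= m)%N%:R%:E * c (visit2 n m x y)) +
    \sum_(0 <= m <oo) (m <= n)%N%:R%:E * c (visit2 m n y x)))%E.
  by apply: eq_eseriesr => n _; rewrite nneseriesD.
rewrite nneseriesD//; last 2 first.
- by move=> n _ _; apply: nneseries_ge0.
- by move=> n _ _; apply: nneseries_ge0.
rewrite double_visits [X in (_ + X)%E]nneseries_interchange// double_visits -big_split/=.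
apply: eq_bigr => z _; rewrite -ge0_muleDr// mule_ge0//; exact: nneseries_ge0.
Qed.

End equilibrium_law.

(** * Local times under the intensity measure of the interlacements *)

Section interlacement_moments.
Context (R : realType) (E : pointedType) (N : transient_network R E).
Context (Q : {fset E} -> {finite_measure set (trajectories N) -> \bar R}).
Context (nu : {measure set (trajectories_mod_shift N) -> \bar R}).
Hypothesis hQ : forall K, is_QK K (Q K).
Hypothesis hnu : is_interlacement_measure Q nu.
Implicit Types (x y z : E) (K : {fset E}).

Lemma intensity_enters K : (nu (enters K) < +oo)%E.
Proof.
rewrite -[enters K]setTI hnu// /pushforward preimage_setT.
by rewrite -ge0_fin_numE// fin_num_measure.
Qed.

(** A function vanishing on trajectories that miss [K] only sees the restriction of [nu], which is
    the image of Q_K. *)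
Lemma ge0_integral_enters K (F : trajectories_mod_shift N -> \bar R) :
  measurable_fun setT F -> (forall ws, (0 <= F ws)%E) ->
  (forall ws, ~ enters K ws -> F ws = 0%E) ->
  (\int[nu]_ws F ws = \int[Q K]_w F (mod_shift w))%E.
Proof.
move=> mF F0 Fout; have mK := @measurable_enters R E N K.
transitivity (\int[nu]_(ws in enters K) F ws)%E.
  rewrite [RHS]integral_mkcond; apply: eq_integral => ws _.
  by rewrite patchE; case: ifPn => //; rewrite notin_setE => /Fout.
rewrite -(ge0_integral_mrestr _ mK)//.
pose push := measure_function_pushforward__canonical__measure_function_Measure
  (Q K) (@measurable_mod_shift R E N).
transitivity (\int[push]_x F x)%E; last first.
  have := ge0_integral_pushforward (@measurable_mod_shift R E N) (Q K) measurableT mF.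
  by rewrite preimage_setT; apply.
apply: eq_measure_integral => A mA _.
by rewrite -[LHS]/(nu (A `&` enters K)) hnu.
Qed.

Hypothesis green_sym : forall x y, green N x y = green N y x.
Hypothesis green_fin : forall x y, green N x y \is a fin_num.

Lemma visits_green x y : visits N x y = ((total_weight N y)%:E * green N x y)%E.
Proof.
by rewrite green_visits muleA -EFinM mulfV ?mul1e// gt_eqF// total_weight_gt0.
Qed.

(** By symmetry of the Green function each term is the expected number of visits from [x] to [z]
    times the probability of not returning to [K] from [z]; the sum is the last exit
    decomposition. *)
Lemma equilibrium_green K x : x \in K ->
  (\sum_(z <- K) equilibrium N K z * green N z x = 1)%E.
Proof.
move=> xK; rewrite -(last_exit N xK); rewrite !big_seq; apply: eq_bigr => z zK.
have l0 : total_weight N z != 0 by rewrite gt_eqF// total_weight_gt0.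
rewrite green_sym green_visits /equilibrium zK mulr1 -muleA.
by rewrite [X in (_ * X)%E]muleA -EFinM mulfV// mul1e muleC.
Qed.

Let eg_ge0 K z x : (0 <= equilibrium N K z * green N z x)%E.
Proof.
rewrite mule_ge0//; first by rewrite -(hQ K).1.
rewrite green_visits mule_ge0//; last exact: nneseries_ge0.
by rewrite lee_fin invr_ge0 total_weight_ge0.
Qed.

Lemma integral_local_time x : (\int[nu]_ws (local_time x ws)%:E = 1)%E.
Proof.
pose K := [fset x]%fset; have xK : x \in K by rewrite inE.
rewrite (ge0_integral_enters (K := K)); last 3 first.
- by apply/measurable_EFinP; exact: measurable_local_time.
- by move=> ws; rewrite lee_fin local_time_ge0.
- by move=> ws /(local_time_out xK) ->.
under eq_integral do rewrite local_time_mod_shift.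
rewrite ge0_integralZl_EFin//; last 3 first.
- by move=> w _; exact: total_time_ge0.
- exact: measurable_total_time.
- by rewrite invr_ge0 total_weight_ge0.
rewrite (integral_total_time (hQ K) xK).
transitivity (((total_weight N x)^-1)%:E * ((total_weight N x)%:E *
   \sum_(z <- K) equilibrium N K z * green N z x))%E; last first.
  by rewrite equilibrium_green// mule1 -EFinM mulVf// gt_eqF// total_weight_gt0.
congr (_ * _)%E; rewrite ge0_sume_distrr.
  by apply: eq_bigr => z _; rewrite visits_green muleCA.
by move=> z _; exact: eg_ge0.
Qed.

(** With K = {x, y}, the sum over starting points collapses to 1 in each order of the visits,
    leaving g(x, y) and g(y, x). *)
Lemma integral_local_time2 x y :
  (\int[nu]_ws (local_time x ws * local_time y ws)%:E = 2%:E * green N x y)%E.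
Proof.
pose K := [fset x; y]%fset.
have [xK yK] : x \in K /\ y \in K by rewrite !inE !eqxx orbT.
have [lx ly] := (total_weight_gt0 N x, total_weight_gt0 N y).
rewrite (ge0_integral_enters (K := K)); last 3 first.
- by apply/measurable_EFinP; apply: measurable_funM; exact: measurable_local_time.
- by move=> ws; rewrite lee_fin mulr_ge0 ?local_time_ge0.
- by move=> ws /(local_time_out xK) ->; rewrite mul0r.
transitivity (\int[Q K]_w (((total_weight N x)^-1 * (total_weight N y)^-1)%:E *
    (total_time x w * total_time y w)))%E.
  apply: eq_integral => w _; rewrite EFinM !local_time_mod_shift.
  by rewrite muleACA EFinM.
rewrite ge0_integralZl_EFin//; last 3 first.
- by move=> w _; rewrite mule_ge0 ?total_time_ge0.
- by apply: emeasurable_funM; exact: measurable_total_time.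
- by rewrite mulr_ge0 ?invr_ge0 ?ltW.
rewrite (integral_total_time2 (hQ K) _ xK yK); last first.
  by move=> z z'; rewrite visits_green fin_numM.
have g0 z z' : (0 <= green N z z')%E.
  by rewrite green_visits mule_ge0 ?nneseries_ge0// lee_fin invr_ge0 total_weight_ge0.
pose l := total_weight N x * total_weight N y.
have term z x' y' : x' \in K -> (equilibrium N K z * (visits N z x' * visits N x' y') =
   (total_weight N x' * total_weight N y')%:E *
     (equilibrium N K z * green N z x' * green N x' y'))%E.
  move=> _; rewrite !visits_green EFinM; move: (equilibrium N K z) => e.
  by rewrite [X in (_ * X = _)%E]muleACA [LHS]muleCA; congr (_ * _)%E; rewrite muleA.
have sumterm x' y' : x' \in K ->
    (\sum_(z <- K) equilibrium N K z * (visits N z x' * visits N x' y') =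
     (total_weight N x' * total_weight N y')%:E * green N x' y')%E.
  move=> x'K; transitivity ((total_weight N x' * total_weight N y')%:E *
    ((\sum_(z <- K) equilibrium N K z * green N z x') * green N x' y'))%E; last first.
    by rewrite equilibrium_green// mul1e.
  rewrite ge0_sume_distrl; last by move=> z _; exact: eg_ge0.
  rewrite ge0_sume_distrr; last by move=> z _; rewrite mule_ge0.
  by apply: eq_bigr => z _; exact: term.
transitivity (((total_weight N x)^-1 * (total_weight N y)^-1)%:E *
    (l%:E * green N x y + l%:E * green N x y))%E.
  congr (_ * _)%E.
  transitivity (\sum_(z <- K) (equilibrium N K z * (visits N z x * visits N x y) +
     equilibrium N K z * (visits N z y * visits N y x)))%E.
    apply: eq_bigr => z _; rewrite ge0_muleDr// mule_ge0//; exact: nneseries_ge0.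
  rewrite big_split/= !sumterm//; congr (_ + _)%E.
  by rewrite /l mulrC (green_sym y x).
case: (green N x y) (green_fin x y) => // r _.
rewrite -!EFinM; congr EFin.
rewrite /l; field.
by rewrite !gt_eqF.
Qed.

End interlacement_moments.

(** * Gaussian variables and fields *)

Section normal_characteristic.
Context (R : realType) (m s : R) (s0 : s != 0).
Let p (x : R) : R := normal_pdf m s x.
Let q (x : R) : R := normal_pdf m (Num.sqrt 2 * s) x.
Let mu := @lebesgue_measure R.

Let sqrt2_s0 : Num.sqrt 2 * s != 0.
Proof. by rewrite mulf_neq0// sqrtr_eq0 -ltNge ltr0n. Qed.

Let pE x : p x = normal_peak s * expR (- (x - m) ^+ 2 / (s ^+ 2 *+ 2)).
Proof. by rewrite /p normal_pdfE. Qed.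

Let p_ge0 x : 0 <= p x. Proof. exact: normal_pdf_ge0. Qed.
Let mp : measurable_fun setT p. Proof. exact: measurable_normal_pdf. Qed.
Let ip : mu.-integrable setT (EFin \o p). Proof. exact: integrable_normal_pdf. Qed.
Let iq : mu.-integrable setT (EFin \o q). Proof. exact: integrable_normal_pdf. Qed.

Let dp (x : R) : is_derive x 1 p (- ((x - m) / s ^+ 2 * p x)).
Proof.
rewrite (_ : p = fun x => normal_peak s * expR (- (x - m) ^+ 2 / (s ^+ 2 *+ 2))); last first.
  exact/funext.
apply: trigger_derive; rewrite /GRing.scale/=; field.
by rewrite s0.
Qed.

Let C : R := `|s| * normal_peak s / normal_peak (Num.sqrt 2 * s).

(** Half of the Gaussian exponent absorbs the linear factor; what remains is a multiple of the
    density of standard deviation sqrt 2 |s|, an integrable dominating function. *)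
Let p_moment x : `|x - m| * p x <= C * q x.
Proof.
rewrite pE /q normal_pdfE// /C -!mulrA.
have n0 : normal_peak (Num.sqrt 2 * s) != 0 by rewrite gt_eqF// normal_peak_gt0.
rewrite [X in _ <= _ * (_ * X)]mulKf// mulrCA [leRHS]mulrCA.
rewrite ler_wpM2l ?normal_peak_ge0// /normal_fun exprMn sqr_sqrtr//.
set z := (x - m) ^+ 2 / (s ^+ 2 * 4).
have s2 : 0 < s ^+ 2 by rewrite exprn_even_gt0.
have -> : - (x - m) ^+ 2 / (s ^+ 2 *+ 2) = - z + - z.
  by rewrite /z; field; rewrite s0.
have -> : - (x - m) ^+ 2 / (2 * s ^+ 2 *+ 2) = - z.
  by rewrite /z; field; rewrite s0.
rewrite expRD mulrA ler_wpM2r ?expR_ge0// expRN ler_pdivrMr ?expR_gt0//.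
(* The inequality e^z >= 1 + z reduces the claim to a perfect square, since |s| (1 + z) = |s| + |x -
   m|^2 / (4 |s|). *)
apply: (@le_trans _ _ (`|s| * (1 + z))); last by rewrite ler_wpM2l// expR_ge1Dx.
have sn : 0 < `|s| by rewrite normr_gt0.
have -> : `|s| * (1 + z) = `|s| + `|x - m| ^+ 2 / (4 * `|s|).
  rewrite /z real_normK ?num_real// -[s ^+ 2]real_normK ?num_real//; field.
  by rewrite normr_eq0.
rewrite -subr_ge0.
have -> : `|s| + `|x - m| ^+ 2 / (4 * `|s|) - `|x - m| = (2 * `|s| - `|x - m|) ^+ 2 / (4 * `|s|).
  by field; rewrite normr_eq0.
by rewrite divr_ge0 ?sqr_ge0// mulr_ge0// ltW.
Qed.

Let ixp (f : R -> R) : measurable_fun setT f -> (forall x, `|f x| <= 1) ->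
  mu.-integrable setT (EFin \o (fun x => f x * ((x - m) * p x))).
Proof.
move=> mf f1; apply: (@le_integrable _ (measurableTypeR R) R mu setT measurableT _
    (EFin \o (fun x => C * q x))).
- apply/measurable_EFinP; apply: measurable_funM => //; apply: measurable_funM => //.
  exact: measurable_funB.
- move=> x _; rewrite lee_fin.
  apply: (le_trans _ (ler_norm _)); apply: (le_trans _ (p_moment x)).
  rewrite !normrM (ger0_norm (p_ge0 x)).
  by rewrite ler_piMl// mulr_ge0.
- exact: (integrableZl measurableT C iq).
Qed.

Let ifp (f : R -> R) : measurable_fun setT f -> (forall x, `|f x| <= 1) ->
  mu.-integrable setT (EFin \o (fun x => f x * p x)).
Proof.
move=> mf f1; apply: (@le_integrable _ (measurableTypeR R) R mu setT measurableT _
    (EFin \o p)) => //.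
- by apply/measurable_EFinP; apply: measurable_funM.
- by move=> x _ /=; rewrite lee_fin normrM ler_piMl.
Qed.

Variable b : R.

Let mcos t : measurable_fun setT (fun x : R => cos (t * (x - m) + b)).
Proof.
apply: measurableT_comp; first exact: continuous_measurable_fun (@continuous_cos R).
by apply: measurable_funD => //; apply: measurable_funM => //; exact: measurable_funB.
Qed.

Let msin t : measurable_fun setT (fun x : R => sin (t * (x - m) + b)).
Proof.
apply: measurableT_comp; first exact: continuous_measurable_fun (@continuous_sin R).
by apply: measurable_funD => //; apply: measurable_funM => //; exact: measurable_funB.
Qed.

Let icos t := ifp (mcos t) (fun x : R => cos_max _).

Let h t x : R := t * (cos (t * (x - m) + b) * p x) -
  (s ^+ 2)^-1 * (sin (t * (x - m) + b) * ((x - m) * p x)).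

(** The integrand is the derivative of a sine times the density, which vanishes at both ends; the
    integral is taken along growing symmetric intervals. *)
Let Rintegral_h t : \int[mu]_x h t x = 0.
Proof.
pose H (x : R) : R := sin (t * (x - m) + b) * p x.
have dH (x : R) : is_derive x 1 H (h t x).
  have d1 : is_derive x 1 (fun x : R => sin (t * (x - m) + b)) (t * cos (t * (x - m) + b)).
    by apply: trigger_derive; rewrite /GRing.scale/=; ring.
  apply: (is_derive_eq (is_deriveM d1 (dp x))).
  by rewrite /GRing.scale/= /h; field.
have cp : continuous p by exact: continuous_normal_pdf.
have caff : continuous (fun x : R => t * (x - m) + b).
  move=> x; apply: cvgD; last exact: cvg_cst.
  by apply: cvgMr; apply: cvgD; [exact: cvg_id|exact: cvg_cst].
have ch : continuous (h t).
  move=> x; rewrite /h; apply: cvgB; apply: cvgMr; apply: cvgM.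
  - by apply: continuous_comp; [exact: caff|exact: continuous_cos].
  - exact: cp.
  - by apply: continuous_comp; [exact: caff|exact: continuous_sin].
  - apply: cvgM; last exact: cp.
    by apply: cvgD; [exact: cvg_id|exact: cvg_cst].
have ih : mu.-integrable setT (EFin \o h t).
  apply: (@integrableB _ (measurableTypeR R) R mu setT measurableT
    (EFin \o (fun x : R => t * (cos (t * (x - m) + b) * p x)))
    (EFin \o (fun x : R => (s ^+ 2)^-1 * (sin (t * (x - m) + b) * ((x - m) * p x))))).
    exact: (integrableZl measurableT t (icos t)).
  exact: (integrableZl measurableT _ (ixp (msin t) (fun x => sin_max _))).
pose A n : set R := `[m - n.+1%:R, m + n.+1%:R]%classic.
have limh : \int[mu]_x (h t \_ (A n)) x @[n --> \oo] --> \int[mu]_x h t x.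
  apply: (@Rintegral_dominated_cvg R _ (measurableTypeR R) mu _ _ (fun x => `|h t x|)).
  - move=> n; apply/(measurable_restrictT _ _).1 => //; first exact: measurable_itv.
    by apply: measurable_funTS; exact: continuous_measurable_fun.
  - move=> x; apply: cvg_near_cst; near=> n.
    rewrite patchE mem_set//= /A/= in_itv/= -ler_distl.
    rewrite (le_trans (ltW (truncnS_gt _)))// ler_nat ltnS.
    by near: n; exact: nbhs_infty_ge.
  - exact: integrable_norm.
  - by move=> n x; rewrite patchE; case: ifP => // _; rewrite normr0.
have stepn n : \int[mu]_x (h t \_ (A n)) x = H (m + n.+1%:R) - H (m - n.+1%:R).
  rewrite -Rintegral_mkcond /Rintegral (@continuous_FTC2 R (h t) H)//.
  - by rewrite ltrD2l gtrN// ltr0n.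
  - exact: continuous_subspaceT.
  - have cH : continuous H.
      by move=> x; apply/differentiable_continuous/derivable1_diffP; exact: ex_derive.
    split; first by move=> x _; exact: ex_derive.
      by apply: cvg_at_right_filter; exact: cH.
    by apply: cvg_at_left_filter; exact: cH.
  - by move=> x _; rewrite derive1E; exact: derive_val.
(* The bound on |x - m| p also gives decay at infinity: the density is at most a constant over |x -
   m|. *)
have Hb x : x != m -> `|H x| <= C * normal_peak (Num.sqrt 2 * s) / `|x - m|.
  move=> xm; rewrite /H normrM (ger0_norm (p_ge0 x)).
  apply: (@le_trans _ _ (p x)); first by rewrite ler_piMl// sin_max.
  rewrite ler_pdivlMr ?normr_gt0 ?subr_eq0// mulrC (le_trans (p_moment x))//.
  rewrite ler_wpM2l ?normal_pdf_ub//.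
  by rewrite /C divr_ge0 ?mulr_ge0 ?normal_peak_ge0.
pose D := C * normal_peak (Num.sqrt 2 * s).
have lim0 : \int[mu]_x (h t \_ (A n)) x @[n --> \oo] --> (0 : R).
  apply/norm_cvg0P; apply: (@squeeze_cvgr _ _ _ _ (cst 0) (fun n => 2 * D * n.+1%:R^-1)).
  - near=> n; rewrite /= normr_ge0/= stepn (le_trans (ler_normB _ _))//.
    have n0 : n.+1%:R != 0 :> R by rewrite pnatr_eq0.
    have h1 := Hb (m + n.+1%:R); have h2 := Hb (m - n.+1%:R).
    rewrite (_ : m + n.+1%:R - m = n.+1%:R) in h1; last by ring.
    rewrite (_ : m - n.+1%:R - m = - n.+1%:R) in h2; last by ring.
    rewrite normrN in h2; rewrite normr_nat in h1 h2.
    have {}h1 := h1 ltac:(by rewrite -subr_eq0 addrAC subrr add0r).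
    have {}h2 := h2 ltac:(by rewrite -subr_eq0 addrAC subrr add0r oppr_eq0).
    by apply: (le_trans (lerD h1 h2)); rewrite -/D le_eqVlt; apply/orP; left; apply/eqP; ring.
  - exact: cvg_cst.
  - rewrite -[X in _ --> X](mulr0 (2 * D)); apply: cvgMr; exact: cvg_harmonic.
exact: (cvg_unique _ limh lim0).
Unshelve. all: by end_near. Qed.

Let K t : R := \int[mu]_x (cos (t * (x - m) + b) * p x).

(** The derivative in [t] of the integrand is dominated by C q for every [t], which allows
    differentiation under the integral; the vanishing integral of [h] then expresses the sine
    integral through K. *)
Let ode t : is_derive t (1 : R) K (- (s ^+ 2 * t * K t)).
Proof.
have tI : `]t - 1, t + 1[%classic t.
  by rewrite /= in_itv/=; apply/andP; split; lra.
have dK (u : R) (x : R) : is_derive u 1 (fun u : R => cos (u * (x - m) + b) * p x)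
    (- (sin (u * (x - m) + b) * ((x - m) * p x))).
  by apply: trigger_derive; rewrite /GRing.scale/=; ring.
have pd (u x : R) : partial1of2 (fun u x : R => cos (u * (x - m) + b) * p x) u x =
    - (sin (u * (x - m) + b) * ((x - m) * p x)).
  by rewrite partial1of2E; exact: derive_val.
have icos' (u : R) : `]t - 1, t + 1[%classic u ->
    mu.-integrable setT (EFin \o (fun x : R => cos (u * (x - m) + b) * p x)).
  by move=> _; exact: icos.
have dcos' (u x : R) : `]t - 1, t + 1[%classic u -> (@setT R) x ->
    derivable (fun u : R => cos (u * (x - m) + b) * p x) u 1.
  by move=> _ _; exact: ex_derive.
have Cq0 (x : R) : 0 <= C * q x by apply: le_trans (p_moment x); rewrite mulr_ge0.
have iCq : mu.-integrable setT (EFin \o (fun x => C * q x)).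
  by exact: (integrableZl measurableT C iq).
have bound (u x : R) : `]t - 1, t + 1[%classic u -> (@setT R) x ->
    `|partial1of2 (fun u x : R => cos (u * (x - m) + b) * p x) u x| <= C * q x.
  move=> _ _; rewrite pd normrN !normrM (ger0_norm (p_ge0 x)).
  by apply: (le_trans _ (p_moment x)); rewrite ler_piMl ?mulr_ge0// sin_max.
apply: DeriveDef; first exact: (derivable_under_integral measurableT tI icos' dcos' Cq0 iCq bound).
rewrite -derive1E (differentiation_under_integral measurableT tI icos' dcos' Cq0 iCq bound).
under eq_Rintegral do rewrite pd.
have := Rintegral_h t; rewrite /h RintegralB//; last 2 first.
- exact: (integrableZl measurableT t (icos t)).
- exact: (integrableZl measurableT _ (ixp (msin t) (fun x => sin_max _))).
rewrite RintegralZl//.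
rewrite RintegralZl//; last exact: (ixp (msin t) (fun x => sin_max _)).
rewrite -/(K t); set S := \int[mu]_x (sin _ * _) => hS.
transitivity (- S).
  have iS := ixp (msin t) (fun x => sin_max _).
  transitivity (-1 * S); last by rewrite mulN1r.
  have := RintegralZl (-1) measurableT iS; rewrite -/S => <-.
  by apply: eq_Rintegral => x _; rewrite mulN1r.
have -> : S = s ^+ 2 * (t * K t).
  move/eqP: hS; rewrite subr_eq0 => /eqP ->; rewrite mulrA mulfV ?mul1r//.
  by rewrite expf_neq0.
by rewrite mulrA.
Qed.

(* Integration by parts gives K' = - s ^ 2 t K. *)
Lemma normal_characteristic t : K t = expR (- (s ^+ 2 * t ^+ 2 / 2)) * cos b.
Proof.
pose F u : R := K u * expR (s ^+ 2 * u ^+ 2 / 2).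
have dF (u : R) : is_derive u 1 F 0.
  have d1 := ode u.
  have d2 : is_derive u 1 (fun u : R => expR (s ^+ 2 * u ^+ 2 / 2))
      (s ^+ 2 * u * expR (s ^+ 2 * u ^+ 2 / 2)).
    by apply: trigger_derive; rewrite /GRing.scale/=; field.
  apply: (is_derive_eq (is_deriveM d1 d2)).
  by rewrite /GRing.scale/=; ring.
have := is_derive_0_is_cst t 0 dF; rewrite /F expr0n/= mulr0 mul0r expR0 mulr1.
have -> : K 0 = cos b.
  rewrite /K; transitivity (\int[mu]_x (cos b * p x)).
    by apply: eq_Rintegral => x _; rewrite mul0r add0r.
  by rewrite RintegralZl// /Rintegral integral_normal_pdf/= mulr1.
move=> <-; rewrite mulrCA -expRD addNr expR0 mulr1//.
Qed.

End normal_characteristic.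

(** * Moments of Gaussian variables, degenerate ones included *)

Section gaussian_variable.
Context (R : realType) d (T : measurableType d) (P : probability T R).
Context (X : T -> R) (m s : R) (mX : measurable_fun setT X).
Hypothesis hX : forall B, measurable B -> P [set o | B (X o)] = gaussian_law m s B.

Let mXR : measurable_fun setT (X : T -> measurableTypeR R). Proof. exact: mX. Qed.

Let integral_law (G : {measure set (measurableTypeR R) -> \bar R}) (f : R -> R) :
  (forall B, measurable B -> gaussian_law m s B = G B) ->
  measurable_fun setT f -> (forall x, 0 <= f x) ->
  (\int[P]_o (f (X o))%:E = \int[G]_x (f x)%:E)%E.
Proof.
move=> hG mf f0; have mfE : measurable_fun setT (EFin \o f) by exact/measurable_EFinP.
have := @ge0_integral_pushforward _ _ T (measurableTypeR R) R X mXR P setT (EFin \o f)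
  measurableT mfE.
rewrite preimage_setT => <-; last by move=> x _; rewrite lee_fin.
by apply: eq_measure_integral => B mB _; rewrite -hG// -hX.
Qed.

Lemma gaussian_characteristic t b :
  \int[P]_o cos (t * X o + b) = expR (- (s ^+ 2 * t ^+ 2 / 2)) * cos (t * m + b).
Proof.
(* Adding 1 makes the integrand nonnegative, so that image measures and densities for nonnegative
   functions apply. *)
pose f (x : R) := 1 + cos (t * x + b).
have f0 x : 0 <= f x by rewrite /f -lerBlDl sub0r cos_geN1.
have maff : measurable_fun setT (fun x : R => cos (t * x + b)).
  apply: measurableT_comp; first exact: continuous_measurable_fun (@continuous_cos R).
  by apply: measurable_funD => //; exact: measurable_funM.
have mf : measurable_fun setT f by exact: measurable_funD.
have icos : P.-integrable setT (EFin \o (fun o => cos (t * X o + b))).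
  apply: (@bounded_integrable _ _ _ _ _ 1); last by move=> o; exact: cos_max.
  exact: (measurableT_comp maff mX).
have -> : \int[P]_o cos (t * X o + b) = \int[P]_o f (X o) - 1.
  have i1 : P.-integrable setT (EFin \o (fun=> 1 : R)).
    by apply: (@bounded_integrable _ _ _ _ _ 1) => // o; rewrite normr1.
  have -> : \int[P]_o f (X o) = \int[P]_o (1 : R) + \int[P]_o cos (t * X o + b).
    by rewrite -(RintegralD measurableT i1 icos).
  have -> : \int[P]_o (1 : R) = 1.
    by rewrite /Rintegral integral_cst//= probability_setT mule1.
  by rewrite addrAC subrr add0r.
rewrite /Rintegral.
have [s0|s0] := eqVneq s 0.
  rewrite (@integral_law (@dirac _ (measurableTypeR R) (m : measurableTypeR R) R) f)//; last first.
    by move=> B mB; rewrite /gaussian_law s0 eqxx.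
  rewrite integral_dirac//; last exact/measurable_EFinP.
  rewrite diracT mul1e s0 /= expr0n/= !mul0r oppr0 expR0 mul1r.
  by rewrite /f addrAC subrr add0r.
rewrite (@integral_law (normal_prob m s) f)//; last first.
  by move=> B mB; rewrite /gaussian_law (negbTE s0).
rewrite (@ge0_integral_density _ _ _ lebesgue_measure _ (normal_pdf m s))//; last 3 first.
- exact: measurable_normal_pdf.
- by move=> x; exact: normal_pdf_ge0.
- exact/measurable_EFinP.
have ic : lebesgue_measure.-integrable setT
   (EFin \o (fun x : R => cos (t * x + b) * normal_pdf m s x)).
  apply: (@le_integrable _ (measurableTypeR R) R _ setT measurableT _
    (EFin \o normal_pdf m s)) => //.
  - by apply/measurable_EFinP; apply: measurable_funM => //; exact: measurable_normal_pdf.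
  - by move=> x _ /=; rewrite lee_fin normrM ler_piMl// cos_max.
  - exact: integrable_normal_pdf.
transitivity (\int[lebesgue_measure]_x (normal_pdf m s x + cos (t * x + b) * normal_pdf m s x) - 1).
  congr (fine _ - _); apply: eq_integral => x _.
  by rewrite -EFinM /f mulrDl mul1r.
rewrite RintegralD//; last exact: integrable_normal_pdf.
rewrite {1}/Rintegral integral_normal_pdf/= addrAC subrr add0r.
rewrite -(normal_characteristic m s0 (t * m + b)).
by apply: eq_Rintegral => x _; congr (cos _ * _); ring.
Qed.

Let Y o := X o - m.

Let mY : measurable_fun setT Y. Proof. exact: measurable_funB. Qed.

Let Y_characteristic t b : \int[P]_o cos (t * Y o + b) = expR (- (s ^+ 2 * t ^+ 2 / 2)) * cos b.
Proof.
have := gaussian_characteristic t (b - t * m); have -> : t * m + (b - t * m) = b by ring.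
move=> <-.
by apply: eq_Rintegral => o _; congr cos; rewrite /Y; ring.
Qed.

Let Y_second_moment_le : (\int[P]_o (Y o ^+ 2)%:E <= (s ^+ 2)%:E)%E.
Proof.
apply: (@second_moment_le R _ T P Y (s ^+ 2) 0) => // t t0.
have := Y_characteristic t 0; under eq_Rintegral do rewrite addr0.
move=> ->; rewrite cos0 mulr1 mul0r addr0 lerBlDl -lerBlDr.
exact: expR_ge1Dx.
Qed.

Let iY2 : P.-integrable setT (EFin \o (fun o => Y o ^+ 2)).
Proof.
apply/integrableP; split; first by apply/measurable_EFinP; exact: measurable_funX.
rewrite (le_lt_trans _ (ltry (s ^+ 2)))//.
under eq_integral do rewrite /= ger0_norm ?sqr_ge0//.
exact: Y_second_moment_le.
Qed.

Let i1 c : P.-integrable setT (EFin \o (fun=> c : R)).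
Proof. by apply: (@bounded_integrable _ _ _ _ _ `|c|) => // o. Qed.

Let iY : P.-integrable setT (EFin \o Y).
Proof. exact: (integrable_of_sqr mY iY2). Qed.

Let V := \int[P]_o (Y o ^+ 2).

Let V_ge0 : 0 <= V.
Proof. by apply: Rintegral_ge0 => o _; exact: sqr_ge0. Qed.

Let V_le : V <= s ^+ 2.
Proof.
rewrite -lee_fin /V /Rintegral fineK; first exact: Y_second_moment_le.
exact: integrable_fin_num.
Qed.

(** The missing inequality comes from 1 - cos y <= y^2 / 2. With z = s^2 t^2 / 2 it gives z / (1 +
    z) <= 1 - e^(-z) <= t^2 V / 2, hence s^2 <= V (1 + z), and z is small with t. *)
Let V_eq : V = s ^+ 2.
Proof.
apply/eqP; rewrite eq_le V_le/=; apply/ler_addgt0Pl => e e0.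
have icos t : P.-integrable setT (EFin \o (fun o => cos (t * Y o + 0))).
  apply: (@bounded_integrable _ _ _ _ _ 1); last by move=> o; exact: cos_max.
  apply: measurableT_comp; first exact: continuous_measurable_fun (@continuous_cos R).
  by apply: measurable_funD => //; exact: measurable_funM.
have bound t : 0 < t -> s ^+ 2 <= V * (1 + s ^+ 2 * t ^+ 2 / 2).
  move=> t0.
  have h1 : \int[P]_o (1 - cos (t * Y o + 0)) <= \int[P]_o (t ^+ 2 / 2 * Y o ^+ 2).
    apply: le_Rintegral => //.
    - exact: (integrableB measurableT (i1 1) (icos t)).
    - exact: (integrableZl measurableT _ iY2).
    - move=> o _; rewrite addr0; have := cos_ge_quadratic (t * Y o).
      by rewrite exprMn; lra.
  move: h1; rewrite RintegralB// RintegralZl// Y_characteristic cos0 mulr1.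
  have -> : \int[P]_o (1 : R) = 1.
    by rewrite /Rintegral integral_cst//= probability_setT mule1.
  rewrite -/V; set z := s ^+ 2 * t ^+ 2 / 2 => h1.
  have z0 : 0 <= z by rewrite /z mulr_ge0// mulr_ge0 ?sqr_ge0.
  have z1 : 0 < 1 + z by rewrite ltr_pwDl.
  have h2 : expR (- z) <= (1 + z)^-1.
    by rewrite expRN lef_pV2 ?posrE ?expR_gt0// expR_ge1Dx.
  have t2 : 0 < t ^+ 2 by rewrite exprn_gt0.
  have h3 : z / (1 + z) <= t ^+ 2 / 2 * V.
    apply: le_trans h1; have -> : z / (1 + z) = 1 - (1 + z)^-1 by field; rewrite gt_eqF.
    by rewrite lerB.
  rewrite -(ler_pM2l (_ : 0 < t ^+ 2 / 2)) ?divr_gt0//.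
  rewrite [leRHS]mulrA -(ler_pdivrMr _ _ z1); apply: le_trans h3.
  rewrite ler_pM2r ?invr_gt0//.
  by rewrite /z le_eqVlt; apply/orP; left; apply/eqP; ring.
have w0 : 0 < 1 + V * s ^+ 2 by rewrite ltr_pwDl// mulr_ge0// sqr_ge0.
(* This t makes the error V z at most e / 2. *)
have t0 : 0 < Num.sqrt (e / (1 + V * s ^+ 2)) by rewrite sqrtr_gt0 divr_gt0.
apply: (le_trans (bound _ t0)); rewrite sqr_sqrtr; last by rewrite divr_ge0// ltW.
rewrite mulrDr mulr1 addrC lerD2r -subr_ge0.
have -> : e - V * (s ^+ 2 * (e / (1 + V * s ^+ 2)) / 2) =
    e * (1 + (1 + V * s ^+ 2)) / (2 * (1 + V * s ^+ 2)).
  by field; rewrite gt_eqF.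
have w1 := ltW w0; rewrite divr_ge0// mulr_ge0// ?(ltW e0)//; exact: addr_ge0.
Qed.

(** The phase -pi/2 shows that sin (t Y) has mean 0 for the centered variable Y. As |sin y - y| <=
    y^2, the mean of Y is at most t V in absolute value, for every t > 0. *)
Lemma gaussian_mean : \int[P]_o X o = m.
Proof.
have iX : \int[P]_o X o = \int[P]_o Y o + m.
  have -> : \int[P]_o X o = \int[P]_o (Y o + m).
    by apply: eq_Rintegral => o _; rewrite /Y subrK.
  rewrite (RintegralD measurableT iY (i1 m)); congr (_ + _).
  by rewrite /Rintegral integral_cst//= probability_setT mule1.
rewrite iX; set M := \int[P]_o Y o.
suff -> : M = 0 by rewrite add0r.
apply/eqP; rewrite -normr_le0; apply/ler_addgt0Pl => e e0; rewrite addr0.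
pose t := e / (1 + V).
have V1 : 0 < 1 + V by rewrite ltr_pwDl.
have t0 : 0 < t by rewrite divr_gt0.
have sin0 : \int[P]_o sin (t * Y o) = 0.
  transitivity (\int[P]_o cos (t * Y o + - (pi / 2))).
    by apply: eq_Rintegral => o _; rewrite cosBpihalf.
  by rewrite Y_characteristic cosN cos_pihalf mulr0.
have isin : P.-integrable setT (EFin \o (fun o => sin (t * Y o))).
  apply: (@bounded_integrable _ _ _ _ _ 1); last by move=> o; exact: sin_max.
  apply: measurableT_comp; first exact: continuous_measurable_fun (@continuous_sin R).
  exact: measurable_funM.
have itY : P.-integrable setT (EFin \o (fun o => t * Y o)).
  exact: (integrableZl measurableT t iY).
have : `|\int[P]_o (sin (t * Y o) - t * Y o)| <= t ^+ 2 * V.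
  apply: (le_trans (le_normr_Rintegral _ _)) => //; first exact: (integrableB measurableT isin itY).
  rewrite /V -RintegralZl//; apply: le_Rintegral => //.
  - exact: (integrable_norm (integrableB measurableT isin itY)).
  - exact: (integrableZl measurableT _ iY2).
  - by move=> o _; rewrite -exprMn; exact: sin_sub_sqr.
rewrite (RintegralB measurableT isin itY) sin0 sub0r normrN RintegralZl// -/M normrM.
rewrite (gtr0_norm t0) expr2 -mulrA ler_pM2l// => h; apply: (le_trans h).
rewrite /t -mulrA ler_piMr ?(ltW e0)// mulrC ler_pdivrMr// mul1r lerDr//.
Qed.

Lemma gaussian_variance_eq : m = 0 -> P.-integrable setT (EFin \o (fun o => X o ^+ 2)) /\
  \int[P]_o X o ^+ 2 = s ^+ 2.
Proof.
move=> m0; have XY : X = Y by apply/funext => o; rewrite /Y m0 subr0.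
by rewrite XY; split; [exact: iY2|exact: V_eq].
Qed.

End gaussian_variable.

Section Rintegral_sum.
Context (R : realType) d (T : measurableType d) (mu : {measure set T -> \bar R}).
Context (I : Type) (f : I -> T -> R).
Hypothesis fi : forall i, mu.-integrable setT (EFin \o f i).

Lemma integrable_Rsum (r : seq I) :
  mu.-integrable setT (EFin \o (fun x => \sum_(i <- r) f i x)).
Proof.
rewrite (_ : EFin \o _ = (fun x => \sum_(i <- r) (EFin \o f i) x)%E).
  exact: integrable_sum.
by apply/funext => x; rewrite /= sumEFin.
Qed.

Lemma Rintegral_sum (r : seq I) :
  \int[mu]_x (\sum_(i <- r) f i x) = \sum_(i <- r) \int[mu]_x f i x.
Proof.
elim: r => [|i r IH].
  rewrite big_nil; under eq_Rintegral do rewrite big_nil.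
  by rewrite /Rintegral integral0.
rewrite big_cons -IH -(RintegralD measurableT (fi i) (integrable_Rsum r)).
by apply: eq_Rintegral => x _; rewrite big_cons.
Qed.

End Rintegral_sum.

(** * The Gaussian free field *)

Section free_field.
Context (R : realType) (E : pointedType) (N : transient_network R E).
Context (PG : probability (real_fields E R) R).
Hypothesis hPG : is_gff N PG.
Implicit Types (x y : E).

Lemma measurable_field x : measurable_fun setT (fun phi : real_fields E R => phi x : R).
Proof. exact: (measurable_real_field x). Qed.

Let measurable_combination n (x : 'I_n -> E) (a : 'I_n -> R) :
  measurable_fun setT (fun phi : real_fields E R => \sum_(i < n) a i * phi (x i)).
Proof.
apply: measurable_sum => i; apply: measurable_funM => //; exact: measurable_field.
Qed.

Let field_law x : exists s, forall B, measurable B ->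
  PG [set phi | B (phi x)] = gaussian_law 0 s B.
Proof.
have [m [s law]] := gff_gaussian hPG (fun _ : 'I_1 => x) (fun=> 1).
have law' B : measurable B -> PG [set phi | B (phi x)] = gaussian_law m s B.
  by move=> mB; rewrite -law//; congr (PG _); apply/seteqP; split=> phi /=; rewrite big_ord1 mul1r.
have m0 : m = 0.
  rewrite -(gaussian_mean (measurable_field x) law').
  by have := gff_centered hPG x; rewrite unlock /Rintegral => ->.
by exists s; rewrite -m0.
Qed.

Let field_sqr_integrable x :
  PG.-integrable setT (EFin \o (fun phi : real_fields E R => phi x ^+ 2)).
Proof.
have [s law] := field_law x.
by have [] := gaussian_variance_eq (measurable_field x) law erefl.
Qed.

Let field_integrable x : PG.-integrable setT (EFin \o (fun phi : real_fields E R => phi x)).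
Proof. exact: (integrable_of_sqr (measurable_field x) (field_sqr_integrable x)). Qed.

Let field_mul_integrable x y :
  PG.-integrable setT (EFin \o (fun phi : real_fields E R => phi x * phi y)).
Proof.
apply: (@le_integrable _ _ _ _ _ measurableT _
    (EFin \o (fun phi : real_fields E R => phi x ^+ 2 + phi y ^+ 2))).
- by apply/measurable_EFinP; apply: measurable_funM; exact: measurable_field.
- move=> phi _ /=; rewrite lee_fin [leRHS]ger0_norm; last by rewrite addr_ge0// sqr_ge0.
  rewrite normrM -subr_ge0 -[phi x ^+ 2]real_normK ?num_real// -[phi y ^+ 2]real_normK ?num_real//.
  have -> : `|phi x| ^+ 2 + `|phi y| ^+ 2 - `|phi x| * `|phi y| =
      (`|phi x| - `|phi y|) ^+ 2 + `|phi x| * `|phi y| by ring.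
  by rewrite addr_ge0 ?sqr_ge0// mulr_ge0.
- exact: (integrableD measurableT (field_sqr_integrable x) (field_sqr_integrable y)).
Qed.

Lemma green_gff_sym x y : green N x y = green N y x.
Proof.
rewrite -(gff_covariance hPG x y) -(gff_covariance hPG y x); congr ('E_PG[_])%E.
by apply/funext => phi; rewrite mulrC.
Qed.

(** Gaussian variables, degenerate or not, have finite second moments, so the covariances of the
    field are finite. *)
Lemma green_gff_fin x y : green N x y \is a fin_num.
Proof.
rewrite -(gff_covariance hPG x y) unlock.
exact: (integrable_fin_num measurableT (field_mul_integrable x y)).
Qed.

Lemma gff_second_moment x :
  (\int[PG]_phi ((phi x : R) ^+ 2)%:E = green N x x)%E.
Proof. by rewrite -(gff_covariance hPG x x) unlock. Qed.

Let Rintegral_mul x y : \int[PG]_phi (phi x * phi y) = fine (green N x y).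
Proof. by rewrite -(gff_covariance hPG x y) unlock. Qed.

(** A linear combination of field values is Gaussian; being centered with second moment the Green
    quadratic form, its law is determined. *)
Lemma gff_characteristic n (x : 'I_n -> E) (a : 'I_n -> R) b :
  \int[PG]_phi cos (\sum_(i < n) a i * phi (x i) + b) =
  expR (- ((\sum_(i < n) \sum_(j < n) a i * a j * fine (green N (x i) (x j))) / 2)) * cos b.
Proof.
have [m [s law]] := gff_gaussian hPG x a.
have mX := measurable_combination x a.
have m0 : m = 0.
  rewrite -(gaussian_mean mX law).
  rewrite Rintegral_sum//; last first.
    by move=> i; exact: (integrableZl measurableT (a i) (field_integrable (x i))).
  rewrite big1// => i _; rewrite RintegralZl//.
  by have := gff_centered hPG (x i); rewrite unlock /Rintegral => ->; rewrite mulr0.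
have [_ var] := gaussian_variance_eq mX law m0.
have := gaussian_characteristic mX law 1 b; rewrite m0 mulr0 add0r expr1n mulr1 -var.
under eq_Rintegral do rewrite mul1r.
move=> ->; congr (expR (- (_ / 2)) * _).
transitivity (\int[PG]_phi \sum_(i < n) \sum_(j < n) a i * a j * (phi (x i) * phi (x j))).
  apply: eq_Rintegral => phi _; rewrite expr2 mulr_suml; apply: eq_bigr => i _.
  by rewrite mulr_sumr; apply: eq_bigr => j _; ring.
have ij i j : PG.-integrable setT
    (EFin \o (fun phi : real_fields E R => a i * a j * (phi (x i) * phi (x j)))).
  exact: (integrableZl measurableT _ (field_mul_integrable (x i) (x j))).
rewrite Rintegral_sum; last by move=> i; apply: integrable_Rsum => j; exact: ij.
apply: eq_bigr => i _; rewrite Rintegral_sum; last by move=> j; exact: ij.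
apply: eq_bigr => j _; rewrite (RintegralZl _ measurableT (field_mul_integrable (x i) (x j))).
by rewrite Rintegral_mul.
Qed.

End free_field.

(** * Limit theorems for occupation times *)

Section occupation_field.
Context (R : realType) (E : pointedType) (N : transient_network R E).
Context (Q : {fset E} -> {finite_measure set (trajectories N) -> \bar R}).
Hypothesis hQ : forall K, is_QK K (Q K).
Context (nu : {sigma_finite_measure set (trajectories_mod_shift N) -> \bar R}).
Hypothesis hnu : is_interlacement_measure Q nu.
Hypothesis green_sym : forall x y, green N x y = green N y x.
Hypothesis green_fin : forall x y, green N x y \is a fin_num.
Context d (Omega : measurableType d) (P : probability Omega R).
Context (wstar : nat -> Omega -> trajectories_mod_shift N) (u_ : nat -> Omega -> R).
Hypothesis hu : forall i o, 0 <= u_ i o.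
Hypothesis hppp : is_poisson_point_process P
  (fun o A => \sum_(0 <= i <oo) \d_(wstar i o, u_ i o) A)%E
  (interlacement_intensity nu).
Context (w : nat -> Omega -> trajectories N).
Hypothesis hw : forall i o, mod_shift (w i o) = wstar i o.

Definition occupation_time u x o : R := fine (occupation (w ^~ o) (u_ ^~ o) x u).

Let occupation_below u x o : occupation (w ^~ o) (u_ ^~ o) x u =
  (\sum_(0 <= i <oo) (below u_ u i o)%:R%:E * (local_time x (wstar i o))%:E)%E.
Proof. by rewrite occupation_local_time; apply: eq_eseriesr => i _; rewrite hw. Qed.

Lemma measurable_occupation_time u x : measurable_fun setT (occupation_time u x).
Proof.
rewrite /occupation_time; apply: measurableT_comp => //.
under eq_fun do rewrite occupation_below.
have mk : measurable_fun setT (fun ws : trajectories_mod_shift N => (local_time x ws)%:E).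
  by apply/measurable_EFinP; exact: measurable_local_time.
apply: (measurable_sum_below hppp u mk) => ws.
by rewrite lee_fin local_time_ge0.
Qed.

Let local_time_integrable x : nu.-integrable setT (EFin \o local_time (N := N) x).
Proof.
apply/integrableP; split; first by apply/measurable_EFinP; exact: measurable_local_time.
under eq_integral do rewrite /= ger0_norm ?local_time_ge0//.
by rewrite (integral_local_time hQ hnu green_sym)// ltry.
Qed.

Let local_time_mul_integrable x y :
  nu.-integrable setT
    (EFin \o (fun ws : trajectories_mod_shift N => local_time x ws * local_time y ws)).
Proof.
apply/integrableP; split.
  by apply/measurable_EFinP; apply: measurable_funM; exact: measurable_local_time.
under eq_integral do rewrite /= normrM !ger0_norm ?local_time_ge0//.
rewrite (integral_local_time2 hQ hnu green_sym)//.
by rewrite -(fineK (green_fin x y)) -EFinM ltry.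
Qed.

Section finite_marginal.
Context (n : nat) (x : 'I_n -> E).

Let K : {fset E} := [fset z in codom x]%fset.
Let xK i : x i \in K. Proof. by rewrite inE/= codom_f. Qed.
Let U := enters (N := N) K.
Let mU : measurable U. Proof. exact: measurable_enters. Qed.
Let nuU : (nu U < +oo)%E. Proof. exact: (intensity_enters hnu). Qed.

Let good : set Omega := [set o | (selected_count R wstar (below u_ 0) o U < +oo)%E].

Definition combined_time (t : 'I_n -> R) (ws : trajectories_mod_shift N) : R :=
  \sum_(i < n) t i * local_time (x i) ws.

Let g_out t ws : ~ U ws -> combined_time t ws = 0.
Proof.
move=> nU; rewrite /combined_time big1// => i _.
by rewrite (local_time_out (xK i) nU) mulr0.
Qed.

Let gi t : nu.-integrable setT (EFin \o combined_time t).
Proof.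
apply: integrable_Rsum => i.
exact: (integrableZl measurableT (t i) (local_time_integrable (x i))).
Qed.

Let ij t i j : nu.-integrable setT (EFin \o (fun ws : trajectories_mod_shift N =>
   t i * t j * (local_time (x i) ws * local_time (x j) ws))).
Proof. exact: (integrableZl measurableT _ (local_time_mul_integrable (x i) (x j))). Qed.

Let g2E t : (fun ws => combined_time t ws ^+ 2) =
  (fun ws => \sum_(i < n) \sum_(j < n) t i * t j * (local_time (x i) ws * local_time (x j) ws)).
Proof.
apply/funext => ws; rewrite expr2 mulr_suml; apply: eq_bigr => i _.
by rewrite mulr_sumr; apply: eq_bigr => j _; ring.
Qed.

Let g2i t : nu.-integrable setT (EFin \o (fun ws => combined_time t ws ^+ 2)).
Proof.
by rewrite g2E; apply: integrable_Rsum => i; apply: integrable_Rsum => j; exact: ij.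
Qed.

Let g_mean t : \int[nu]_ws combined_time t ws = \sum_(i < n) t i.
Proof.
rewrite Rintegral_sum; last first.
  by move=> i; exact: (integrableZl measurableT (t i) (local_time_integrable (x i))).
apply: eq_bigr => i _; rewrite (RintegralZl _ measurableT (local_time_integrable (x i))).
by rewrite /Rintegral (integral_local_time hQ hnu green_sym)//= mulr1.
Qed.

Let covar t := \sum_(i < n) \sum_(j < n) t i * t j * fine (green N (x i) (x j)).

Let g_var t : \int[nu]_ws (combined_time t ws ^+ 2) = 2 * covar t.
Proof.
rewrite g2E Rintegral_sum; last by move=> i; apply: integrable_Rsum => j; exact: ij.
rewrite /covar mulr_sumr; apply: eq_bigr => i _; rewrite Rintegral_sum; last by move=> j; exact: ij.
rewrite mulr_sumr; apply: eq_bigr => j _.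
rewrite (RintegralZl _ measurableT (local_time_mul_integrable (x i) (x j))).
rewrite /Rintegral (integral_local_time2 hQ hnu green_sym)//.
by rewrite fineM//=; ring.
Qed.

Let level t u := level_sum wstar u_ U (combined_time t) u.

(** Occupation times are infinite series, level sums are truncated at the cutoff. They agree unless
    infinitely many trajectories below level [u] enter [K], a null event since [K] has finite
    intensity. *)
Let level_occupation t u : 0 <= u -> exists A, [/\ measurable A, P A = 0%E &
  forall o, ~ A o -> \sum_(i < n) t i * occupation_time u (x i) o = level t u o].
Proof.
move=> u0; have pb := poisson_below hu hppp u0.
have mUu : (mscale (NngNum u0) nu U < +oo)%E.
  by rewrite /mscale/= -(@fineK _ (nu U)) ?ge0_fin_numE// -EFinM ltry.
have [mgood Pgood] := selected_count_lty pb mU mUu.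
exists (~` [set o | (selected_count R wstar (below u_ u) o U < +oo)%E]); split.
- exact: measurableC.
- by have /= -> := probability_setC P mgood; rewrite Pgood subee.
move=> o /contrapT /= go.
pose M := cutoff wstar (below u_ u) U o.
have occ i : occupation_time u (x i) o =
    \sum_(k < M) (below u_ u k o)%:R * local_time (x i) (wstar k o).
  rewrite /occupation_time occupation_below (@nneseries_eventually0 _ _ M).
  - by under eq_bigr do rewrite -EFinM; rewrite sumEFin.
  - by move=> k; rewrite mule_ge0// lee_fin ?local_time_ge0.
  - move=> k Mk; have := cutoffP go Mk.
    case: (below u_ u k o) => //= [|_]; last by rewrite mul0e.
    by rewrite notin_setE => nU; rewrite (local_time_out (xK i) nU) mule0.
rewrite /level /level_sum /selected_sum -/M.
under eq_bigr do rewrite occ mulr_sumr.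
rewrite exchange_big [RHS]big_mkcond/=; apply: eq_bigr => k _.
case: (below u_ u k o); last by rewrite big1// => i _; rewrite mul0r mulr0.
by apply: eq_bigr => i _; rewrite mul1r.
Qed.

Let measurable_combination (t : 'I_n -> R) u :
  measurable_fun setT (fun o => \sum_(i < n) t i * occupation_time u (x i) o).
Proof.
apply: measurable_sum => i; apply: measurable_funM => //.
exact: measurable_occupation_time.
Qed.

Let measurable_level t u : 0 <= u -> measurable_fun setT (level t u).
Proof.
move=> u0; exact: (measurable_level_sum hu hppp mU (@g_out t) (gi t) u0).
Qed.

Lemma occupation_second_moment t u : 0 <= u ->
  (\int[P]_o ((\sum_(i < n) t i * occupation_time u (x i) o - u * \sum_(i < n) t i) ^+ 2)%:E <=
   (u * (2 * covar t))%:E)%E.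
Proof.
move=> u0; have := level_sum_second_moment hu hppp mU nuU (@g_out t) (gi t) (g2i t) u0.
rewrite g_mean g_var; apply: le_trans; rewrite le_eqVlt; apply/orP; left; apply/eqP.
have [A [mA A0 HA]] := level_occupation t u0.
apply: ae_eq_integral => //.
- apply/measurable_EFinP; apply: measurable_funX; exact: measurable_funB.
- apply/measurable_EFinP; apply: measurable_funX; apply: measurable_funB => //.
  exact: (measurable_level t u0).
- by exists A; split=> // o /= h; apply: contrapT => nA; apply: h => _; rewrite HA.
Qed.

(** The sums of coefficients centre the occupation times at u because each local time has mean 1,
    and nu(g^2) = 2 [covar t] turns the exponent V / 4 into half the covariance form. *)
Lemma occupation_clt t b :
  \int[P]_o cos (\sum_(i < n) t i * ((occupation_time u (x i) o - u) / Num.sqrt (2 * u)) + b)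
    @[u --> +oo] --> expR (- (covar t / 2)) * cos b.
Proof.
have := level_sum_clt hu hppp mU nuU (@g_out t) (gi t) (g2i t) (b := b).
rewrite g_mean g_var (_ : 2 * covar t / 4 = covar t / 2); last by field.
apply: cvg_trans; apply: near_eq_cvg; near=> u.
have u0 : 0 <= u by near: u; exact: nbhs_pinfty_ge.
have [A [mA A0 HA]] := level_occupation t u0.
have mcos (f : Omega -> R) : measurable_fun setT f -> measurable_fun setT (fun o => cos (f o)).
  by move=> mf; apply: measurableT_comp mf; exact: continuous_measurable_fun (@continuous_cos R).
have sumE o : \sum_(i < n) t i * ((occupation_time u (x i) o - u) / Num.sqrt (2 * u)) =
    (\sum_(i < n) t i * occupation_time u (x i) o - u * \sum_(i < n) t i) / Num.sqrt (2 * u).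
  by rewrite mulr_sumr -sumrB mulr_suml; apply: eq_bigr => i _; ring.
rewrite /Rintegral; congr fine; apply: ae_eq_integral => //.
- apply/measurable_EFinP; apply: mcos; apply: measurable_funD => //.
  apply: measurable_funM => //; apply: measurable_funB => //; exact: (measurable_level t u0).
- apply/measurable_EFinP; apply: mcos; apply: measurable_funD => //.
  under eq_fun do rewrite sumE.
  apply: measurable_funM => //; apply: measurable_funB => //; exact: (measurable_combination t u).
- exists A; split=> // o /= h; apply: contrapT => nA; apply: h => _.
  by rewrite sumE HA.
Unshelve. all: by end_near. Qed.

End finite_marginal.

Let sqrt2_inv0 : (Num.sqrt (2 * u))^-1 @[u --> +oo] --> (0 : R).
Proof.
apply/gtr0_cvgV0; last exact: cvg_sqrt2.
by near=> u; rewrite sqrtr_gt0 mulr_gt0//; near: u; exact: nbhs_pinfty_gt.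
Unshelve. all: by end_near. Qed.

Let green_ge0 x y : 0 <= fine (green N x y).
Proof.
rewrite fine_ge0// green_visits mule_ge0 ?nneseries_ge0//.
by rewrite lee_fin invr_ge0 total_weight_ge0.
Qed.

(** The trace bounds all the variances at once and serves as common second moment bound. *)
Let green_le n (x : 'I_n -> E) i :
  fine (green N (x i) (x i)) <= \sum_(j < n) fine (green N (x j) (x j)).
Proof. by rewrite (bigD1 i)//= lerDl sumr_ge0. Qed.

Let second_moment_scale (X : Omega -> R) c M : measurable_fun setT X ->
  (\int[P]_o (X o ^+ 2)%:E <= M%:E)%E ->
  (\int[P]_o ((X o / c) ^+ 2)%:E <= ((c ^+ 2)^-1 * M)%:E)%E.
Proof.
move=> mX XM.
have -> : (\int[P]_o ((X o / c) ^+ 2)%:E =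
    \int[P]_o (((c ^+ 2)^-1)%:E * (X o ^+ 2)%:E))%E.
  by apply/eq_integral => o _; rewrite -EFinM expr_div_n mulrC.
rewrite ge0_integralZl_EFin//; last 3 first.
- by move=> o _; rewrite lee_fin sqr_ge0.
- by apply/measurable_EFinP; apply: measurable_funX.
- by rewrite invr_ge0 sqr_ge0.
by rewrite EFinM lee_wpmul2l ?lee_fin ?invr_ge0 ?sqr_ge0.
Qed.

Let occupation_second_moment1 y u c : 0 <= u ->
  (\int[P]_o (((occupation_time u y o - u) / c) ^+ 2)%:E <=
   ((c ^+ 2)^-1 * (2 * u * fine (green N y y)))%:E)%E.
Proof.
move=> u0; apply: second_moment_scale.
  by apply: measurable_funB => //; exact: measurable_occupation_time.
have := occupation_second_moment (fun _ : 'I_1 => y) (fun=> 1) u0.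
rewrite !big_ord1 !mul1r !mulr1 mulrA (mulrC u).
apply: le_trans; rewrite le_eqVlt; apply/orP; left.
by apply/eqP/eq_integral => o _; rewrite big_ord1 mul1r.
Qed.

(** The criterion is applied to (L - u) / u, whose second moment is of order 1 / u, with the zero
    vector as limit; [f1] restores the constant 1. *)
Lemma occupation_law_of_large_numbers :
  cvg_in_fdd P (fun u x o => occupation_time u x o / u) P (fun _ _ => 1).
Proof.
move=> n x f cf [B fB].
pose f1 (v : 'rV[R]_n) := f (\row_i (1 + v ord0 i)).
have cf1 : continuous f1.
  move=> v; apply: (continuous_comp (f := fun v : 'rV[R]_n => \row_i (1 + v ord0 i))).
    2: exact: cf.
  apply: row_continuous => i; under eq_fun do rewrite mxE.
  move=> y; apply: (@cvgD R R^o _ (nbhs y) _ (fun=> 1) (fun v : 'rV[R]_n => v ord0 i)).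
    exact: cvg_cst.
  exact: coord_continuous.
pose Z u o : 'rV[R]_n := \row_i ((occupation_time u (x i) o - u) / u).
pose C := 2 * \sum_(j < n) fine (green N (x j) (x j)).
have mZ u i : measurable_fun setT (fun o => Z u o ord0 i).
  under eq_fun do rewrite mxE; apply: measurable_funM => //; apply: measurable_funB => //.
  exact: measurable_occupation_time.
pose Z0 : 'rV[R]_n := 0.
have conv : 'E_P[fun o => f1 (Z u o)]%E @[u --> +oo] --> 'E_P[fun=> f1 Z0]%E.
  apply: (cvg_bounded_continuous (C := C) (B := B)) => //.
  - near=> u; move=> i.
    have u1 : 1 <= u by near: u; exact: nbhs_pinfty_ge.
    have u0 : 0 <= u by rewrite (le_trans _ u1).
    under eq_integral do rewrite mxE.
    apply: (le_trans (occupation_second_moment1 (x i) u u0)); rewrite lee_fin.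
    have -> : (u ^+ 2)^-1 * (2 * u * fine (green N (x i) (x i))) =
        2 * fine (green N (x i) (x i)) / u.
      by field; rewrite gt_eqF// (lt_le_trans _ u1).
    rewrite ler_pdivrMr ?(lt_le_trans _ u1)//.
    apply: (@le_trans _ _ C); first by rewrite /C ler_wpM2l// green_le.
    by rewrite ler_peMr// mulr_ge0// sumr_ge0.
  - move=> i; under eq_integral do rewrite mxE expr0n/=.
    by rewrite integral0 lee_fin mulr_ge0// sumr_ge0.
  - move=> t b.
    have Z0E : dotr t (Z0 : 'rV[R]_n) = 0 :> R.
      by rewrite /dotr big1// => i _; rewrite mxE mulr0.
    pose S u o := dotr t (Z u o).
    pose V := 2 * \sum_(i < n) \sum_(j < n) t ord0 i * t ord0 j * fine (green N (x i) (x j)).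
    (* The weight in the inequality |S| <= c / 2 + S^2 / (2 c). With E S^2 <= V / u and 1 / (2 c) =
       c u, the expectation of the right-hand side is at most c (1 + 2 V) / 2, which tends to 0. *)
    pose c u : R := (Num.sqrt (2 * u))^-1.
    apply/cvgrPdist_le => e e0.
    have lim0 : (c u * (1 + 2 * V)) / 2 @[u --> +oo] --> (0 : R).
      rewrite -[X in _ --> X](mul0r 2^-1); apply: cvgMl.
      rewrite -[X in _ --> X](mul0r (1 + 2 * V)); apply: cvgMl; exact: sqrt2_inv0.
    have mS u : measurable_fun setT (S u) 
      by apply: measurable_sum => i; exact: measurable_funM.
    have mcos (h : Omega -> R) : measurable_fun setT h -> measurable_fun setT (fun o => cos (h o)).
      move=> mh; apply: measurableT_comp mh.
      exact: continuous_measurable_fun (@continuous_cos R).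
    near=> u.
    have u0 : 0 < u by near: u; exact: nbhs_pinfty_gt.
    have c0 : 0 < c u by rewrite /c invr_gt0 sqrtr_gt0 mulr_gt0.
    have cu : (c u) ^+ 2 = (2 * u)^-1 by rewrite exprVn sqr_sqrtr// mulr_ge0// ltW.
    have SV : (\int[P]_o (S u o ^+ 2)%:E <= (V / u)%:E)%E.
      have -> : V / u = (u ^+ 2)^-1 * (u * V) by rewrite /V; field; rewrite gt_eqF.
      have mX : measurable_fun setT (fun o => \sum_(i < n) t ord0 i * occupation_time u (x i) o -
          u * \sum_(i < n) t ord0 i).
        apply: measurable_funB => //; apply: measurable_sum => i; apply: measurable_funM => //.
        exact: measurable_occupation_time.
      have := second_moment_scale u mX (occupation_second_moment x (t ord0) (ltW u0)).
      rewrite -/V; apply: le_trans.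
      rewrite le_eqVlt; apply/orP; left; apply/eqP/eq_integral => o _; congr (_ ^+ 2)%:E.
      rewrite /S /dotr mulr_sumr -sumrB mulr_suml; apply: eq_bigr => i _.
      by rewrite mxE; ring.
    have iS2 : P.-integrable setT (EFin \o (fun o => S u o ^+ 2)).
      apply/integrableP; split; first by apply/measurable_EFinP; exact: measurable_funX.
      under eq_integral do rewrite /= ger0_norm ?sqr_ge0//.
      exact: (le_lt_trans SV (ltry _)).
    have i1 (r : R) : P.-integrable setT (EFin \o (fun=> r)).
      by apply: (@bounded_integrable _ _ _ _ _ `|r|) => // o.
    have ic : P.-integrable setT (EFin \o (fun o => cos (S u o + b))).
      apply: (@bounded_integrable _ _ _ _ _ 1); last by move=> o; exact: cos_max.
      by apply: mcos; exact: measurable_funD.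
    have iG : P.-integrable setT (EFin \o (fun o => c u / 2 + (2 * c u)^-1 * S u o ^+ 2)).
      exact: (integrableD measurableT (i1 (c u / 2)) (integrableZl measurableT _ iS2)).
    have -> : \int[P]_o cos (dotr t Z0 + b) = \int[P]_o cos b.
      by apply: eq_Rintegral => o _; rewrite Z0E ?add0r.
    rewrite -(RintegralB measurableT (i1 (cos b)) ic).
    have id := integrableB measurableT (i1 (cos b)) ic.
    apply: (le_trans (le_normr_Rintegral _ id)) => //.
    apply: (@le_trans _ _ (\int[P]_o (c u / 2 + (2 * c u)^-1 * S u o ^+ 2))).
      apply: le_Rintegral => //; first exact: (integrable_norm id).
      move=> o _; apply: (le_trans (cos_1Lipschitz _ _)).
      rewrite opprD addrCA subrr addr0 normrN -subr_ge0 -[S u o ^+ 2]real_normK ?num_real//.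
      have -> : c u / 2 + (2 * c u)^-1 * `|S u o| ^+ 2 - `|S u o| =
          (`|S u o| - c u) ^+ 2 / (2 * c u) by field; rewrite gt_eqF.
      by rewrite divr_ge0 ?sqr_ge0// mulr_ge0// ltW.
    rewrite (RintegralD measurableT (i1 (c u / 2)) (integrableZl measurableT _ iS2)).
    rewrite (RintegralZl _ measurableT iS2).
    have -> : \int[P]_o (c u / 2) = c u / 2.
      by rewrite /Rintegral integral_cst//= probability_setT mule1.
    have SVR : \int[P]_o (S u o ^+ 2) <= V / u.
      rewrite -lee_fin /Rintegral fineK//; exact: (integrable_fin_num measurableT iS2).
    apply: (@le_trans _ _ (c u * (1 + 2 * V) / 2)).
      have -> : c u * (1 + 2 * V) / 2 = c u / 2 + (2 * c u)^-1 * (V / u).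
        have -> : (2 * c u)^-1 = c u * u.
          have := cu; rewrite expr2 => cu2; apply: (mulfI (lt0r_neq0 c0)).
          rewrite mulrA cu2; field; by rewrite !gt_eqF.
        by field; rewrite gt_eqF.
      by rewrite lerD2l ler_wpM2l// invr_ge0 mulr_ge0// ltW.
    apply: (le_trans (ler_norm _)); rewrite -normrN -sub0r.
    by near: u; move/cvgrPdist_le : lim0; exact.
  - by move=> v; exact: fB.
have f1Z0 : f1 Z0 = f (\row_(i < n) 1).
  by congr f; apply/rowP => i; rewrite !mxE addr0.
rewrite f1Z0 in conv.
apply: cvg_trans conv; apply: near_eq_cvg; near=> u.
have u0 : 0 < u by near: u; exact: nbhs_pinfty_gt.
congr ('E_P[_])%E; apply/funext => o; rewrite /f1; congr f; apply/rowP => i; rewrite !mxE.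
by field; rewrite gt_eqF.
Unshelve. all: by end_near. Qed.

Context (PG : probability (real_fields E R) R).
Hypothesis hPG : is_gff N PG.

Lemma occupation_central_limit :
  cvg_in_fdd P (fun u x o => (occupation_time u x o - u) / Num.sqrt (2 * u))
    PG (fun x phi => phi x).
Proof.
move=> n x f cf [B fB].
apply: (cvg_bounded_continuous (C := \sum_(j < n) fine (green N (x j) (x j))) (B := B)) => //.
- move=> u i; under eq_fun do rewrite mxE.
  apply: measurable_funM => //; apply: measurable_funB => //.
  exact: measurable_occupation_time.
- move=> i; rewrite (_ : (fun o : real_fields E R => _) = (fun phi : real_fields E R => phi (x i))).
    exact: measurable_field.
  by apply/funext => phi; rewrite mxE.
- near=> u; move=> i.
  have u0 : 0 < u by near: u; exact: nbhs_pinfty_gt.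
  under eq_integral do rewrite mxE.
  apply: (le_trans (occupation_second_moment1 (x i) _ (ltW u0))); rewrite lee_fin.
  rewrite sqr_sqrtr ?mulr_ge0 ?(ltW u0)// mulKf ?green_le//.
  by rewrite mulf_neq0// gt_eqF.
- move=> i; under eq_integral do rewrite mxE.
  by rewrite (gff_second_moment hPG) -(fineK (green_fin (x i) (x i))) lee_fin green_le.
- move=> t b.
  have -> : \int[PG]_phi cos (dotr t (\row_i phi (x i)) + b) =
      \int[PG]_phi cos (\sum_(i < n) t ord0 i * phi (x i) + b).
    apply: eq_Rintegral => phi _; congr (cos (_ + _)).
    by apply: eq_bigr => i _; rewrite mxE.
  rewrite (gff_characteristic hPG).
  have := @occupation_clt n x (t ord0) b; apply: cvg_trans; apply: near_eq_cvg.
  near=> u; apply: eq_Rintegral => o _; congr (cos (_ + _)).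
  by apply: eq_bigr => i _; rewrite mxE.
Unshelve. all: by end_near. Qed.

(** Continuous mapping: [x0] is added as a last point, and subtracting its coordinate cancels the
    centering u. *)
Lemma occupation_central_limit_increments x0 :
  cvg_in_fdd P (fun u x o => (occupation_time u x o - occupation_time u x0 o) / Num.sqrt (2 * u))
    PG (fun x phi => phi x - phi x0).
Proof.
move=> n x f cf [B fB].
pose x' (i : 'I_n.+1) := if unlift ord_max i is Some j then x j else x0.
pose diff (v : 'rV[R]_n.+1) : 'rV[R]_n := \row_i (v ord0 (lift ord_max i) - v ord0 ord_max).
have cdiff : continuous diff.
  apply: row_continuous => i; under eq_fun do rewrite mxE.
  move=> y; apply: (@cvgB R R^o _ (nbhs y) _ (fun v : 'rV[R]_n.+1 => v ord0 (lift ord_max i))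
    (fun v : 'rV[R]_n.+1 => v ord0 ord_max)); exact: coord_continuous.
have := @occupation_central_limit n.+1 x' (f \o diff) _ _.
have -> : (fun phi : real_fields E R => (f \o diff) (\row_i phi (x' i))) =
    (fun phi => f (\row_i (phi (x i) - phi x0))).
  apply/funext => phi /=; congr f; apply/rowP => i; rewrite !mxE.
  by rewrite /x' liftK unlift_none.
have -> : (fun u => 'E_P[fun o =>
      ((f \o diff) (\row_i ((occupation_time u (x' i) o - u) / Num.sqrt (2 * u))))%R])%E =
    (fun u => 'E_P[fun o =>
      (f (\row_i ((occupation_time u (x i) o - occupation_time u x0 o) / Num.sqrt (2 * u))))%R])%E.
  apply/funext => u; congr ('E_P[_])%E; apply/funext => o /=; congr f.
  apply/rowP => i; rewrite !mxE.
  by rewrite /x' liftK unlift_none; ring.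
apply.
- by move=> v; apply: continuous_comp; [exact: cdiff|exact: cf].
- by exists B => v; exact: fB.
Qed.

End occupation_field.

Theorem theorem4p1 (R : realType) (E : pointedType) (N : transient_network R E)
    (Q : {fset E} -> {finite_measure set (trajectories N) -> \bar R})
    (hQ : forall K, is_QK K (Q K))
    (nu : {sigma_finite_measure set (trajectories_mod_shift N) -> \bar R})
    (hnu : is_interlacement_measure Q nu)
    (d : measure_display) (Omega : measurableType d) (P : probability Omega R)
    (wstar : nat -> Omega -> trajectories_mod_shift N)
    (u_ : nat -> Omega -> R)
    (hu : forall i o, 0 <= u_ i o)
    (hppp : is_poisson_point_process P
      (fun o A => \sum_(0 <= i <oo) \d_(wstar i o, u_ i o) A)%E
      (interlacement_intensity nu))
    (w : nat -> Omega -> trajectories N)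
    (hw : forall i o, mod_shift (w i o) = wstar i o)
    (PG : probability (real_fields E R) R)
    (hPG : is_gff N PG)
    (x0 : E) :
  let L (u : R) (x : E) (o : Omega) : R :=
    fine (occupation (w ^~ o) (u_ ^~ o) x u) in
  [/\ cvg_in_fdd P (fun u x o => L u x o / u)
                 P (fun _ _ => 1),
      cvg_in_fdd P (fun u x o => (L u x o - u) / Num.sqrt (2 * u))
                 PG (fun x phi => phi x)
    & cvg_in_fdd P (fun u x o => (L u x o - L u x0 o) / Num.sqrt (2 * u))
                 PG (fun x phi => phi x - phi x0)].
Proof.
have gs := green_gff_sym hPG; have gf := green_gff_fin hPG.
split.
- exact: (occupation_law_of_large_numbers hQ hnu gs gf hu hppp hw).
- exact: (occupation_central_limit hQ hnu gs gf hu hppp hw hPG).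
- exact: (occupation_central_limit_increments hQ hnu gs gf hu hppp hw hPG).
Qed.
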